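(* Let $a\colon V_\infty\to(0,\infty)$ satisfy $0<a_-=\inf_{V_\infty}a\le\sup_{V_\infty}a=a_+<\infty$. Let $f\colon V\times\mathbb{R}\to\mathbb{R}$ be an $L^1$-Carathéodory function with primitive $F(\boldsymbol{x},u)=\int_0^u f(\boldsymbol{x},s)\,ds$. Assume that at least one of the following two conditions holds: (1) there exist $\alpha<a_-\lambda_1$ and $\beta\in L^1(V;\mathbb{R}_+)$ such that $F(\boldsymbol{x},u)\le\frac{\alpha}{2}|u|^2+\beta(\boldsymbol{x})$ for all $u\in\mathbb{R}$ and $\mu$-a.e. $\boldsymbol{x}\in V$; and $\lim_{u\to0}\frac{F(\boldsymbol{x},u)}{|u|^2}=\infty$ uniformly with respect to $\mu$-a.e. $\boldsymbol{x}\in V$; (2) there exist $R>0$ and $\alpha<\frac{a_-R^2}{162}$ such that $F(\boldsymbol{x},u)\le\alpha$ for all $u\in[-R,R]$ and $\mu$-a.e. $\boldsymbol{x}\in V$; and there exist $\theta>2$ and $M_0>0$ such that $0<\theta F(\boldsymbol{x},u)\le uf(\boldsymbol{x},u)$ for all $u\in(-\infty,-M_0]\cup[M_0,\infty)$ and $\mu$-a.e. $\boldsymbol{x}\in V$. Then the problem $$-\Delta_a u(\boldsymbol{x})\ni f(\boldsymbol{x},u(\boldsymbol{x}))\ \text{ for }\boldsymbol{x}\in V\setminus V_0,\qquad u(\boldsymbol{x})=0\ \text{ for }\boldsymbol{x}\in V_0,$$ has at least one nonzero solution $u\in H_0^1(V)$.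
   Context: Sierpiński gasket. Let $\boldsymbol{p}_1,\boldsymbol{p}_2,\boldsymbol{p}_3$ be the vertices of an equilateral triangle in $\mathbb{R}^2$ and $\boldsymbol{F}_i(\boldsymbol{x})=\frac{\boldsymbol{x}+\boldsymbol{p}_i}{2}$, $i\in\{1,2,3\}$. $V$ is the unique nonempty compact set with $V=\boldsymbol{F}_1(V)\cup\boldsymbol{F}_2(V)\cup\boldsymbol{F}_3(V)$, $V_0=\{\boldsymbol{p}_1,\boldsymbol{p}_2,\boldsymbol{p}_3\}$, and $\mu$ is the normalized Hausdorff measure on $V$ ($\mu(V)=1$). Let $\Sigma_n=\{1,2,3\}^n$, $\Sigma_\infty=\bigcup_{n\ge1}\Sigma_n$; for $\omega=(\omega_1,\dots,\omega_n)\in\Sigma_n$ put $\boldsymbol{F}_\omega=\boldsymbol{F}_{\omega_1}\circ\cdots\circ\boldsymbol{F}_{\omega_n}$ and $\boldsymbol{p}_\omega=\boldsymbol{F}_{\omega_1\ldots\omega_{n-1}}(\boldsymbol{p}_{\omega_n})$ (so $\boldsymbol{p}_{\omega i}=\boldsymbol{F}_\omega(\boldsymbol{p}_i)$). Let $V_\infty=\{\boldsymbol{p}_\omega:\omega\in\Sigma_\infty\}$. Energy. For $u\in C(V)$, $\mathcal{E}(u)=\lim_{n\to\infty}(5/3)^n\sum_{\omega\in\Sigma_n}\sum_{1\le i<j\le3}|u(\boldsymbol{p}_{\omega i})-u(\boldsymbol{p}_{\omega j})|^2\in[0,\infty]$ (the sequence is nondecreasing). $H_0^1(V)=\{u\in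 C(V):\mathcal{E}(u)<\infty,\ u=0\text{ on }V_0\}$ is a Hilbert space with norm $\|u\|_{H_0^1}=\sqrt{\mathcal{E}(u)}$. $\lambda_1$ is the first Dirichlet eigenvalue of the Laplacian, i.e. $\lambda_1^{-1}$ is the optimal constant in $\|u\|_{L^2(V,\mu)}^2\le\lambda_1^{-1}\|u\|_{H_0^1}^2$, $u\in H_0^1(V)$. Weighted energy. For $u\in H_0^1(V)$, $\mathcal{E}_a(u)=\limsup_{n\to\infty}(5/3)^n\sum_{\omega\in\Sigma_n}\sum_{1\le i<j\le3}\frac{a(\boldsymbol{p}_{\omega i})+a(\boldsymbol{p}_{\omega j})}{2}|u(\boldsymbol{p}_{\omega i})-u(\boldsymbol{p}_{\omega j})|^2$. The (possibly multivalued) weighted Laplacian $-\Delta_a$ is the convex subdifferential of $\frac12\mathcal{E}_a$ on $H_0^1(V)$. $L^1$-Carathéodory: $f(\cdot,u)$ is measurable for every $u\in\mathbb{R}$; $f(\boldsymbol{x},\cdot)$ is continuous for $\mu$-a.e. $\boldsymbol{x}$; for every $M>0$ there is $f_M\in L^1(V;\mathbb{R}_+)$ with $|f(\boldsymbol{x},u)|\le f_M(\boldsymbol{x})$ for $\mu$-a.e. $\boldsymbol{x}$ and all $u\in[-M,M]$. Solution: $u\in H_0^1(V)$ is a solution of the problem if it is a critical point of $I=\psi+\Phi$, with $\psi=\frac12\mathcal{E}_a$ and $\Phi(u)=-\int_V F(\boldsymbol{x},u(\boldsymbol{x}))\,d\mu$, in the sense that $-\Phi'(u)\in\partial\psi(u)$,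 i.e. $\frac12\mathcal{E}_a(v)-\frac12\mathcal{E}_a(u)-\int_V f(\boldsymbol{x},u(\boldsymbol{x}))(v(\boldsymbol{x})-u(\boldsymbol{x}))\,d\mu(\boldsymbol{x})\ge0$ for all $v\in H_0^1(V)$. *)

(* Defs.v *)
From HB Require Import structures.
From mathcomp Require Import all_boot all_order all_algebra.
From mathcomp Require Import all_classical all_reals all_analysis.

Set Implicit Arguments.
Unset Strict Implicit.
Unset Printing Implicit Defensive.
Import Order.TTheory GRing.Theory Num.Theory.
Import numFieldNormedType.Exports.

Local Open Scope classical_set_scope.
Local Open Scope ring_scope.

Section euclidean_plane.
Context {R : realType}.
Implicit Types (x y : 'rV[R]_2) (U : set 'rV[R]_2).

(* The library norm on 'rV[R]_2 is the sup norm: it gives the right topology,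
   but distances and diameters below have to be the Euclidean ones. *)
Definition eucl_dist x y : R := Num.sqrt (\sum_i (x 0 i - y 0 i) ^+ 2).

Definition eucl_diam U : \bar R :=
  ereal_sup [set (eucl_dist x y)%:E | x in U & y in U].

End euclidean_plane.

Section hausdorff_measure.
Context {R : realType} (s : R).
Implicit Types (A : set 'rV[R]_2) (U : nat -> set 'rV[R]_2) (d : R).
Local Open Scope ereal_scope.

Definition hausdorff_gauge A : \bar R :=
  if A == set0 then 0 else eucl_diam A `^ s.

Definition hausdorff_cover d A : set (nat -> set 'rV[R]_2) :=
  [set U | (forall k, eucl_diam (U k) <= d%:E) /\ A `<=` \bigcup_k U k].

Definition hausdorff_pre d A : \bar R :=
  ereal_inf [set \sum_(k <oo) hausdorff_gauge (U k) | U in hausdorff_cover d A].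

Definition hausdorff A : \bar R :=
  ereal_sup [set hausdorff_pre d A | d in [set d : R | (0 < d)%R]].

Let hausdorff_gauge_ge0 A : 0 <= hausdorff_gauge A.
Proof. by rewrite /hausdorff_gauge; case: ifP => // _; exact: poweR_ge0. Qed.

Let pregauge d A : \bar R :=
  if eucl_diam A <= d%:E then hausdorff_gauge A else +oo.

Let pregauge_ge0 d A : 0 <= pregauge d A.
Proof. by rewrite /pregauge; case: ifP. Qed.

Let pregauge0 d : pregauge d set0 = 0.
Proof.
rewrite /pregauge /hausdorff_gauge eqxx ifT// /eucl_diam.
by apply: ge_ereal_sup => _ [x []].
Qed.

Let discrete := g_sigma_algebraType [set: set 'rV[R]_2].

Let hausdorff_preE d A : hausdorff_pre d A = @mu_ext _ discrete R (pregauge d) A.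
Proof.
apply/eqP; rewrite eq_le; apply/andP; split; apply: le_ereal_inf_tmp.
- move=> _ [U [mU AU] <-].
  have [[k Uk]|allU] := pselect (exists k, ~~ (eucl_diam (U k) <= d%:E)).
    rewrite (@eseries_pinfty _ _ xpredT k) ?leey//; last first.
      by rewrite /pregauge (negbTE Uk).
    by move=> n _; rewrite gt_eqF// (lt_le_trans _ (pregauge_ge0 d (U n))).
  have UE k : eucl_diam (U k) <= d%:E.
    by apply: contrapT => /negP Uk; apply: allU; exists k.
  apply: ereal_inf_lbound; exists U; first by split.
  by apply: eq_eseriesr => k _; rewrite /pregauge UE.
- move=> _ [U [Ud AU] <-]; apply: ereal_inf_lbound; exists U.
    by split => // k; exact: sub_sigma_algebra.
  by apply: eq_eseriesr => k _; rewrite /pregauge Ud.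
Qed.

Let hausdorff_pre_le d A : (0 < d)%R -> hausdorff_pre d A <= hausdorff A.
Proof. by move=> d0; apply: ereal_sup_ubound; exists d. Qed.

Let hausdorff_ge0 A : 0 <= hausdorff A.
Proof.
apply: le_trans (hausdorff_pre_le A ltr01).
by rewrite hausdorff_preE; exact: mu_ext_ge0.
Qed.

Let hausdorff0 : hausdorff set0 = 0.
Proof.
apply/eqP; rewrite eq_le hausdorff_ge0 andbT; apply: ge_ereal_sup.
by move=> _ [d _ <-]; rewrite hausdorff_preE mu_ext0.
Qed.

Let le_hausdorff : {homo hausdorff : A B / A `<=` B >-> A <= B}.
Proof.
move=> A B AB; apply: ge_ereal_sup => _ [d d0 <-].
apply: le_trans (hausdorff_pre_le B d0).
by rewrite !hausdorff_preE; exact: le_mu_ext.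
Qed.

Let hausdorff_sigma_subadditive : sigma_subadditive hausdorff.
Proof.
move=> A; apply: ge_ereal_sup => _ [d d0 <-].
rewrite hausdorff_preE.
apply: (le_trans (@mu_ext_sigma_subadditive _ discrete R _ (pregauge_ge0 d) A)).
apply: lee_nneseries => [n _ _|n _].
  exact: (@mu_ext_ge0 _ discrete R _ (pregauge_ge0 d)).
by rewrite -hausdorff_preE; exact: hausdorff_pre_le.
Qed.

HB.instance Definition _ := isOuterMeasure.Build R 'rV[R]_2 hausdorff
  hausdorff0 hausdorff_ge0 le_hausdorff hausdorff_sigma_subadditive.

End hausdorff_measure.

Section gasket.
Context {R : realType}.
Local Notation plane := 'rV[R]_2.
Implicit Types (p : 'I_3 -> plane) (V : set plane) (u v : plane -> R).

Definition equilateral p : Prop :=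
  exists2 l : R, 0 < l & forall i j, i != j -> eucl_dist (p i) (p j) = l.

Definition Fmap p (i : 'I_3) (x : plane) : plane := 2^-1 *: (x + p i).

Definition Fword p (w : seq 'I_3) (x : plane) : plane := foldr (Fmap p) x w.

Definition is_gasket p V : Prop :=
  [/\ compact V, V !=set0 & V = \bigcup_i (Fmap p i @` V)].

(* The nonempty words are written as w followed by the letter i. *)
Definition Vinfty p : set plane :=
  [set x | exists (w : seq 'I_3) (i : 'I_3), x = Fword p w (p i)].

Definition gasket_dim : R := ln 3 / ln 2.

(* gasket_space is the whole plane with the sigma-algebra of sets that are
   Caratheodory measurable for the Hausdorff outer measure; it is complete and
   larger than the Borel sigma-algebra. *)
Definition gasket_outer_measure : {outer_measure set plane -> \bar R} :=
  hausdorff gasket_dim.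

Definition gasket_space := caratheodory_type gasket_outer_measure.

HB.instance Definition _ := Measurable.on gasket_space.

Fact gasket_scale_ge0 V : 0 <= (fine (gasket_outer_measure V))^-1.
Proof. by rewrite invr_ge0 fine_ge0// outer_measure_ge0. Qed.

(* Hausdorff measure on the plane, scaled so that V has mass 1. *)
Definition gasket_measure V : {measure set gasket_space -> \bar R} :=
  mscale (NngNum (gasket_scale_ge0 V)) 
    (gasket_outer_measure : set gasket_space -> \bar R).

Definition graph_energy p (c : plane -> plane -> R) u (n : nat) : R :=
  (5 / 3) ^+ n * \sum_(w : n.-tuple 'I_3) \sum_(i < 3) \sum_(j < 3 | (i < j)%N)
    c (Fword p w (p i)) (Fword p w (p j))
      * `|u (Fword p w (p i)) - u (Fword p w (p j))| ^+ 2.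

Definition energy p u : \bar R :=
  limn (fun n => (graph_energy p (fun _ _ => 1) u n)%:E).

Definition weighted_energy p (a : plane -> R) u : \bar R :=
  limn_esup (fun n =>
    (graph_energy p (fun x y => (a x + a y) / 2) u n)%:E).

(* Functions on V are represented by functions on the plane; no notion below
   depends on their values outside V. *)
Definition H01 p V : set (plane -> R) :=
  [set u | [/\ {within V, continuous u}, (energy p u < +oo)%E
             & forall i, u (p i) = 0]].

Definition poincare_constant p V : R :=
  inf [set C : R | forall u, H01 p V u ->
    \int[gasket_measure V]_(x in V) (`|u x| ^+ 2) <= C * fine (energy p u)].

Definition lambda1 p V : R := (poincare_constant p V)^-1.

Definition L1_Caratheodory V (f : plane -> R -> R) : Prop :=
  [/\ forall t : R, measurable_fun (V : set gasket_space) (f ^~ t),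
      {ae gasket_measure V, forall x, V x -> continuous (f x)}
    & forall M : R, 0 < M -> exists fM : plane -> R,
        [/\ (gasket_measure V).-integrable V (EFin \o fM),
            forall x, V x -> 0 <= fM x
          & {ae gasket_measure V, forall x, V x ->
              forall t, `|t| <= M -> `|f x t| <= fM x}]].

Definition primitive (f : plane -> R -> R) (x : plane) (t : R) : R :=
  if 0 <= t then \int[lebesgue_measure]_(s in `[0, t]) f x s
  else - \int[lebesgue_measure]_(s in `[t, 0]) f x s.

(* h is in (- Delta_a)(u), the subdifferential at u of half the weighted energy
   on H01, where h stands for the functional v |-> \int_V h v. *)
Definition weighted_laplacian p V (a : plane -> R) u (h : plane -> R) : Prop :=
  forall v, H01 p V v ->
    (0 <= 2^-1%:E * weighted_energy p a v - 2^-1%:E * weighted_energy p a u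
          - (\int[gasket_measure V]_(x in V) (h x * (v x - u x)))%:E)%E.

Definition solution p V a (f : plane -> R -> R) u : Prop :=
  H01 p V u /\ weighted_laplacian p V a u (fun x => f x (u x)).

End gasket.

(* Main.v *)
Require Import Defs.
From mathcomp Require Import all_boot all_order all_algebra.
From mathcomp Require Import all_classical all_reals all_analysis.
From mathcomp Require Import measurable_realfun.
From mathcomp Require Import ring lra zify.
Import Order.TTheory GRing.Theory Num.Theory.
Import numFieldNormedType.Exports.
Local Open Scope classical_set_scope.
Local Open Scope ring_scope.
Set Implicit Arguments.
Unset Strict Implicit.
Unset Printing Implicit Defensive.

(** Solutions are critical points of the action [W u / 2 - \int F x (u x)], where [W] is
the weighted energy. As an upper limit, [W] is not a quadratic form. It is however
strongly convex and 2-homogeneous ([WEnergy_comb], [WEnergyZ]), because the graph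
energies satisfy an exact convexity identity whose defect is bounded below by the
unweighted energy [En]. This replaces the Hilbert space structure: it yields the
triangle inequality for [Num.sqrt (W u)], and it turns uniformly convergent minimizing
sequences into sequences that converge in energy.

On a cell of level [n] the energy of a function is at most [(3 / 5) ^+ n] times its
total energy. Hence functions in [H01] are bounded by five times the square root of
their energy ([H01_sup]), their oscillation on small cells is uniformly small on energy
balls, and energy balls are compact for uniform convergence ([H01_compact]). The
integral terms are continuous for uniform convergence by dominated convergence, so all
passages to the limit go through compactness.

The central object is the resolvent [S u], the minimizer over [v] of
[W v / 2 - \int f x (u x) * v x]. Its fixed points are the solutions
([resolvent_fixed_solution]). On energy balls it is continuous from uniform convergence
to convergence in energy ([resolvent_cvg]), and [S u - u] is a direction of descent for
the action, with a uniform step size ([action_descent]).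

Under the first condition the Poincare inequality with its optimal constant makes the
action coercive, so that it has a minimizer, which by the descent property is a fixed
point of the resolvent. The minimum is negative, as is seen on small multiples of a bump
function [e]; hence the minimizer is not zero ([subquadratic_solution]).

Under the second condition the action is at least some [b > 0] on a sphere around zero,
while it is nonpositive at a large multiple of [e] ([action_le0_large]). A path that
joins zero to this point is moved by small steps towards the resolvent. If [S u - u] were
bounded away from zero at all [u] with action between [b / 2] and the maximum over the
path, finitely many steps would bring the path below the level [b], although it must
cross the sphere. This gives approximate critical points ([palais_smale_sequence]); the
Ambrosetti-Rabinowitz condition bounds their energy ([palais_smale_bounded]), and a
subsequence converges to a fixed point of positive action ([superquadratic_solution]).

Two facts about the gasket feed into this. Its Hausdorff measure in dimension
[ln 3 / ln 2] is positive and finite, closed sets are measurable for it and cells have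
positive measure ([hausdorff_closed_measurable], [hausdorff_gasket_gt0],
[gasket_measure_cell]). And there is a bump function in [H01], made from a harmonic
function, which is built by the rule that extends values at the vertices of a cell to
the midpoints with the least energy ([positive_H01_function]). *)

(** * Coordinates in the plane *)

Section plane.
Context {R : realType}.
Implicit Types (x y : 'rV[R]_2).

Lemma ord3_ind (P : 'I_3 -> Prop) : P 0 -> P 1 -> P 2 -> forall i, P i.
Proof.
move=> P0 P1 P2 [[|[|[|//]]] i3].
- by rewrite (_ : Ordinal _ = 0)//; exact: val_inj.
- by rewrite (_ : Ordinal _ = 1)//; exact: val_inj.
- by rewrite (_ : Ordinal _ = 2)//; exact: val_inj.
Qed.

Lemma row2P x y : x 0 0 = y 0 0 -> x 0 1 = y 0 1 -> x = y.
Proof.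
move=> e0 e1; apply/rowP => -[[|[|//]] i2].
- by rewrite (_ : Ordinal _ = 0)//; exact: val_inj.
- by rewrite (_ : Ordinal _ = 1)//; exact: val_inj.
Qed.

Lemma eucl_distE x y :
  eucl_dist x y = Num.sqrt ((x 0 0 - y 0 0) ^+ 2 + (x 0 1 - y 0 1) ^+ 2).
Proof.
rewrite /eucl_dist !big_ord_recl big_ord0 addr0.
by rewrite (_ : lift _ _ = 1)//; exact: val_inj.
Qed.

Lemma eucl_dist_ge0 x y : 0 <= eucl_dist x y.
Proof. exact: sqrtr_ge0. Qed.

Lemma eucl_distxx x : eucl_dist x x = 0.
Proof. by rewrite eucl_distE !subrr expr0n addr0 sqrtr0. Qed.

Lemma coord_le_eucl_dist i x y : `|x 0 i - y 0 i| <= eucl_dist x y.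
Proof.
rewrite -sqrtr_sqr ler_sqrt; last by rewrite sumr_ge0// => j _; exact: sqr_ge0.
by rewrite (bigD1 i)//= lerDl sumr_ge0// => j _; exact: sqr_ge0.
Qed.

Lemma norm_le_eucl_dist x y : `|x - y| <= eucl_dist x y.
Proof.
have [->|] := eqVneq `|x - y| 0; first exact: eucl_dist_ge0.
move=> _; rewrite /Num.Def.normr/= mx_normrE.
apply/bigmax_leP; split=> [|[i j] _ /=]; first exact: eucl_dist_ge0.
by rewrite !mxE (ord1 i); exact: coord_le_eucl_dist.
Qed.

Lemma coord_le_norm i x : `|x 0 i| <= `|x|.
Proof.
rewrite {2}/Num.Def.normr/= mx_normrE.
exact: (le_bigmax _ (fun ij : 'I_1 * 'I_2 => `|x ij.1 ij.2|) (0, i)).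
Qed.

Lemma eucl_dist_le_norm x y : eucl_dist x y <= 2 * `|x - y|.
Proof.
rewrite eucl_distE -(@ler_pXn2r _ 2)// ?nnegrE ?sqrtr_ge0 ?mulr_ge0//.
rewrite sqr_sqrtr ?addr_ge0 ?sqr_ge0//.
have h i : (x 0 i - y 0 i) ^+ 2 <= `|x - y| ^+ 2.
  rewrite -real_normK ?num_real// ler_pXn2r ?nnegrE//.
  by have := coord_le_norm i (x - y); rewrite !mxE.
have := h 0; have := h 1; have := sqr_ge0 `|x - y|; nra.
Qed.

Definition cross x y : R := x 0 0 * y 0 1 - x 0 1 * y 0 0.

(** With sides of length [l] at an angle of 60 degrees, Lagrange's identity
[|A|^2 |B|^2 = (A . B)^2 + cross A B ^ 2] gives [cross A B ^ 2 = 3 l^4 / 4]. *)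
Lemma equilateral_cross_neq0 (p : 'I_3 -> 'rV[R]_2) :
  equilateral p -> cross (p 1 - p 0) (p 2 - p 0) != 0.
Proof.
move=> [l l0 pl]; apply/eqP; rewrite /cross !mxE => D0.
have sq i j : i != j ->
    (p i 0 0 - p j 0 0) ^+ 2 + (p i 0 1 - p j 0 1) ^+ 2 = l ^+ 2.
  by move=> /pl; rewrite eucl_distE => <-; rewrite sqr_sqrtr// addr_ge0 ?sqr_ge0.
have h1 := sq 1 0 isT; have h2 := sq 2 0 isT; have h3 := sq 2 1 isT.
set a := p 1 0 0 - p 0 0 0 in h1 D0; set b := p 1 0 1 - p 0 0 1 in h1 D0.
set c := p 2 0 0 - p 0 0 0 in h2 D0; set d := p 2 0 1 - p 0 0 1 in h2 D0.
have h3' : (c - a) ^+ 2 + (d - b) ^+ 2 = l ^+ 2 by rewrite -h3 /a /b /c /d; ring.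
have dot : (a * c + b * d) = l ^+ 2 / 2.
  have := h3'; have -> : (c - a) ^+ 2 + (d - b) ^+ 2 =
    (c ^+ 2 + d ^+ 2) + (a ^+ 2 + b ^+ 2) - 2 * (a * c + b * d) by ring.
  rewrite h1 h2; lra.
have : (a ^+ 2 + b ^+ 2) * (c ^+ 2 + d ^+ 2) =
    (a * c + b * d) ^+ 2 + (a * d - b * c) ^+ 2 by ring.
rewrite h1 h2 dot D0 => /eqP; apply/negP.
have -> : (l ^+ 2 / 2) ^+ 2 + 0 ^+ 2 = (l ^+ 2 * l ^+ 2) / 4 by field.
have : 0 < l ^+ 2 * l ^+ 2 by rewrite mulr_gt0 ?exprn_gt0.
by move: (l ^+ 2 * l ^+ 2) => z z0; apply/eqP; lra.
Qed.

(** Everything below about the position of the cells is read off these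
coordinates, in which the contractions act by
[b_j (F_i x) = (b_j x + (i == j)) / 2]. *)
Lemma barycentric_coordinates (p : 'I_3 -> 'rV[R]_2) : equilateral p ->
  exists b : 'I_3 -> 'rV[R]_2 -> R,
  [/\ forall i x y, b i (2^-1 *: (x + y)) = 2^-1 * (b i x + b i y),
      forall i j, b i (p j) = (i == j)%:R,
      forall x, \sum_i b i x = 1,
      forall x y, (forall i, b i x = b i y) -> x = y
    & exists2 C : R, 0 < C &
        forall i x y, `|b i x - b i y| <= C * eucl_dist x y].
Proof.
move=> /equilateral_cross_neq0; set A := p 1 - p 0; set B := p 2 - p 0 => D0.
set D := cross A B in D0.
pose b1 x := cross (x - p 0) B / D; pose b2 x := cross A (x - p 0) / D.
pose b (i : 'I_3) x : R :=
  if i == 0 then 1 - b1 x - b2 x else if i == 1 then b1 x else b2 x.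
have sumb x : \sum_i b i x = 1.
  rewrite !big_ord_recl big_ord0 /b/=; ring.
exists b; split=> //.
- by elim/ord3_ind => x y; rewrite /b/= /b1 /b2 /cross !mxE; field.
- have D1 : (p 1 0 0 - p 0 0 0) * (p 2 0 1 - p 0 0 1) -
    (p 1 0 1 - p 0 0 1) * (p 2 0 0 - p 0 0 0) != 0.
    by move: D0; rewrite /D /cross /A /B !mxE.
  by elim/ord3_ind; elim/ord3_ind;
    rewrite /b/= /b1 /b2 /D /cross /A /B !mxE; field.
- move=> x y xy.
  have := xy 1; have := xy 2; rewrite /b/= /b1 /b2.
  move=> /(mulIf (invr_neq0 D0)) e2 /(mulIf (invr_neq0 D0)) e1.
  move: e1 e2 D0; rewrite /D /cross /A /B !mxE.
  set a := p 1 0 0 - _; set c := p 1 0 1 - _; set d := p 2 0 0 - _.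
  set e := p 2 0 1 - _ => e1 e2 D0.
  have f1 : (x 0 0 - y 0 0) * e = (x 0 1 - y 0 1) * d by lra.
  have f2 : a * (x 0 1 - y 0 1) = c * (x 0 0 - y 0 0) by lra.
  apply: row2P; apply/eqP; rewrite -subr_eq0; apply/eqP;
    apply: (mulIf D0); rewrite mul0r.
  + have -> : (x 0 0 - y 0 0) * (a * e - c * d) =
      a * ((x 0 0 - y 0 0) * e) - d * (c * (x 0 0 - y 0 0)) by ring.
    by rewrite f1 -f2; ring.
  + have -> : (x 0 1 - y 0 1) * (a * e - c * d) =
      e * (a * (x 0 1 - y 0 1)) - c * ((x 0 1 - y 0 1) * d) by ring.
    by rewrite f2 -f1; ring.
- pose K := `|A 0 0| + `|A 0 1| + `|B 0 0| + `|B 0 1|.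
  have K0 : 0 <= K by rewrite !addr_ge0.
  have b1K x y : `|b1 x - b1 y| <= K / `|D| * eucl_dist x y.
    rewrite (_ : _ - _ = ((x 0 0 - y 0 0) * B 0 1 - (x 0 1 - y 0 1) * B 0 0) / D);
      last by rewrite /b1 /cross !mxE; ring.
    rewrite normrM normrV ?unitfE// mulrAC ler_wpM2r ?invr_ge0//.
    rewrite (le_trans (ler_normB _ _))// !normrM.
    have := coord_le_eucl_dist 0 x y; have := coord_le_eucl_dist 1 x y.
    have := normr_ge0 (A 0 0); have := normr_ge0 (A 0 1).
    have := normr_ge0 (B 0 0); have := normr_ge0 (B 0 1).
    have := eucl_dist_ge0 x y; rewrite /K; nra.
  have b2K x y : `|b2 x - b2 y| <= K / `|D| * eucl_dist x y.
    rewrite (_ : _ - _ = (A 0 0 * (x 0 1 - y 0 1) - A 0 1 * (x 0 0 - y 0 0)) / D);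
      last by rewrite /b2 /cross !mxE; ring.
    rewrite normrM normrV ?unitfE// mulrAC ler_wpM2r ?invr_ge0//.
    rewrite (le_trans (ler_normB _ _))// !normrM.
    have := coord_le_eucl_dist 0 x y; have := coord_le_eucl_dist 1 x y.
    have := normr_ge0 (A 0 0); have := normr_ge0 (A 0 1).
    have := normr_ge0 (B 0 0); have := normr_ge0 (B 0 1).
    have := eucl_dist_ge0 x y; rewrite /K; nra.
  exists (2 * (K / `|D|) + 1) => [|i x y].
    by rewrite ltr_wpDl// mulr_ge0// divr_ge0.
  have := b1K x y; have := b2K x y; have := eucl_dist_ge0 x y.
  have : 0 <= K / `|D| * eucl_dist x y by rewrite !mulr_ge0 ?invr_ge0 ?eucl_dist_ge0.
  set k := K / `|D| => *; rewrite mulrDl mul1r -mulrA.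
  elim/ord3_ind: i; rewrite /b/=; [|lra|lra].
  rewrite (_ : _ - _ = - (b1 x - b1 y) - (b2 x - b2 y)); last ring.
  by rewrite (le_trans (ler_normB _ _))// normrN; lra.
Qed.

End plane.

(** * Cells of the gasket *)

Section gasket_geometry.
Context {R : realType} {p : 'I_3 -> 'rV[R]_2} {V : set 'rV[R]_2}.
Hypothesis gasketV : is_gasket p V.
Implicit Types (x y : 'rV[R]_2) (w : seq 'I_3).

Lemma within_continuousP (u : 'rV[R]_2 -> R) :
  {within V, continuous u} <-> forall x, V x -> forall e, 0 < e ->
    exists2 d : R, 0 < d &
      forall y, V y -> eucl_dist x y < d -> `|u x - u y| < e.
Proof.
split=> [/subspace_continuousP cu x Vx e e0|cu].
  have /cvgrPdist_lt/(_ e e0) := cu x Vx.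
  rewrite near_withinE => /nbhs_ballP[d /= d0 dP]; exists d => // y Vy xy.
  apply: dP => //; rewrite -ball_normE/=.
  exact: le_lt_trans (norm_le_eucl_dist _ _) xy.
apply/subspace_continuousP => x Vx; apply/cvgrPdist_lt => e e0.
have [d d0 dP] := cu x Vx e e0; rewrite near_withinE; apply/nbhs_ballP.
exists (d / 2); first by rewrite /= divr_gt0.
move=> y; rewrite -ball_normE/= => xy Vy; apply: dP => //.
by rewrite (le_lt_trans (eucl_dist_le_norm _ _))//; lra.
Qed.

Lemma eucl_dist_Fmap i x y :
  eucl_dist (Fmap p i x) (Fmap p i y) = 2^-1 * eucl_dist x y.
Proof.
rewrite !eucl_distE /Fmap !mxE.
have -> : (2^-1 * (x 0 0 + p i 0 0) - 2^-1 * (y 0 0 + p i 0 0)) ^+ 2 +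
  (2^-1 * (x 0 1 + p i 0 1) - 2^-1 * (y 0 1 + p i 0 1)) ^+ 2 =
  2^-1 ^+ 2 * ((x 0 0 - y 0 0) ^+ 2 + (x 0 1 - y 0 1) ^+ 2) by ring.
by rewrite sqrtrM ?sqr_ge0// sqrtr_sqr ger0_norm.
Qed.

Lemma eucl_dist_Fword w x y :
  eucl_dist (Fword p w x) (Fword p w y) = 2^-1 ^+ size w * eucl_dist x y.
Proof.
elim: w => [|i w IH] /=; first by rewrite expr0 mul1r.
by rewrite eucl_dist_Fmap IH exprS mulrA.
Qed.

Lemma Fmap_inj i : injective (Fmap p i).
Proof. by move=> x y /scalerI h; apply/addIr/h; rewrite invr_eq0 pnatr_eq0. Qed.

Lemma Fmap_vertex i : Fmap p i (p i) = p i.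
Proof. by apply: row2P; rewrite /Fmap !mxE; field. Qed.

Lemma Fmap_gasket i x : V x -> V (Fmap p i x).
Proof.
by case: gasketV => _ _ VE Vx; rewrite VE; exists i => //; exists x.
Qed.

Lemma Fword_gasket w x : V x -> V (Fword p w x).
Proof. by elim: w => //= i w IH Vx; apply/Fmap_gasket/IH. Qed.

Lemma gasket_Fmap x : V x -> exists i, exists2 y, V y & x = Fmap p i y.
Proof.
by case: gasketV => _ _ VE; rewrite {1}VE => -[i _ [y Vy <-]]; exists i, y.
Qed.

Lemma gasket_Fword n x : V x ->
  exists2 w, size w = n & exists2 y, V y & x = Fword p w y.
Proof.
elim: n x => [|n IH] x Vx; first by exists [::] => //; exists x.
have [i [y Vy ->]] := gasket_Fmap Vx; have [w wn [z Vz ->]] := IH y Vy.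
by exists (i :: w); rewrite /= ?wn//; exists z.
Qed.

(** The gasket has a point closest to [p i]; its image under [Fmap p i] is
twice as close, so that the smallest distance is 0. *)
Lemma gasket_vertex i : V (p i).
Proof.
case: (gasketV) => cV V0 _.
have [] := @compact_EVT_min _ _ (fun x => `|x - p i|) _ V0 cV.
  apply/within_continuousP => x _ e e0; exists e => // y _; apply: le_lt_trans.
  rewrite (le_trans (ler_dist_dist _ _))//.
  by rewrite (_ : _ - _ = x - y) ?norm_le_eucl_dist// opprB addrA subrK.
move=> c /set_mem Vc /(_ (Fmap p i c)); rewrite inE => /(_ (Fmap_gasket i Vc)).
have -> : Fmap p i c - p i = 2^-1 *: (c - p i).
  by apply: row2P; rewrite /Fmap !mxE; field.
rewrite normrZ ger0_norm// => h.
have : `|c - p i| = 0 by have := normr_ge0 (c - p i); lra.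
by move/normr0_eq0/eqP; rewrite subr_eq0 => /eqP <-.
Qed.

Lemma gasket_Vinfty x : Vinfty p x -> V x.
Proof. by move=> [w [i ->]]; exact/Fword_gasket/gasket_vertex. Qed.

Lemma gasket_bounded : exists2 D : R, 0 < D &
  forall x y, V x -> V y -> eucl_dist x y <= D.
Proof.
case: (gasketV) => /compact_bounded[M [_ MV]] _ _.
have VM x : V x -> `|x| <= `|M| + 1.
  by apply: MV; rewrite (le_lt_trans (ler_norm M))// ltrDl.
exists (4 * (`|M| + 1)) => [|x y Vx Vy]; first by rewrite mulr_gt0// ltr_wpDl.
rewrite (le_trans (eucl_dist_le_norm _ _))//.
by have := ler_normB x y; have := VM x Vx; have := VM y Vy; lra.
Qed.

Lemma small_cells (e : R) : 0 < e -> exists n, forall w x y, (n <= size w)%N ->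
  V x -> V y -> eucl_dist (Fword p w x) (Fword p w y) < e.
Proof.
move=> e0; have [D D0 VD] := gasket_bounded.
have : @GRing.exp R 2^-1 n @[n --> \oo] --> 0.
  by apply: cvg_expr; rewrite ger0_norm// invf_lt1// ltr1n.
move=> /cvgrPdist_lt/(_ (e / D)); rewrite divr_gt0// => /(_ isT)[n _ nP].
exists n => w x y wn Vx Vy; rewrite eucl_dist_Fword.
have := nP _ wn; rewrite sub0r normrN ger0_norm ?exprn_ge0// ltr_pdivlMr//.
by apply: le_lt_trans; rewrite ler_wpM2l ?exprn_ge0// VD.
Qed.

Lemma Fmap_continuous i : continuous (Fmap p i).
Proof.
move=> x; suff : Fmap p i y @[y --> (x : 'rV[R]_2)] --> Fmap p i x by [].
apply/(@cvgrPdist_lt _ _ _ (nbhs (x : 'rV[R]_2))) => e e0.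
apply/nbhs_ballP; exists e => // y; rewrite -ball_normE/= => xy.
rewrite (_ : _ - _ = 2^-1 *: (x - y)).
  by rewrite normrZ ger0_norm//; have := normr_ge0 (x - y); lra.
by rewrite /Fmap -scalerBr opprD addrACA subrr addr0.
Qed.

Lemma cell_compact w : compact (Fword p w @` V).
Proof.
elim: w => [|i w IH].
  by case: gasketV => + _ _; congr compact; rewrite /= image_id.
have -> : Fword p (i :: w) @` V = Fmap p i @` (Fword p w @` V).
  by rewrite -image_comp.
by apply: continuous_compact IH; apply/continuous_subspaceT/Fmap_continuous.
Qed.

Lemma cell_closed w : closed (Fword p w @` V).
Proof.
by apply: compact_closed; [exact: norm_hausdorff|exact: cell_compact].
Qed.

Lemma within_continuous_Fmap i (u : 'rV[R]_2 -> R) :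
  {within V, continuous u} -> {within V, continuous (u \o Fmap p i)}.
Proof.
move=> /within_continuousP cu; apply/within_continuousP => x Vx e e0.
have [d d0 dP] := cu _ (Fmap_gasket i Vx) _ e0.
exists d => // y Vy xy; apply: dP; first exact: Fmap_gasket.
by rewrite eucl_dist_Fmap; have := eucl_dist_ge0 x y; lra.
Qed.

(** A bound at the points of [Vinfty p] passes to the gasket, as each of its points lies
in arbitrarily small cells, and every cell contains a vertex. *)
Lemma gasket_dense (u : 'rV[R]_2 -> R) (c K : R) : {within V, continuous u} ->
  (forall w j, `|u (Fword p w (p j)) - c| <= K) ->
  forall x, V x -> `|u x - c| <= K.
Proof.
move=> /within_continuousP cu uK x Vx; apply/ler_addgt0Pr => e e0.
have [d d0 dP] := cu x Vx e e0; have [n nP] := small_cells d0.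
have [w wn [y Vy xE]] := gasket_Fword n Vx.
have := dP _ (Fword_gasket w (gasket_vertex 0)); rewrite {1}xE.
rewrite nP ?wn//; last exact: gasket_vertex.
move=> /(_ isT) ue; rewrite [leRHS]addrC.
have -> : u x - c = (u x - u (Fword p w (p 0))) + (u (Fword p w (p 0)) - c) by ring.
by rewrite (le_trans (ler_normD _ _))// lerD// ltW.
Qed.

Section bary.
Context {b : 'I_3 -> 'rV[R]_2 -> R}.
Hypothesis b_affine :
  forall i x y, b i (2^-1 *: (x + y)) = 2^-1 * (b i x + b i y).
Hypothesis b_vertex : forall i j, b i (p j) = (i == j)%:R.
Hypothesis b_sum : forall x, \sum_i b i x = 1.
Hypothesis b_inj : forall x y, (forall i, b i x = b i y) -> x = y.
Hypothesis b_lip : exists2 C : R, 0 < C &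
  forall i x y, `|b i x - b i y| <= C * eucl_dist x y.

Lemma bary_Fmap i j x : b j (Fmap p i x) = 2^-1 * (b j x + (j == i)%:R).
Proof. by rewrite /Fmap b_affine b_vertex. Qed.

Lemma bary_continuous i : {within V, continuous b i}.
Proof.
apply/within_continuousP => x Vx e e0; have [C C0 bC] := b_lip.
exists (e / C) => [|y _ xy]; first exact: divr_gt0.
by rewrite (le_lt_trans (bC _ _ _))// mulrC -ltr_pdivlMr.
Qed.

(** A point of the gasket where [b i] is smallest is [Fmap p j y] for some [y], so that
the minimum [m] satisfies [m >= m / 2]. *)
Lemma bary_ge0 i x : V x -> 0 <= b i x.
Proof.
case: (gasketV) => cV V0 _.
have [c /set_mem Vc cmin] := compact_EVT_min V0 cV (bary_continuous (i := i)).
suff c0 : 0 <= b i c by move=> Vx; apply: le_trans c0 (cmin _ _); rewrite inE.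
have [j [y Vy cE]] := gasket_Fmap Vc.
have := cmin y; rewrite inE => /(_ Vy); rewrite cE bary_Fmap.
have := ler0n R (i == j); lra.
Qed.

(** The coordinate [b i] is at least 1/2 on the cell [Fmap p i @` V], so that two
different cells of level 1 meet only at the midpoint of a side. *)
Lemma cell_intersection i j x y : V x -> V y -> i != j ->
  Fmap p i x = Fmap p j y -> x = p j /\ y = p i.
Proof.
move=> Vx Vy ij xy.
have h k : b k x + (k == i)%:R = b k y + (k == j)%:R.
  by have := congr1 (b k) xy; rewrite !bary_Fmap; lra.
have coord z l : V z -> 1 <= b l z -> z = p l.
  move=> Vz z1; have := b_sum z; rewrite (bigD1 l)//= => sz.
  have s0 : \sum_(k < 3 | k != l) b k z = 0.
    have : 0 <= \sum_(k < 3 | k != l) b k z.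
      by apply: sumr_ge0 => k _; exact: bary_ge0.
    lra.
  apply: b_inj => k; rewrite b_vertex; case: eqVneq => [->|kl].
    by move: sz; rewrite s0 addr0 => ->.
  move/eqP: s0; rewrite psumr_eq0 => [/allP|m _]; last exact: bary_ge0.
  by move=> /(_ k); rewrite mem_index_enum kl => /(_ isT)/eqP.
split; apply: coord => //.
- have := h j; rewrite eqxx eq_sym (negbTE ij) addr0 => ->.
  by rewrite lerDr bary_ge0.
- have := h i; rewrite eqxx (negbTE ij) addr0 => <-.
  by rewrite lerDr bary_ge0.
Qed.

End bary.
End gasket_geometry.

(** * Graph energies and oscillation *)

Lemma big_tuple_cons (T : Type) (idx : T) (op : Monoid.com_law idx) (I : finType)
    n (F : n.+1.-tuple I -> T) : \big[op/idx]_w F w =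
  \big[op/idx]_i \big[op/idx]_(w : n.-tuple I) F [tuple of i :: w].
Proof.
rewrite [RHS]pair_big/=.
rewrite [LHS](reindex (fun iw : I * n.-tuple I => [tuple of iw.1 :: iw.2]))//=.
exists (fun w : n.+1.-tuple I => (thead w, [tuple of behead w])).
  by move=> [i w] _; congr pair; apply/val_inj.
by move=> w _; rewrite /= [RHS]tuple_eta.
Qed.

Section graph_energy.
Context {R : realType} (p : 'I_3 -> 'rV[R]_2).
Implicit Types (x y : 'rV[R]_2) (u v : 'rV[R]_2 -> R).
Implicit Types (X Y c : 'rV[R]_2 -> 'rV[R]_2 -> R).

(** Sum over the edges of the graph of level [n], renormalized by [(5 / 3) ^+ n].
The graph energies are the values of this linear form at
[c x y * (u x - u y) ^+ 2]. *)
Definition edge_sum n X : R := (5 / 3) ^+ n * \sum_(w : n.-tuple 'I_3)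
  \sum_(i < 3) \sum_(j < 3 | (i < j)%N)
    X (Fword p w (p i)) (Fword p w (p j)).

Lemma graph_energyE c u n : graph_energy p c u n =
  edge_sum n (fun x y => c x y * (u x - u y) ^+ 2).
Proof.
rewrite /graph_energy /edge_sum; congr *%R.
apply: eq_bigr => w _; apply: eq_bigr => i _; apply: eq_bigr => j _.
by rewrite real_normK ?num_real.
Qed.

Lemma edge_sumD n X Y :
  edge_sum n (fun x y => X x y + Y x y) = edge_sum n X + edge_sum n Y.
Proof.
rewrite /edge_sum -mulrDr; congr *%R; rewrite -big_split.
apply: eq_bigr => w _; rewrite -big_split; apply: eq_bigr => i _.
by rewrite -big_split; apply: eq_bigr.
Qed.

Lemma edge_sumZ n k X : edge_sum n (fun x y => k * X x y) = k * edge_sum n X.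
Proof.
rewrite /edge_sum mulrCA; congr *%R; rewrite mulr_sumr.
apply: eq_bigr => w _; rewrite mulr_sumr; apply: eq_bigr => i _.
by rewrite mulr_sumr; apply: eq_bigr.
Qed.

Lemma eq_edge_sum n X Y : (forall x y, X x y = Y x y) ->
  edge_sum n X = edge_sum n Y.
Proof. by move=> XY; congr edge_sum; apply/funext => x; apply/funext. Qed.

Lemma le_edge_sum n X Y :
  (forall x y, Vinfty p x -> Vinfty p y -> X x y <= Y x y) ->
  edge_sum n X <= edge_sum n Y.
Proof.
move=> XY; rewrite ler_wpM2l ?exprn_ge0//.
apply: ler_sum => w _; apply: ler_sum => i _; apply: ler_sum => j _.
by apply: XY; [exists w, i|exists w, j].
Qed.

Lemma edge_sum0 n : edge_sum n (fun _ _ => 0) = 0.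
Proof.
rewrite /edge_sum big1 ?mulr0// => w _; rewrite big1// => i _.
by rewrite big1.
Qed.

Lemma edge_sumS n X : edge_sum n.+1 X =
  5 / 3 * \sum_i edge_sum n (fun x y => X (Fmap p i x) (Fmap p i y)).
Proof.
rewrite /edge_sum exprS -mulrA; congr *%R; rewrite -mulr_sumr; congr *%R.
exact: big_tuple_cons.
Qed.

Section convexity.
Context (c : 'rV[R]_2 -> 'rV[R]_2 -> R) (n : nat).
Local Notation G u := (graph_energy p c u n).

(** A quadratic form [q] satisfies
[q (t u + s v) = t q(u) + s q(v) - t s q(u - v)] when [t + s = 1]: this is
convexity together with its exact defect. *)
Lemma graph_energy_comb (t s : R) u v : t + s = 1 ->
  G (fun x => t * u x + s * v x) =
  t * G u + s * G v - t * s * G (fun x => u x - v x).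
Proof.
move=> ts; rewrite !graph_energyE -mulNr -!edge_sumZ -!edge_sumD.
apply: eq_edge_sum => x y; have -> : s = 1 - t by rewrite -ts; ring.
ring.
Qed.

Lemma graph_energyZ (t : R) u : G (fun x => t * u x) = t ^+ 2 * G u.
Proof.
by rewrite !graph_energyE -edge_sumZ; apply: eq_edge_sum => x y; ring.
Qed.

Hypothesis c_ge0 : forall x y, Vinfty p x -> Vinfty p y -> 0 <= c x y.

Lemma graph_energy_ge0 u : 0 <= G u.
Proof.
rewrite graph_energyE -(edge_sum0 n); apply: le_edge_sum => x y Vx Vy.
by rewrite mulr_ge0 ?sqr_ge0// c_ge0.
Qed.

Lemma graph_energy_le u v :
  (forall x y, Vinfty p x -> Vinfty p y -> `|u x - u y| <= `|v x - v y|) ->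
  G u <= G v.
Proof.
move=> uv; rewrite !graph_energyE; apply: le_edge_sum => x y Vx Vy.
rewrite ler_wpM2l ?c_ge0// -[leLHS]real_normK ?num_real//.
by rewrite -[leRHS]real_normK ?num_real// lerXn2r ?nnegrE ?uv.
Qed.

Lemma eq_graph_energy u v : (forall x, Vinfty p x -> u x = v x) -> G u = G v.
Proof.
move=> uv; apply/eqP; rewrite eq_le !graph_energy_le// => x y Vx Vy;
  by rewrite !uv.
Qed.

End convexity.

Lemma graph_energy_weight (m : R) c c' u n :
  (forall x y, Vinfty p x -> Vinfty p y -> m * c x y <= c' x y) ->
  m * graph_energy p c u n <= graph_energy p c' u n.
Proof.
move=> cc'; rewrite !graph_energyE -edge_sumZ; apply: le_edge_sum => x y Vx Vy.
by rewrite mulrA ler_wpM2r ?sqr_ge0 ?cc'.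
Qed.

Local Notation E n u := (graph_energy p (fun _ _ => 1) u n).

Lemma energy1_ge0 n u : 0 <= E n u.
Proof. by apply: graph_energy_ge0. Qed.

Lemma graph_energyS n u : E n.+1 u = 5 / 3 * \sum_i E n (u \o Fmap p i).
Proof.
by rewrite graph_energyE edge_sumS; under eq_bigr do rewrite -graph_energyE.
Qed.

Lemma Fmap_vertexC i j : Fmap p i (p j) = Fmap p j (p i).
Proof. by rewrite /Fmap addrC. Qed.

Lemma sum_edges3 (g : 'I_3 -> 'I_3 -> R) :
  \sum_(i < 3) \sum_(j < 3 | (i < j)%N) g i j = g 0 1 + g 0 2 + g 1 2.
Proof.
under eq_bigr do rewrite big_mkcond.
rewrite !big_ord_recl !big_ord0/= !(add0r, addr0).
have e1 : lift ord0 ord0 = 1 :> 'I_3 by exact: val_inj.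
have e2 : lift ord0 (lift ord0 ord0) = 2 :> 'I_3 by exact: val_inj.
by rewrite !e1 !e2.
Qed.

Lemma sum_ord3 (g : 'I_3 -> R) : \sum_i g i = g 0 + g 1 + g 2.
Proof.
rewrite !big_ord_recl !big_ord0/= addr0 addrA.
by congr (_ + g _ + g _); exact: val_inj.
Qed.

Lemma graph_energy0 u : E 0 u = (u (p 0) - u (p 1)) ^+ 2 +
  (u (p 0) - u (p 2)) ^+ 2 + (u (p 1) - u (p 2)) ^+ 2.
Proof.
rewrite graph_energyE /edge_sum expr0 mul1r (big_pred1 [tuple]); last first.
  by move=> w; apply/esym/eqP; exact: tuple0.
by rewrite sum_edges3/= !mul1r.
Qed.

(** For given values at the vertices, the energy of level 1 is smallest when each
midpoint gets 2/5 of the values at the ends of its side and 1/5 of the third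
value; the minimum is the energy of level 0, and the excess is a sum of squares
of the deviations [dx], [dy], [dz] from these optimal values. *)
Lemma graph_energy_mono01 u : E 0 u <= E 1 u.
Proof.
rewrite graph_energyS sum_ord3 !graph_energy0/= !Fmap_vertex.
rewrite (Fmap_vertexC 1 0) (Fmap_vertexC 2 0) (Fmap_vertexC 2 1).
set a0 := u (p 0); set a1 := u (p 1); set a2 := u (p 2).
set x := u (Fmap p 1 (p 2)); set y := u (Fmap p 0 (p 2)).
set z := u (Fmap p 0 (p 1)).
pose dx := x - (a0 + 2 * a1 + 2 * a2) / 5.
pose dy := y - (2 * a0 + a1 + 2 * a2) / 5.
pose dz := z - (2 * a0 + 2 * a1 + a2) / 5.
rewrite -subr_ge0 (_ : _ - _ = 5 / 3 * (2 * dx ^+ 2 + 2 * dy ^+ 2 + 2 * dz ^+ 2 +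
  (dx - dy) ^+ 2 + (dx - dz) ^+ 2 + (dy - dz) ^+ 2)).
  apply: mulr_ge0 => //.
  have := sqr_ge0 dx; have := sqr_ge0 dy; have := sqr_ge0 dz.
  have := sqr_ge0 (dx - dy); have := sqr_ge0 (dx - dz).
  have := sqr_ge0 (dy - dz); lra.
by rewrite /dx /dy /dz; field.
Qed.

Lemma graph_energy_mono n u : E n u <= E n.+1 u.
Proof.
elim: n u => [|n IH] u; first exact: graph_energy_mono01.
by rewrite !(graph_energyS _ u) ler_wpM2l//; apply: ler_sum => i _; exact: IH.
Qed.

Lemma graph_energy_cell n i u : E n (u \o Fmap p i) <= 3 / 5 * E n.+1 u.
Proof.
rewrite graph_energyS mulrA (_ : 3 / 5 * _ = 1) ?mul1r; last by field.
by rewrite (bigD1 i)//= lerDl sumr_ge0// => j _; exact: energy1_ge0.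
Qed.

Definition bounded_energy M u := forall n, E n u <= M ^+ 2.

Lemma bounded_energy_cell (M : R) u i : 0 <= M ->
  bounded_energy M u -> bounded_energy (4 / 5 * M) (u \o Fmap p i).
Proof.
move=> M0 uM n; rewrite (le_trans (graph_energy_cell _ _ _))//.
by have := uM n.+1; have := sqr_ge0 M; rewrite exprMn; lra.
Qed.

Lemma bounded_energy_Fword (M : R) u (w : seq 'I_3) : 0 <= M ->
  bounded_energy M u -> bounded_energy ((4 / 5) ^+ size w * M) (u \o Fword p w).
Proof.
elim: w M u => [|i w IH] M u M0 uM /=; first by rewrite expr0 mul1r.
rewrite exprSr -mulrA (_ : u \o _ = (u \o Fmap p i) \o Fword p w)//.
by apply: IH; [rewrite mulr_ge0|exact: bounded_energy_cell].
Qed.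

(** Along the chain of nested cells that leads to [Fword p w (p j)] the energies
decay by 3/5 <= (4/5)^2 at each level, so that the increments are dominated by a
geometric series of sum 5. *)
Lemma sup_bound_Vinfty (M : R) u (w : seq 'I_3) i j : 0 <= M ->
  bounded_energy M u -> `|u (Fword p w (p j)) - u (p i)| <= 5 * M.
Proof.
have vertices (N : R) v k l : 0 <= N -> bounded_energy N v ->
    `|v (p k) - v (p l)| <= N.
  move=> N0 /(_ 0); rewrite graph_energy0 => vN.
  rewrite -(@ler_pXn2r _ 2) ?nnegrE// real_normK ?num_real//.
  apply: le_trans vN; elim/ord3_ind: k; elim/ord3_ind: l;
  have := sqr_ge0 (v (p 0) - v (p 1)); have := sqr_ge0 (v (p 0) - v (p 2));
  have := sqr_ge0 (v (p 1) - v (p 2)); nra.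
elim: w i M u => [|k w IH] i M u M0 uM /=.
  by rewrite (le_trans (vertices _ _ _ _ M0 uM))//; lra.
have := IH k _ _ _ (bounded_energy_cell k M0 uM).
rewrite mulr_ge0// => /(_ isT)/=; rewrite Fmap_vertex => h.
rewrite (_ : _ - _ = (u (Fmap p k (Fword p w (p j))) - u (p k)) +
  (u (p k) - u (p i))); last by ring.
rewrite (le_trans (ler_normD _ _))//.
by have := vertices _ _ k i M0 uM; lra.
Qed.

Lemma sup_bound (V : set 'rV[R]_2) (M : R) u : is_gasket p V -> 0 <= M ->
  {within V, continuous u} -> bounded_energy M u ->
  forall i x, V x -> `|u x - u (p i)| <= 5 * M.
Proof.
move=> gV M0 cu uM i x Vx; apply: (gasket_dense gV) => // w j.
exact: sup_bound_Vinfty.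
Qed.

Lemma within_continuous_Fword (V : set 'rV[R]_2) u (w : seq 'I_3) :
  is_gasket p V -> {within V, continuous u} ->
  {within V, continuous (u \o Fword p w)}.
Proof.
move=> gV; elim: w u => //= i w IH u cu.
exact: (IH (u \o Fmap p i) (within_continuous_Fmap gV cu)).
Qed.

Lemma cell_oscillation (V : set 'rV[R]_2) (M : R) u (w : seq 'I_3) :
  is_gasket p V -> 0 <= M -> {within V, continuous u} -> bounded_energy M u ->
  forall i x, V x ->
  `|u (Fword p w x) - u (Fword p w (p i))| <= 5 * ((4 / 5) ^+ size w * M).
Proof.
move=> gV M0 cu uM i x Vx.
apply: (sup_bound (u := u \o Fword p w) gV) => //.
- by rewrite mulr_ge0// exprn_ge0.
- exact: within_continuous_Fword.
- exact: bounded_energy_Fword.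
Qed.

End graph_energy.

(** * The energy space *)

Section bounded_limsup.
Context {R : realType}.

(** The three facts about the upper limit of a bounded real sequence from which
every estimate of a weighted energy is derived. *)
Lemma limn_esup_bounded (x : nat -> R) (M : R) : (forall n, 0 <= x n <= M) ->
  exists L : R, [/\ limn_esup (fun n => (x n)%:E) = L%:E,
    forall e, 0 < e -> \forall n \near \oo, x n < L + e,
    forall c, (\forall n \near \oo, x n <= c) -> L <= c
  & forall c, (\forall n \near \oo, c <= x n) -> c <= L].
Proof.
move=> x0M; set S := limn_esup _.
have Sle c : (\forall n \near \oo, x n <= c) -> (S <= c%:E)%E.
  move=> cx; rewrite /S /limn_esup limf_esupE.
  apply: (@le_trans _ _ (ereal_sup [set (x n)%:E | n in [set n | x n <= c]])).
    by apply: ereal_inf_lbound; exists [set n | x n <= c].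
  by apply: ge_ereal_sup => _ [n /= nc <-]; rewrite lee_fin.
have leS c : (\forall n \near \oo, c <= x n) -> (c%:E <= S)%E.
  move=> cx; rewrite /S /limn_esup limf_esupE.
  apply: le_ereal_inf_tmp => _ [A /= FA <-].
  have [n [An cn]] : exists n, A n /\ c <= x n.
    exact: (filter_ex (filterI FA cx)).
  by rewrite (@le_trans _ _ (x n)%:E) ?lee_fin//; apply: ereal_sup_ubound; exists n.
have SM : (S <= M%:E)%E.
  by apply: Sle; apply: nearW => n; case/andP: (x0M n).
have S0 : (0%:E <= S)%E.
  by apply: leS; apply: nearW => n; case/andP: (x0M n).
have Sfin : S \is a fin_num by rewrite ge0_fin_numE// (le_lt_trans SM)// ltry.
exists (fine S); split.
- by rewrite fineK.
- move=> e e0; have : (S < (fine S + e)%:E)%E.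
    by rewrite -[X in (X < _)%E]fineK// lte_fin ltrDl.
  rewrite {1}/S /limn_esup limf_esupE => /ereal_inf_lt[_ [A /= FA <-] Ae].
  apply: filterS FA => n An; rewrite -lte_fin.
  by apply: le_lt_trans Ae; apply: ereal_sup_ubound; exists n.
- by move=> c /Sle; rewrite -{1}(fineK Sfin) lee_fin.
- by move=> c /leS; rewrite -{1}(fineK Sfin) lee_fin.
Qed.

End bounded_limsup.

Section energy_space.
Context {R : realType} {p : 'I_3 -> 'rV[R]_2} {V : set 'rV[R]_2}.
Hypothesis gasketV : is_gasket p V.
Local Notation fct := ('rV[R]_2 -> R).
Local Notation E n u := (graph_energy p (fun _ _ => 1) u n).
Implicit Types (u v : 'rV[R]_2 -> R) (x : 'rV[R]_2).
Implicit Types (us vs : nat -> 'rV[R]_2 -> R).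

Definition finite_energy u : Prop := exists M, forall n, E n u <= M.

Definition Energy u : R := fine (energy p u).

Lemma energy_nd u : nondecreasing_seq (fun n => (E n u)%:E).
Proof.
by apply/nondecreasing_seqP => n; rewrite lee_fin graph_energy_mono.
Qed.

Lemma energy_sup u : energy p u = ereal_sup (range (fun n => (E n u)%:E)).
Proof. by apply/cvg_lim => //; exact/ereal_nondecreasing_cvgn/energy_nd. Qed.

Lemma energy_ge0 u : (0 <= energy p u)%E.
Proof.
rewrite energy_sup (@le_trans _ _ (E 0 u)%:E) ?lee_fin ?energy1_ge0//.
by apply: ereal_sup_ubound; exists 0.
Qed.

Lemma finite_energyP u : (energy p u < +oo)%E <-> finite_energy u.
Proof.
split=> [uoo|[M uM]]; last first.
  rewrite energy_sup (@le_lt_trans _ _ M%:E) ?ltry//.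
  by apply: ge_ereal_sup => _ [n _ <-]; rewrite lee_fin.
have fin : energy p u \is a fin_num by rewrite ge0_fin_numE// energy_ge0.
exists (fine (energy p u)) => n; rewrite -lee_fin fineK// energy_sup.
by apply: ereal_sup_ubound; exists n.
Qed.

Lemma EnergyE u : finite_energy u -> energy p u = (Energy u)%:E.
Proof.
by move=> /finite_energyP uoo; rewrite fineK// ge0_fin_numE// energy_ge0.
Qed.

Lemma Energy_ge0 u : 0 <= Energy u.
Proof. by rewrite fine_ge0// energy_ge0. Qed.

Lemma graph_energy_le_Energy n u : finite_energy u -> E n u <= Energy u.
Proof.
move=> fu; rewrite -lee_fin -EnergyE// energy_sup.
by apply: ereal_sup_ubound; exists n.
Qed.

Lemma Energy_le u (M : R) : (forall n, E n u <= M) -> Energy u <= M.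
Proof.
move=> uM; have fu : finite_energy u by exists M.
rewrite -lee_fin -EnergyE// energy_sup.
by apply: ge_ereal_sup => _ [n _ <-]; rewrite lee_fin.
Qed.

Lemma cvg_graph_energy u : finite_energy u -> E n u @[n --> \oo] --> Energy u.
Proof.
move=> fu; have : (E n u)%:E @[n --> \oo] --> (Energy u)%:E.
  by rewrite -EnergyE// energy_sup; exact/ereal_nondecreasing_cvgn/energy_nd.
by move/fine_cvgP => -[].
Qed.

Lemma finite_energy_comb (t s : R) u v : finite_energy u -> finite_energy v ->
  finite_energy (fun x => t * u x + s * v x).
Proof.
move=> [M uM] [N vN]; exists (2 * t ^+ 2 * M + 2 * s ^+ 2 * N) => n.
have t0 : 0 <= 2 * t ^+ 2 by rewrite mulr_ge0// sqr_ge0.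
have s0 : 0 <= 2 * s ^+ 2 by rewrite mulr_ge0// sqr_ge0.
apply: (@le_trans _ _ (2 * t ^+ 2 * E n u + 2 * s ^+ 2 * E n v)); last first.
  by rewrite lerD// ler_wpM2l.
rewrite !graph_energyE -!edge_sumZ -edge_sumD; apply: le_edge_sum => x y _ _.
have := sqr_ge0 (t * (u x - u y) - s * (v x - v y)); nra.
Qed.

Lemma finite_energyB u v : finite_energy u -> finite_energy v ->
  finite_energy (fun x => u x - v x).
Proof.
move=> fu fv; have := finite_energy_comb 1 (-1) fu fv.
by under eq_fun do rewrite mul1r mulN1r.
Qed.

Lemma finite_energyZ (t : R) u : finite_energy u ->
  finite_energy (fun x => t * u x).
Proof.
move=> fu; have := finite_energy_comb t 0 fu fu.
by rewrite (_ : (fun x => _ + _) = fun x => t * u x)//; apply/funext => x; ring.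
Qed.

Lemma bounded_energy_Energy u : finite_energy u ->
  bounded_energy p (Num.sqrt (Energy u)) u.
Proof.
by move=> fu n; rewrite sqr_sqrtr ?Energy_ge0// graph_energy_le_Energy.
Qed.

Section uniform_convergence.

Definition uconv (us : nat -> fct) u : Prop := forall e, 0 < e ->
  \forall n \near \oo, forall x, V x -> `|us n x - u x| < e.

Definition econv (us : nat -> fct) u : Prop := forall e, 0 < e ->
  \forall n \near \oo, Energy (fun x => us n x - u x) <= e.

Lemma uconv_cvg us u x : uconv us u -> V x -> us n x @[n --> \oo] --> u x.
Proof.
move=> uu Vx; apply/cvgrPdist_lt => e e0; near=> n.
by rewrite distrC; move: x Vx; near: n; exact: uu.
Unshelve. all: by end_near. Qed.

Lemma uconv_sub us u (k : nat -> nat) : (forall n, (n <= k n)%N) ->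
  uconv us u -> uconv (us \o k) u.
Proof.
move=> kn uu e e0; have [N _ NP] := uu e e0; exists N => // n /= Nn x Vx.
by apply: NP => //=; exact: leq_trans Nn (kn n).
Qed.

Lemma uconv_cst u : uconv (fun=> u) u.
Proof. by move=> e e0; apply: nearW => n x _; rewrite subrr normr0. Qed.

Lemma uconv_comb (t s : R) us u vs v : uconv us u -> uconv vs v ->
  uconv (fun n x => t * us n x + s * vs n x) (fun x => t * u x + s * v x).
Proof.
move=> uu vv e e0; have K0 : 0 < `|t| + `|s| + 1 by rewrite ltr_wpDl ?addr_ge0.
near=> n => x Vx.
have ux : `|us n x - u x| < e / (`|t| + `|s| + 1).
  by move: x Vx; near: n; apply: uu; rewrite divr_gt0.
have vx : `|vs n x - v x| < e / (`|t| + `|s| + 1).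
  by move: x Vx {ux}; near: n; apply: vv; rewrite divr_gt0.
rewrite (_ : _ - _ = t * (us n x - u x) + s * (vs n x - v x)); last by ring.
rewrite (le_lt_trans (ler_normD _ _))// !normrM.
have : e / (`|t| + `|s| + 1) * (`|t| + `|s| + 1) = e by rewrite divfK ?lt0r_neq0.
have : 0 < e / (`|t| + `|s| + 1) by rewrite divr_gt0.
move: ux vx; move: (e / (`|t| + `|s| + 1)) => d.
have := normr_ge0 t; have := normr_ge0 s; nra.
Unshelve. all: by end_near. Qed.

Lemma uconv_within_continuous us u : (forall n, {within V, continuous us n}) ->
  uconv us u -> {within V, continuous u}.
Proof.
move=> cu uu; apply/within_continuousP => x Vx e e0.
have e3 : 0 < e / 3 by rewrite divr_gt0.
have [N _ /(_ N (leqnn N)) NP] := uu _ e3.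
have /within_continuousP/(_ x Vx _ e3)[d d0 dP] := cu N.
exists d => // y Vy xy; have := dP y Vy xy; have := NP x Vx; have := NP y Vy.
rewrite !ltr_norml => *; lra.
Qed.

Lemma uconv_graph_energy us u n : uconv us u -> E n (us k) @[k --> \oo] --> E n u.
Proof.
move=> uu; rewrite graph_energyE; under eq_fun do rewrite graph_energyE.
rewrite /edge_sum; apply: cvgMr.
apply: cvg_big => [|w _]; first exact: add_continuous.
apply: cvg_big => [|i _]; first exact: add_continuous.
apply: cvg_big => [|j _]; first exact: add_continuous.
have uc k : us m (Fword p w (p k)) @[m --> \oo] --> u (Fword p w (p k)).
  by apply: uconv_cvg => //; exact: (Fword_gasket gasketV _ (gasket_vertex gasketV _)).
by apply: cvgMr; apply: cvgM; apply: cvgB.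
Qed.

Lemma uconv_graph_energy_le us u n (M : R) : uconv us u ->
  (\forall k \near \oo, E n (us k) <= M) -> E n u <= M.
Proof.
move=> uu uM; have h := uconv_graph_energy (n := n) uu.
by rewrite -(cvg_lim (@Rhausdorff R) h); apply: limr_le => //; apply/cvg_ex; eexists; exact: h.
Qed.

End uniform_convergence.

Lemma H01P u : H01 p V u <->
  [/\ {within V, continuous u}, finite_energy u & forall i, u (p i) = 0].
Proof. by split=> -[? /finite_energyP ? ?]. Qed.

Lemma H01_finite u : H01 p V u -> finite_energy u.
Proof. by case=> _ /finite_energyP. Qed.

Lemma within_continuous_comb (t s : R) u v :
  {within V, continuous u} -> {within V, continuous v} ->
  {within V, continuous (fun x => t * u x + s * v x)}.
Proof.
move=> cu cv; apply: (uconv_within_continuous _ (uconv_cst _)) => _.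
move=> x; apply: (@continuousD _ _ (subspace V)); apply: (@continuousM _ (subspace V)).
- exact: cst_continuous.
- exact: cu.
- exact: cst_continuous.
- exact: cv.
Qed.

Lemma H01_comb (t s : R) u v : H01 p V u -> H01 p V v ->
  H01 p V (fun x => t * u x + s * v x).
Proof.
move=> /H01P[cu fu u0] /H01P[cv fv v0]; apply/H01P; split.
- exact: within_continuous_comb.
- exact: finite_energy_comb.
- by move=> i; rewrite u0 v0 !mulr0 addr0.
Qed.

Lemma H01B u v : H01 p V u -> H01 p V v -> H01 p V (fun x => u x - v x).
Proof.
move=> Hu Hv; have := H01_comb 1 (-1) Hu Hv.
by under eq_fun do rewrite mul1r mulN1r.
Qed.

Lemma H01Z (t : R) u : H01 p V u -> H01 p V (fun x => t * u x).
Proof.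
move=> Hu; have := H01_comb t 0 Hu Hu.
by under eq_fun do rewrite mul0r addr0.
Qed.

Lemma H01_sup u : H01 p V u -> forall x, V x -> `|u x| <= 5 * Num.sqrt (Energy u).
Proof.
move=> /H01P[cu fu u0] x Vx.
have := sup_bound gasketV (sqrtr_ge0 _) cu (bounded_energy_Energy fu) 0 Vx.
by rewrite u0 subr0.
Qed.

Lemma H01_sup_le u (M : R) : 0 <= M -> H01 p V u -> Energy u <= M ^+ 2 ->
  forall x, V x -> `|u x| <= 5 * M.
Proof.
move=> M0 Hu uM x Vx; rewrite (le_trans (H01_sup Hu Vx))//.
by rewrite ler_wpM2l// -(ger0_norm M0) -sqrtr_sqr ler_sqrt ?sqr_ge0.
Qed.

Lemma econv_uconv us u : (forall n, H01 p V (us n)) -> H01 p V u ->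
  econv us u -> uconv us u.
Proof.
move=> Hu_ Hu uu e e0; near=> n => x Vx.
have : Energy (fun x => us n x - u x) <= (e / 6) ^+ 2.
  by near: n; apply: uu; rewrite exprn_gt0// divr_gt0.
have e6 : 0 <= e / 6 by rewrite divr_ge0// ltW.
move=> /(H01_sup_le e6 (H01B (Hu_ n) Hu))/(_ x Vx).
by move=> /le_lt_trans; apply; lra.
Unshelve. all: by end_near. Qed.

Lemma Energy_lsc us u (M : R) : uconv us u -> (forall n, finite_energy (us n)) ->
  (\forall k \near \oo, Energy (us k) <= M) -> Energy u <= M.
Proof.
move=> uu fu uM; apply: Energy_le => n; apply: (uconv_graph_energy_le uu).
by apply: filterS uM => k; apply: le_trans; exact: graph_energy_le_Energy.
Qed.

Lemma H01_uconv us u (M : R) : uconv us u -> (forall n, H01 p V (us n)) ->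
  (forall n, Energy (us n) <= M) -> H01 p V u.
Proof.
move=> uu Hu uM; apply/H01P; split.
- by apply: (uconv_within_continuous _ uu) => n; case: (Hu n).
- exists M => n; apply: (uconv_graph_energy_le uu); apply: nearW => k.
  by apply: le_trans (uM k); apply: graph_energy_le_Energy; exact: H01_finite.
- move=> i; have /(@cvg_lim _ (@Rhausdorff R)) := uconv_cvg uu (gasket_vertex gasketV i).
  have -> : (fun n => us n (p i)) = fun=> 0.
    by apply/funext => n; case: (Hu n).
  by move=> <-; exact: lim_cst.
Qed.

(** Completeness: by lower semicontinuity the uniform limit of a Cauchy sequence
is also its limit in energy. *)
Lemma econv_cauchy us u : uconv us u -> (forall n, finite_energy (us n)) ->
  (forall e, 0 < e -> exists N, forall m n, (N <= m)%N -> (N <= n)%N ->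
     Energy (fun x => us n x - us m x) <= e) -> econv us u.
Proof.
move=> uu fu cu e e0; have [N NP] := cu e e0; exists N => // n /= Nn.
apply: (@Energy_lsc (fun m x => us n x - us m x)).
- have := uconv_comb 1 (-1) (uconv_cst (us n)) uu.
  have h (a b : R) : 1 * a + -1 * b = a - b by ring.
  by under eq_fun do (under eq_fun do rewrite h); under [X in uconv _ X]eq_fun do rewrite h.
- by move=> m; exact: finite_energyB.
- by exists N => // m /= Nm; exact: NP.
Qed.

(** Compactness of energy balls in the uniform norm: in the pointwise limit along
an ultrafilter the oscillation on cells of a large level is uniformly small, and
there are finitely many such cells. *)
Lemma H01_compact us (M : R) : (forall n, H01 p V (us n)) ->
  (forall n, Energy (us n) <= M) ->
  exists (k : nat -> nat) u,
    [/\ forall n, (n <= k n)%N, H01 p V u & uconv (us \o k) u].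
Proof.
move=> Hu uM; pose N := Num.sqrt `|M|.
have N0 : 0 <= N by exact: sqrtr_ge0.
have uN n : Energy (us n) <= N ^+ 2.
  by rewrite sqr_sqrtr// (le_trans (uM n))// ler_norm.
(* The pointwise limit [u] of [us] along an ultrafilter [U] that refines [\oo]. *)
have [U [UU sU]] := ultraFilterLemma (eventually_filter : ProperFilter \oo).
have bnd n x : V x -> `|us n x| <= 5 * N by move=> Vx; exact: H01_sup_le.
have lim_ x : V x -> exists l : R, us n x @[n --> U] --> l.
  move=> Vx; have := @segment_compact R (- (5 * N)) (5 * N).
  rewrite compact_ultra => /(_ (us n x @[n --> U]))/(_ _ _)[].
  - split=> [|G GP sG]; first exact: fmap_proper_filter.
    apply/seteqP; split=> // A GA.
    have [//|UA] := in_ultra_setVsetC ((fun n => us n x) @^-1` A) UU.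
    have /(filterI GA) : G (~` A) by exact: sG.
    by rewrite setICr => /filter_not_empty.
  - apply: (@filterS _ U _ setT) => [n _|]; last exact: filterT.
    by rewrite /= in_itv/=; have := bnd n x Vx; rewrite ler_norml.
  - by move=> l [_ ul]; exists l.
pose u x := if pselect (V x) is left Vx then projT1 (cid (lim_ x Vx)) else 0.
have ul x : V x -> us n x @[n --> U] --> u x.
  by move=> Vx; rewrite /u; case: pselect => // Vx'; case: cid.
have osc n (w : seq 'I_3) y : V y ->
    `|us n (Fword p w y) - us n (Fword p w (p 0))| <= 5 * ((4 / 5) ^+ size w * N).
  move=> Vy; apply: (@cell_oscillation R p V N (us n) w gasketV N0) => //.
    by case: (Hu n).
  move=> m; rewrite (le_trans _ (uN n))//.
  by apply: graph_energy_le_Energy; exact: H01_finite.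
have oscu (w : seq 'I_3) y : V y ->
    `|u (Fword p w y) - u (Fword p w (p 0))| <= 5 * ((4 / 5) ^+ size w * N).
  move=> Vy; have h : `|us n (Fword p w y) - us n (Fword p w (p 0))| @[n --> U]
      --> `|u (Fword p w y) - u (Fword p w (p 0))|.
    apply: cvg_norm; apply: cvgB; apply: ul; apply: Fword_gasket => //.
    exact: (gasket_vertex gasketV 0).
  rewrite -(cvg_lim (@Rhausdorff R) h); apply: limr_le.
    by apply/cvg_ex; eexists; exact: h.
  by apply: nearW => n; exact: osc.
have unif e : 0 < e -> U [set n | forall x, V x -> `|us n x - u x| < e].
  move=> e0; have [m mP] : exists m, 5 * ((4 / 5) ^+ m * N) < e / 3.
    have : 5 * ((4 / 5) ^+ m * N) @[m --> \oo] --> 5 * (0 * N).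
      apply: cvgMr; apply: cvgMl; apply: cvg_expr.
      by rewrite ger0_norm// ltr_pdivrMr// mul1r ltr_nat.
    move=> /cvgrPdist_lt/(_ (e / 3)); rewrite divr_gt0// => /(_ isT)[m _ mP].
    exists m; have := mP m (leqnn m); rewrite mul0r mulr0 sub0r normrN.
    exact: le_lt_trans (ler_norm _).
  have vert : U [set n | forall w : m.-tuple 'I_3,
      `|us n (Fword p w (p 0)) - u (Fword p w (p 0))| < e / 3].
    apply: filter_forall => w.
    have /ul/cvgrPdist_lt/(_ (e / 3)) : V (Fword p w (p 0)).
      exact: (Fword_gasket gasketV _ (gasket_vertex gasketV _)).
    rewrite divr_gt0// => /(_ isT); apply: filterS => n.
    by rewrite distrC.
  apply: filterS vert => n /= vert x Vx.
  have [w wm [y Vy ->]] := gasket_Fword gasketV m Vx.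
  have := vert (Tuple (introT eqP wm)) => /=.
  have := osc n w y Vy; have := oscu w y Vy; rewrite wm.
  rewrite ltr_norml [`|u _ - _| <= _]ler_norml [`|us n _ - us n _| <= _]ler_norml.
  rewrite ltr_norml; lra.
have ex m : exists n, (m <= n)%N /\
    forall x, V x -> `|us n x - u x| < m.+1%:R^-1.
  have U1 : U [set n | forall x, V x -> `|us n x - u x| < m.+1%:R^-1].
    by apply: unif; rewrite invr_gt0.
  have U2 : U [set n | (m <= n)%N] by apply: sU; exists m.
  by have [n [nm nP]] := filter_ex (filterI U2 U1); exists n.
have [k kP] := choice ex.
have uu : uconv (us \o k) u.
  move=> e e0; have [m _ mP] := near_infty_natSinv_lt (PosNum e0).
  exists m => // n mn x Vx; have [_ /(_ x Vx)] := kP n.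
  by move=> /lt_trans; apply; exact: mP.
exists k, u; split=> //; first by move=> n; case: (kP n).
by apply: (H01_uconv uu) => n; [exact: Hu|exact: uM].
Qed.

End energy_space.

Arguments finite_energy {R} p u.
Arguments Energy {R} p u.
Arguments uconv {R} V us u.
Arguments econv {R} p us u.

(** * The weighted energy *)

Section weighted_energy.
Context {R : realType} {p : 'I_3 -> 'rV[R]_2} {V : set 'rV[R]_2}.
Context {a : 'rV[R]_2 -> R} {am ap : R}.
Hypothesis gasketV : is_gasket p V.
Hypothesis am_gt0 : 0 < am.
Hypothesis am_le : forall x, Vinfty p x -> am <= a x.
Hypothesis le_ap : forall x, Vinfty p x -> a x <= ap.
Local Notation fct := ('rV[R]_2 -> R).
Local Notation E n u := (graph_energy p (fun _ _ => 1) u n).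
Local Notation G n u := (graph_energy p (fun x y => (a x + a y) / 2) u n).
Implicit Types (u v : 'rV[R]_2 -> R) (us : nat -> 'rV[R]_2 -> R).

Definition WEnergy u : R := fine (weighted_energy p a u).

Let weight x y : Vinfty p x -> Vinfty p y -> am <= (a x + a y) / 2 <= ap.
Proof.
move=> Vx Vy; have := am_le Vx; have := am_le Vy.
by have := le_ap Vx; have := le_ap Vy; lra.
Qed.

Let G_ge n u : am * E n u <= G n u.
Proof.
apply: graph_energy_weight => x y Vx Vy; rewrite mulr1.
by have /andP[] := weight Vx Vy.
Qed.

Let G_le n u : G n u <= ap * E n u.
Proof.
rewrite !graph_energyE -edge_sumZ; apply: le_edge_sum => x y Vx Vy.
by rewrite mul1r ler_wpM2r ?sqr_ge0//; have /andP[] := weight Vx Vy.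
Qed.

Let ap_gt0 : 0 < ap.
Proof.
apply: (lt_le_trans am_gt0); have Vp : Vinfty p (p 0) by exists [::], 0.
exact: le_trans (am_le Vp) (le_ap Vp).
Qed.

Lemma WEnergyP u : finite_energy p u ->
  [/\ weighted_energy p a u = (WEnergy u)%:E,
    forall e, 0 < e -> \forall n \near \oo, G n u < WEnergy u + e,
    forall c, (\forall n \near \oo, G n u <= c) -> WEnergy u <= c
  & forall c, (\forall n \near \oo, c <= G n u) -> c <= WEnergy u].
Proof.
move=> fu; have [|L [LE h1 h2 h3]] :=
    @limn_esup_bounded R (fun n => G n u) (ap * Energy p u).
  move=> n; apply/andP; split.
    by apply: le_trans (G_ge n u); rewrite mulr_ge0 ?energy1_ge0// ltW.
  by rewrite (le_trans (G_le n u))// ler_wpM2l ?graph_energy_le_Energy// ltW.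
by rewrite /WEnergy /weighted_energy LE.
Qed.

Lemma WEnergy_ge u : finite_energy p u -> am * Energy p u <= WEnergy u.
Proof.
move=> fu; have [_ _ _ h] := WEnergyP fu.
apply/ler_addgt0Pr => e e0; rewrite -lerBlDr; apply: h.
have /cvgrPdist_lt/(_ (e / am)) := cvg_graph_energy fu.
rewrite divr_gt0// => /(_ isT); apply: filterS => n nP.
apply: le_trans (G_ge n u); rewrite lerBlDr -lerBlDl -mulrBr.
by rewrite mulrC -ler_pdivlMr// (le_trans (ler_norm _))// ltW.
Qed.

Lemma WEnergy_le u : finite_energy p u -> WEnergy u <= ap * Energy p u.
Proof.
move=> fu; have [_ _ h _] := WEnergyP fu; apply: h; apply: nearW => n.
by rewrite (le_trans (G_le n u))// ler_wpM2l ?graph_energy_le_Energy// ltW.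
Qed.

Lemma WEnergy_ge0 u : finite_energy p u -> 0 <= WEnergy u.
Proof.
move=> fu; apply: le_trans (WEnergy_ge fu).
by rewrite mulr_ge0 ?Energy_ge0// ltW.
Qed.

(** The upper limit is not quadratic any more, but the convexity defect of the
graph energies survives in the limit because they dominate [am] times the
unweighted ones, which converge: the weighted energy is strongly convex. *)
Lemma WEnergy_comb (t s : R) u v : 0 <= t -> 0 <= s -> t + s = 1 ->
  finite_energy p u -> finite_energy p v ->
  WEnergy (fun x => t * u x + s * v x) <=
  t * WEnergy u + s * WEnergy v - t * s * am * Energy p (fun x => u x - v x).
Proof.
move=> t0 s0 ts fu fv.
have [_ hu _ _] := WEnergyP fu; have [_ hv _ _] := WEnergyP fv.
have [_ _ h _] := WEnergyP (finite_energy_comb t s fu fv).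
have fuv := finite_energyB fu fv.
have k0 : 0 <= t * s * am by rewrite !mulr_ge0// ltW.
apply/ler_addgt0Pr => e e0; apply: h.
have d0 : 0 < e / (1 + t * s * am) by rewrite divr_gt0// ltr_pwDl.
near=> n; rewrite graph_energy_comb//.
have uP : G n u < WEnergy u + e / (1 + t * s * am) by near: n; exact: hu.
have vP : G n v < WEnergy v + e / (1 + t * s * am) by near: n; exact: hv.
have uvP : `|Energy p (fun x => u x - v x) - E n (fun x => u x - v x)| <
    e / (1 + t * s * am).
  by near: n; move/cvgrPdist_lt: (cvg_graph_energy fuv); apply.
have := G_ge n (fun x => u x - v x); move: uP vP uvP.
have : e / (1 + t * s * am) * (1 + t * s * am) = e.
  by rewrite divfK// lt0r_neq0// ltr_pwDl.
have d0' := d0; move: (e / _) d0' => d d0' <- uP vP /ltr_normlW uvP gP.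
have : t * G n u <= t * (WEnergy u + d) by rewrite ler_wpM2l// ltW.
have : s * G n v <= s * (WEnergy v + d) by rewrite ler_wpM2l// ltW.
have : t * s * (am * E n (fun x => u x - v x)) <= t * s * G n (fun x => u x - v x).
  by rewrite ler_wpM2l// mulr_ge0.
have : t * s * am * Energy p (fun x => u x - v x) <=
    t * s * am * (E n (fun x => u x - v x) + d).
  by rewrite ler_wpM2l//; lra.
have : t * d + s * d = d by rewrite -mulrDl ts mul1r.
lra.
Unshelve. all: by end_near. Qed.

Lemma eq_Energy u v : (forall x, V x -> u x = v x) -> Energy p u = Energy p v.
Proof.
move=> uv; rewrite /Energy /energy; congr (fine (limn _)); apply/funext => n.
by congr EFin; apply: eq_graph_energy => // x /(gasket_Vinfty gasketV)/uv.
Qed.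

Lemma eq_WEnergy u v : (forall x, V x -> u x = v x) -> WEnergy u = WEnergy v.
Proof.
move=> uv; rewrite /WEnergy /weighted_energy; congr (fine (limn_esup _)).
apply/funext => n; congr EFin; apply: eq_graph_energy => [x y Vx Vy|].
  by have /andP[+ _] := weight Vx Vy; apply: le_trans; exact: ltW.
by move=> x /(gasket_Vinfty gasketV)/uv.
Qed.

Lemma EnergyZ (t : R) u : finite_energy p u ->
  Energy p (fun x => t * u x) = t ^+ 2 * Energy p u.
Proof.
move=> fu; have ft := finite_energyZ t fu.
have h := cvg_graph_energy ft; have h' := cvg_graph_energy fu.
rewrite -(cvg_lim (@Rhausdorff R) h); apply/cvg_lim => //.
by under eq_fun do rewrite graph_energyZ; exact: cvgMr.
Qed.

Lemma EnergyC u v : Energy p (fun x => u x - v x) = Energy p (fun x => v x - u x).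
Proof.
rewrite /Energy /energy; congr (fine (limn _)); apply/funext => n.
congr EFin; rewrite !graph_energyE; apply: eq_edge_sum => x y; ring.
Qed.

Lemma WEnergyZ_le (t : R) u : finite_energy p u -> t != 0 ->
  WEnergy (fun x => t * u x) <= t ^+ 2 * WEnergy u.
Proof.
move=> fu t0; have ft := finite_energyZ t fu.
have [_ _ h _] := WEnergyP ft; have [_ hu _ _] := WEnergyP fu.
apply/ler_addgt0Pr => e e0; apply: h.
have t2 : 0 < t ^+ 2 by rewrite exprn_even_gt0.
have := hu (e / t ^+ 2); rewrite divr_gt0// => /(_ isT); apply: filterS => n nP.
rewrite graph_energyZ (_ : _ + e = t ^+ 2 * (WEnergy u + e / t ^+ 2)).
  by rewrite ler_wpM2l// ltW.
by rewrite mulrDr mulrCA divff ?mulr1// lt0r_neq0.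
Qed.

Lemma WEnergyZ (t : R) u : finite_energy p u ->
  WEnergy (fun x => t * u x) = t ^+ 2 * WEnergy u.
Proof.
move=> fu; have ft := finite_energyZ t fu.
have [->|t0] := eqVneq t 0.
  rewrite expr0n/= mul0r; apply/eqP; rewrite eq_le.
  have f0 := finite_energyZ 0 fu.
  rewrite WEnergy_ge0// andbT (le_trans (WEnergy_le f0))//.
  by rewrite EnergyZ// expr0n/= mul0r mulr0.
apply/eqP; rewrite eq_le WEnergyZ_le//=.
have := WEnergyZ_le ft (invr_neq0 t0).
under eq_fun do rewrite mulrA mulVf// mul1r.
by rewrite exprVn ler_pdivlMl// exprn_even_gt0.
Qed.

Lemma Energy_comb (t s : R) u v : 0 <= t -> 0 <= s -> t + s = 1 ->
  finite_energy p u -> finite_energy p v ->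
  Energy p (fun x => t * u x + s * v x) <= t * Energy p u + s * Energy p v.
Proof.
move=> t0 s0 ts fu fv; apply: Energy_le => n; rewrite graph_energy_comb//.
have := energy1_ge0 p n (fun x => u x - v x).
have := ler_wpM2l t0 (graph_energy_le_Energy n fu).
have := ler_wpM2l s0 (graph_energy_le_Energy n fv).
have : 0 <= t * s by exact: mulr_ge0.
nra.
Qed.

Section triangle.
Context (Q : fct -> R).
Hypothesis Q_ge0 : forall u, finite_energy p u -> 0 <= Q u.
Hypothesis QZ : forall (t : R) u, finite_energy p u ->
  Q (fun x => t * u x) = t ^+ 2 * Q u.
Hypothesis Q_convex : forall (t s : R) u v, 0 <= t -> 0 <= s -> t + s = 1 ->
  finite_energy p u -> finite_energy p v ->
  Q (fun x => t * u x + s * v x) <= t * Q u + s * Q v.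

(** Convexity and 2-homogeneity make the square root a seminorm: for
[A > sqrt (Q u)] and [B > sqrt (Q v)], the function [(u + v) / (A + B)] is a convex
combination of [u / A] and [v / B], which lie in the unit ball. *)
Lemma sqrt_triangle u v : finite_energy p u -> finite_energy p v ->
  Num.sqrt (Q (fun x => u x + v x)) <= Num.sqrt (Q u) + Num.sqrt (Q v).
Proof.
move=> fu fv; apply/ler_addgt0Pr => e e0.
pose A := Num.sqrt (Q u) + e / 2; pose B := Num.sqrt (Q v) + e / 2.
have e2 : 0 < e / 2 by rewrite divr_gt0.
have A0 : 0 < A by rewrite ltr_wpDl ?sqrtr_ge0.
have B0 : 0 < B by rewrite ltr_wpDl ?sqrtr_ge0.
have AB0 : 0 < A + B by rewrite addr_gt0.
have QA : Q u <= A ^+ 2.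
  rewrite -[leLHS]sqr_sqrtr ?Q_ge0// ler_pXn2r ?nnegrE ?sqrtr_ge0//.
    by rewrite lerDl ltW.
  exact: ltW.
have QB : Q v <= B ^+ 2.
  rewrite -[leLHS]sqr_sqrtr ?Q_ge0// ler_pXn2r ?nnegrE ?sqrtr_ge0//.
    by rewrite lerDl ltW.
  exact: ltW.
have An0 := lt0r_neq0 A0; have Bn0 := lt0r_neq0 B0; have ABn0 := lt0r_neq0 AB0.
have h1 : 0 <= A / (A + B) by rewrite divr_ge0// ltW.
have h2 : 0 <= B / (A + B) by rewrite divr_ge0// ltW.
have h3 : A / (A + B) + B / (A + B) = 1 by rewrite -mulrDl divff.
have := Q_convex h1 h2 h3
  (finite_energyZ ((A + B) / A) fu) (finite_energyZ ((A + B) / B) fv).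
have -> : (fun x => A / (A + B) * ((A + B) / A * u x) +
    B / (A + B) * ((A + B) / B * v x)) = (fun x => u x + v x).
  by apply/funext => x; field; rewrite An0 Bn0 ABn0.
rewrite !QZ// => h.
have -> : Num.sqrt (Q u) + Num.sqrt (Q v) + e = A + B by rewrite /A /B; lra.
rewrite -(ger0_norm (ltW AB0)) -sqrtr_sqr ler_sqrt ?sqr_ge0// (le_trans h)//.
rewrite (_ : _ + _ = (A + B) * (Q u / A + Q v / B)); last first.
  by field; rewrite An0 Bn0 ABn0.
rewrite expr2 ler_pM2l// lerD// ler_pdivrMr// -expr2//.
Qed.

End triangle.

Lemma sqrt_Energy_triangle u v : finite_energy p u -> finite_energy p v ->
  Num.sqrt (Energy p (fun x => u x + v x)) <=
  Num.sqrt (Energy p u) + Num.sqrt (Energy p v).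
Proof.
by apply: sqrt_triangle => *; [exact: Energy_ge0|exact: EnergyZ|exact: Energy_comb].
Qed.

Lemma sqrt_WEnergy_triangle u v : finite_energy p u -> finite_energy p v ->
  Num.sqrt (WEnergy (fun x => u x + v x)) <=
  Num.sqrt (WEnergy u) + Num.sqrt (WEnergy v).
Proof.
apply: sqrt_triangle => *; [exact: WEnergy_ge0|exact: WEnergyZ|].
rewrite (le_trans (WEnergy_comb _ _ _ _ _))//.
by rewrite gerBl !mulr_ge0 ?Energy_ge0// ltW.
Qed.

Lemma finite_energyD u v : finite_energy p u -> finite_energy p v ->
  finite_energy p (fun x => u x + v x).
Proof.
move=> fu fv; have := finite_energy_comb 1 1 fu fv.
by under eq_fun do rewrite !mul1r.
Qed.

Lemma EnergyD_le u v : finite_energy p u -> finite_energy p v ->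
  Energy p (fun x => u x + v x) <= 2 * Energy p u + 2 * Energy p v.
Proof.
move=> fu fv; have := sqrt_Energy_triangle fu fv.
have h w : Energy p w = Num.sqrt (Energy p w) ^+ 2 by rewrite sqr_sqrtr ?Energy_ge0.
rewrite [X in _ -> X <= _]h [X in _ -> _ <= 2 * X + _]h [X in _ -> _ <= _ + 2 * X]h.
have := sqrtr_ge0 (Energy p u); have := sqrtr_ge0 (Energy p v).
have := sqrtr_ge0 (Energy p (fun x => u x + v x)).
set x := Num.sqrt _; set y := Num.sqrt _; set z := Num.sqrt _ => x0 z0 y0 xyz.
have : x ^+ 2 <= (z + y) ^+ 2 by rewrite lerXn2r ?nnegrE ?addr_ge0.
have := sqr_ge0 (y - z); nra.
Qed.

Lemma EnergyB_le u v : finite_energy p u -> finite_energy p v ->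
  Energy p (fun x => u x - v x) <= 2 * Energy p u + 2 * Energy p v.
Proof.
move=> fu fv; have := EnergyD_le fu (finite_energyZ (-1) fv).
rewrite EnergyZ// sqrrN expr1n mul1r.
by under eq_fun do rewrite mulN1r.
Qed.

Lemma WEnergy_cvg us u : (forall n, finite_energy p (us n)) ->
  finite_energy p u -> econv p us u -> WEnergy (us n) @[n --> \oo] --> WEnergy u.
Proof.
move=> fus fu uu.
have sq w : finite_energy p w -> WEnergy w = Num.sqrt (WEnergy w) * Num.sqrt (WEnergy w).
  by move=> fw; rewrite -expr2 sqr_sqrtr// WEnergy_ge0.
rewrite (sq u)//; under eq_fun do rewrite sq//.
suff h : Num.sqrt (WEnergy (us n)) @[n --> \oo] --> Num.sqrt (WEnergy u) by exact: cvgM.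
apply/cvgrPdist_le => e e0.
have := uu (e ^+ 2 / ap); rewrite divr_gt0 ?exprn_gt0// => /(_ isT).
apply: filterS => n; rewrite ler_pdivlMr// mulrC => h.
have small v w : finite_energy p v -> finite_energy p w ->
    ap * Energy p (fun x => v x - w x) <= e ^+ 2 ->
    Num.sqrt (WEnergy v) <= Num.sqrt (WEnergy w) + e.
  move=> fv fw vw; have := sqrt_WEnergy_triangle (finite_energyB fv fw) fw.
  have -> : (fun x => v x - w x + w x) = v by apply/funext => x; rewrite subrK.
  move=> /le_trans; apply; rewrite addrC lerD2l.
  rewrite -(ger0_norm (ltW e0)) -sqrtr_sqr ler_sqrt ?sqr_ge0//.
  exact: le_trans (WEnergy_le (finite_energyB fv fw)) vw.
have h1 := small _ _ (fus n) fu h.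
have h2 : Num.sqrt (WEnergy u) <= Num.sqrt (WEnergy (us n)) + e.
  by apply: small => //; rewrite EnergyC.
by rewrite ler_norml; lra.
Qed.

End weighted_energy.

Arguments WEnergy {R} p a u.

(** * Harmonic functions *)

Section geometric_convergence.
Context {R : realType}.

Lemma geometric_cvg (s : nat -> R) (K q : R) : 0 <= q < 1 ->
  (forall n, `|s n.+1 - s n| <= K * q ^+ n) ->
  exists l, forall n, `|s n - l| <= K / (1 - q) * q ^+ n.
Proof.
move=> /andP[q0 q1] sK; have q1' : 0 < 1 - q by rewrite subr_gt0.
pose lo n := s n - K / (1 - q) * q ^+ n; pose hi n := s n + K / (1 - q) * q ^+ n.
have CE : K / (1 - q) * (1 - q) = K by rewrite divfK// lt0r_neq0.
have step n : K / (1 - q) * q ^+ n - K / (1 - q) * q ^+ n.+1 = K * q ^+ n.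
  by rewrite -[in RHS]CE exprS; ring.
have lonD n : lo n <= lo n.+1.
  by have := sK n; rewrite ler_norml /lo; have := step n; lra.
have hinI n : hi n.+1 <= hi n.
  by have := sK n; rewrite ler_norml /hi; have := step n; lra.
have lohi n : lo n <= hi n.
  have K0 : 0 <= K by have := sK 0; rewrite expr0 mulr1; apply: le_trans.
  have : 0 <= K / (1 - q) * q ^+ n by rewrite !mulr_ge0 ?exprn_ge0 ?invr_ge0// ltW.
  by rewrite /lo /hi; lra.
have lo_mono m n : (m <= n)%N -> lo m <= lo n.
  by move: m n; apply/nondecreasing_seqP.
have hi_mono m n : (m <= n)%N -> hi n <= hi m.
  by apply: (@homo_leq _ hi (fun x y => y <= x)) => // y x z /[swap]; exact: le_trans.
have bd n : ubound (range lo) (hi n).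
  move=> _ [m _ <-]; have [mn|/ltnW nm] := leqP m n.
    exact: le_trans (lo_mono _ _ mn) (lohi n).
  exact: le_trans (lohi m) (hi_mono _ _ nm).
exists (sup (range lo)) => n.
have h1 : lo n <= sup (range lo).
  by apply: ub_le_sup; [exists (hi 0); exact: bd|exists n].
have h2 : sup (range lo) <= hi n by apply: ge_sup => //; exists (lo 0); exists 0.
by move: h1 h2; rewrite ler_norml /lo /hi; lra.
Qed.

End geometric_convergence.

Section harmonic_function.
Context {R : realType} {p : 'I_3 -> 'rV[R]_2} {V : set 'rV[R]_2}.
Hypothesis gasketV : is_gasket p V.
Context {b : 'I_3 -> 'rV[R]_2 -> R}.
Hypothesis b_affine :
  forall i x y, b i (2^-1 *: (x + y)) = 2^-1 * (b i x + b i y).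
Hypothesis b_vertex : forall i j, b i (p j) = (i == j)%:R.
Hypothesis b_sum : forall x, \sum_i b i x = 1.
Hypothesis b_inj : forall x y, (forall i, b i x = b i y) -> x = y.
Hypothesis b_lip : exists2 C : R, 0 < C &
  forall i x y, `|b i x - b i y| <= C * eucl_dist x y.
Implicit Types (c : 'I_3 -> R) (x y : 'rV[R]_2).
Local Notation E n u := (graph_energy p (fun _ _ => 1) u n).

(** Boundary values on the cell [i] of the energy minimizer with boundary values
[c]: the 2/5-2/5-1/5 rule of [graph_energy_mono01]. *)
Definition harmonic_step (i : 'I_3) c (j : 'I_3) : R :=
  if i == j then c i else (c 0 + c 1 + c 2 + c i + c j) / 5.

Lemma harmonic_stepC i j c : harmonic_step i c j = harmonic_step j c i.
Proof. by rewrite /harmonic_step eq_sym; case: eqVneq => [->//|_]; congr (_ / _); ring. Qed.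

Definition spread c : R := `|c 0 - c 1| + `|c 0 - c 2| + `|c 1 - c 2|.

Lemma spread_ge0 c : 0 <= spread c.
Proof. by rewrite !addr_ge0. Qed.

Lemma spread_ge c i j : `|c i - c j| <= spread c.
Proof.
have := normr_ge0 (c 0 - c 1); have := normr_ge0 (c 0 - c 2).
have := normr_ge0 (c 1 - c 2); rewrite /spread.
elim/ord3_ind: i; elim/ord3_ind: j; rewrite ?subrr ?normr0 //;
  rewrite ?(distrC (c 2)) ?(distrC (c 1) (c 0)); lra.
Qed.

(** On the cells of level [n] the boundary values differ by at most [(3 / 5) ^+ n] times
their initial spread: this makes the approximations below converge uniformly. *)
Lemma spread_step i c : spread (harmonic_step i c) <= 3 / 5 * spread c.
Proof.
rewrite /spread; set X := `|c 0 - c 1|; set Y := `|c 0 - c 2|.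
set Z := `|c 1 - c 2|.
have hX : - X <= c 0 - c 1 <= X by rewrite -ler_norml.
have hY : - Y <= c 0 - c 2 <= Y by rewrite -ler_norml.
have hZ : - Z <= c 1 - c 2 <= Z by rewrite -ler_norml.
elim/ord3_ind: i; rewrite /harmonic_step/=.
- have h1 : `|c 0 - (c 0 + c 1 + c 2 + c 0 + c 1) / 5| <= (2 * X + Y) / 5.
    by rewrite ler_norml; lra.
  have h2 : `|c 0 - (c 0 + c 1 + c 2 + c 0 + c 2) / 5| <= (X + 2 * Y) / 5.
    by rewrite ler_norml; lra.
  have h3 : `|(c 0 + c 1 + c 2 + c 0 + c 1) / 5 -
      (c 0 + c 1 + c 2 + c 0 + c 2) / 5| <= Z / 5 by rewrite ler_norml; lra.
  lra.
- have h1 : `|(c 0 + c 1 + c 2 + c 1 + c 0) / 5 - c 1| <= (2 * X + Z) / 5.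
    by rewrite ler_norml; lra.
  have h2 : `|(c 0 + c 1 + c 2 + c 1 + c 0) / 5 -
      (c 0 + c 1 + c 2 + c 1 + c 2) / 5| <= Y / 5 by rewrite ler_norml; lra.
  have h3 : `|c 1 - (c 0 + c 1 + c 2 + c 1 + c 2) / 5| <= (X + 2 * Z) / 5.
    by rewrite ler_norml; lra.
  lra.
- have h1 : `|(c 0 + c 1 + c 2 + c 2 + c 0) / 5 -
      (c 0 + c 1 + c 2 + c 2 + c 1) / 5| <= X / 5 by rewrite ler_norml; lra.
  have h2 : `|(c 0 + c 1 + c 2 + c 2 + c 0) / 5 - c 2| <= (2 * Y + Z) / 5.
    by rewrite ler_norml; lra.
  have h3 : `|(c 0 + c 1 + c 2 + c 2 + c 1) / 5 - c 2| <= (Y + 2 * Z) / 5.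
    by rewrite ler_norml; lra.
  lra.
Qed.

Lemma harmonic_step_between (m M : R) c i j : (forall k, m <= c k <= M) ->
  m <= harmonic_step i c j <= M.
Proof.
move=> cmM; rewrite /harmonic_step; case: eqP => // _.
by have := cmM 0; have := cmM 1; have := cmM 2; have := cmM i; have := cmM j; lra.
Qed.

Definition cell_index x : 'I_3 :=
  if pselect (exists i, exists2 y, V y & x = Fmap p i y) is left H
  then projT1 (cid H) else 0.

Lemma cell_indexP x : V x -> exists2 y, V y & x = Fmap p (cell_index x) y.
Proof.
move=> Vx; rewrite /cell_index; case: pselect => [H|[]]; last exact: gasket_Fmap.
by case: cid => i /= [y Vy xE]; exists y.
Qed.

(** Approximation of the harmonic function with boundary values [c]: affine on
each cell of level [n]. *)
Fixpoint harmonic_approx n c x : R :=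
  if n is n'.+1 then
    harmonic_approx n' (harmonic_step (cell_index x) c)
      (2 *: x - p (cell_index x))
  else \sum_i c i * b i x.

Lemma double_Fmap i y : 2 *: Fmap p i y - p i = y.
Proof. by apply: row2P; rewrite /Fmap !mxE; field. Qed.

Lemma harmonic_approx_vertex n c j : harmonic_approx n c (p j) = c j.
Proof.
elim: n c => [|n IH] c /=.
  rewrite (bigD1 j)//= b_vertex eqxx mulr1 big1 ?addr0// => i ij.
  by rewrite b_vertex (negbTE ij) mulr0.
have [y Vy] := cell_indexP (gasket_vertex gasketV j).
move: (cell_index _) => k pjE.
have [kj|kj] := eqVneq k j; last first.
  have := cell_intersection gasketV b_affine b_vertex b_sum b_inj b_lip
    (gasket_vertex gasketV j) Vy _ (etrans (Fmap_vertex j) pjE).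
  rewrite eq_sym => /(_ kj)[pjk _]; have := b_vertex k j.
  rewrite pjk b_vertex eqxx (negbTE kj) => /eqP.
  by rewrite oner_eq0.
have -> : 2 *: p j - p k = p j.
  by rewrite kj -{1}(Fmap_vertex j) double_Fmap.
by rewrite IH /harmonic_step kj eqxx.
Qed.

(** The choice of a cell by [cell_index] does not matter: the common point of two cells
is the image of a vertex under both maps, and both cells prescribe the same value
there. *)
Lemma harmonic_approx_Fmap n c i y : V y ->
  harmonic_approx n.+1 c (Fmap p i y) =
  harmonic_approx n (harmonic_step i c) y.
Proof.
move=> Vy; have [z Vz] := cell_indexP (Fmap_gasket gasketV i Vy).
rewrite /=; move: (cell_index _) => j yzE; rewrite yzE double_Fmap.
have [ij|ij] := eqVneq i j; first by move: yzE; rewrite ij => /Fmap_inj ->.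
have [-> ->] := cell_intersection gasketV b_affine b_vertex b_sum b_inj b_lip
    Vy Vz ij yzE.
by rewrite !harmonic_approx_vertex harmonic_stepC.
Qed.

Lemma harmonic_approx_between n (m M : R) c x : (forall k, m <= c k <= M) -> V x ->
  m <= harmonic_approx n c x <= M.
Proof.
elim: n c x => [|n IH] c x cmM Vx.
  have -> : m = \sum_i m * b i x by rewrite -mulr_sumr b_sum mulr1.
  have -> : M = \sum_i M * b i x by rewrite -mulr_sumr b_sum mulr1.
  have b0 i := bary_ge0 gasketV b_affine b_vertex b_lip i Vx.
  by apply/andP; split; apply: ler_sum => i _; rewrite ler_wpM2r//;
    have /andP[] := cmM i.
have [i [y Vy ->]] := gasket_Fmap gasketV Vx.
rewrite harmonic_approx_Fmap//; apply: IH => // k.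
exact: harmonic_step_between.
Qed.

Lemma harmonic_approx_step n c x : V x ->
  `|harmonic_approx n.+1 c x - harmonic_approx n c x| <= 2 * spread c * (3 / 5) ^+ n.
Proof.
elim: n c x => [|n IH] c x Vx; have [i [y Vy xE]] := gasket_Fmap gasketV Vx.
  have near d z : V z -> `|harmonic_approx 0 d z - d i| <= spread d.
    move=> Vz; rewrite ler_norml.
    have := @harmonic_approx_between 0 (d i - spread d) (d i + spread d) d z.
    move=> /(_ _ Vz) h; suff /h : forall k, d i - spread d <= d k <= d i + spread d by lra.
    by move=> k; have := spread_ge d k i; rewrite ler_norml; lra.
  have := near c x Vx; have := near (harmonic_step i c) y Vy.
  rewrite xE harmonic_approx_Fmap// expr0 mulr1 {2}/harmonic_step eqxx.
  have := spread_step i c; have := spread_ge0 c.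
  rewrite !ler_norml; lra.
rewrite xE !(harmonic_approx_Fmap _ _ _ Vy).
have := IH (harmonic_step i c) y Vy; move=> /le_trans; apply.
rewrite exprS mulrA ler_wpM2r ?exprn_ge0//.
by have := spread_step i c; lra.
Qed.

Lemma harmonic_approx_continuous n c : {within V, continuous (harmonic_approx n c)}.
Proof.
elim: n c => [|n IH] c.
  have cb i := bary_continuous (V := V) b_lip (i := i).
  have -> : harmonic_approx 0 c =
      (fun x => 1 * (c 0 * b 0 x + c 1 * b 1 x) + c 2 * b 2 x).
    by apply/funext => x; rewrite /= sum_ord3 mul1r.
  by apply: within_continuous_comb => //; exact: within_continuous_comb.
have piece i : {within Fmap p i @` V, continuous (harmonic_approx n.+1 c)}.
  apply/within_continuousP => _ [y Vy <-] e e0.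
  have /within_continuousP/(_ y Vy e e0)[d d0 dP] := IH (harmonic_step i c).
  exists (d / 2); first by rewrite divr_gt0.
  move=> _ [z Vz <-]; rewrite eucl_dist_Fmap => yz.
  by rewrite !harmonic_approx_Fmap// dP//; lra.
have clo i : closed (Fmap p i @` V).
  exact: (@cell_closed _ _ _ gasketV [:: i]).
case: (gasketV) => _ _ ->.
have -> : \bigcup_i (Fmap p i @` V) =
    Fmap p 0 @` V `|` (Fmap p 1 @` V `|` Fmap p 2 @` V).
  apply/seteqP; split=> [x [i _]|x [|[|]] Fx]; last 3 first.
    by exists 0. by exists 1. by exists 2.
  by elim/ord3_ind: i => h; [left|right; left|right; right].
apply: withinU_continuous => //; first exact: closedU.
exact: withinU_continuous.
Qed.

(** The harmonic functions of the gasket, obtained as uniform limits of functions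
that are affine on cells; their energies are constant in the level because the
step rule is the one that minimizes the energy. *)
Lemma harmonic_functions : exists h : ('I_3 -> R) -> 'rV[R]_2 -> R,
  [/\ forall c, {within V, continuous (h c)},
      forall c j, h c (p j) = c j,
      forall c i y, V y -> h c (Fmap p i y) = h (harmonic_step i c) y,
      forall c (m M : R) x, (forall k, m <= c k <= M) -> V x -> m <= h c x <= M
    & forall c, finite_energy p (h c)].
Proof.
have q35 : 0 <= (3 / 5 : R) < 1 by apply/andP; split; lra.
have ex_lim c x : V x -> exists l, forall n, `|harmonic_approx n c x - l| <=
    5 * spread c * (3 / 5) ^+ n.
  move=> Vx; have [l lP] := geometric_cvg q35 (fun n => harmonic_approx_step n c Vx).
  exists l => n; rewrite (le_trans (lP n))//.
  rewrite (_ : 2 * spread c / (1 - 3 / 5) = 5 * spread c)//; by field.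
pose h c x := if pselect (V x) is left Vx then projT1 (cid (ex_lim c x Vx)) else 0.
have hP c x n : V x -> `|harmonic_approx n c x - h c x| <= 5 * spread c * (3 / 5) ^+ n.
  by rewrite /h; case: pselect => // Vx _; case: cid.
have cvg0 (K : R) : K * (3 / 5) ^+ n @[n --> \oo] --> 0.
  rewrite -(mulr0 K); apply: cvgMr; apply: cvg_expr.
  by rewrite ger0_norm; lra.
have uh c : uconv V (fun n => harmonic_approx n c) (h c).
  move=> e e0; have /cvgrPdist_lt/(_ e e0) := cvg0 (5 * spread c).
  apply: filterS => n; rewrite sub0r normrN => nP x Vx.
  by rewrite (le_lt_trans (hP c x n Vx))// (le_lt_trans (ler_norm _)).
have hh c x : V x -> harmonic_approx n c x @[n --> \oo] --> h c x.
  by move=> Vx; exact: (uconv_cvg (uh c) Vx).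
have hv c j : h c (p j) = c j.
  have := hh c _ (gasket_vertex gasketV j) => /(@cvg_lim _ (@Rhausdorff R)) <-.
  by under eq_fun do rewrite harmonic_approx_vertex; exact: lim_cst.
have hF c i y : V y -> h c (Fmap p i y) = h (harmonic_step i c) y.
  move=> Vy; have := hh c _ (Fmap_gasket gasketV i Vy).
  rewrite -cvg_shiftS; under eq_fun do rewrite harmonic_approx_Fmap//.
  move=> h1; exact: (cvg_unique (@Rhausdorff R) h1 (hh _ _ Vy)).
exists h; split=> // [c|c m M x cmM Vx|c].
- by apply: uconv_within_continuous (uh c) => n; exact: harmonic_approx_continuous.
- have hx := hh c x Vx; apply/andP; split.
    rewrite -(cvg_lim (@Rhausdorff R) hx); apply: limr_ge.
      by apply/cvg_ex; eexists; exact: hx.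
    by apply: nearW => n; have /andP[] := harmonic_approx_between n cmM Vx.
  rewrite -(cvg_lim (@Rhausdorff R) hx); apply: limr_le.
    by apply/cvg_ex; eexists; exact: hx.
  by apply: nearW => n; have /andP[] := harmonic_approx_between n cmM Vx.
- exists ((c 0 - c 1) ^+ 2 + (c 0 - c 2) ^+ 2 + (c 1 - c 2) ^+ 2) => n.
  rewrite le_eqVlt; apply/orP; left; apply/eqP.
  elim: n c => [|n IH] c; first by rewrite graph_energy0 !hv.
  rewrite graph_energyS.
  under eq_bigr => i _.
    rewrite (@eq_graph_energy _ _ _ _ _ _ (h (harmonic_step i c))) ?IH//; last first.
      by move=> x /(gasket_Vinfty gasketV) Vx /=; exact: hF.
    over.
  by rewrite sum_ord3 /harmonic_step/=; field.
Qed.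

(** A product [h (1 - h)], with [h] harmonic and equal to 1 at one vertex and to 0
at the two others. On the cell of the word [2; 1] the values of [h] lie between 1/5
and 2/5. *)
Lemma positive_H01_function : exists e : 'rV[R]_2 -> R,
  [/\ H01 p V e, forall x, V x -> 0 <= e x
    & forall y, V y -> 4 / 25 <= e (Fmap p 2 (Fmap p 1 y))].
Proof.
have [h [hc hv hF hb hE]] := harmonic_functions.
pose c (k : 'I_3) : R := if k == 1 then 1 else 0.
have h01 x : V x -> 0 <= h c x <= 1.
  by apply: hb => k; rewrite /c; case: eqP; rewrite ?lexx ler01.
exists (fun x => h c x * (1 - h c x)); split.
- apply/H01P; split.
  + have -> : (fun x => h c x * (1 - h c x)) = (fun x => h c x - h c x ^+ 2).
      by apply/funext => x; ring.
    move=> x; apply: (@continuousB _ _ (subspace V)); first exact: hc.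
    by apply: (@continuousM _ (subspace V)); exact: hc.
  + have [M hM] := hE c; exists M => n; rewrite (le_trans _ (hM n))//.
    apply: graph_energy_le => // x y /(gasket_Vinfty gasketV) Vx.
    move=> /(gasket_Vinfty gasketV) Vy.
    rewrite (_ : _ - _ = (h c x - h c y) * (1 - h c x - h c y)); last ring.
    rewrite normrM ler_piMr// ler_norml.
    by have := h01 x Vx; have := h01 y Vy; lra.
  + by move=> i; rewrite hv /c; case: eqP => _; ring.
- by move=> x /h01 /andP[? ?]; rewrite mulr_ge0// subr_ge0.
- move=> y Vy; rewrite (hF _ _ _ (Fmap_gasket gasketV 1 Vy)) (hF _ _ _ Vy).
  set d := harmonic_step 1 _.
  have : 1 / 5 <= h d y <= 2 / 5.
    apply: hb => // k; rewrite /d /harmonic_step /c.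
    by elim/ord3_ind: k => /=; lra.
  by move=> /andP[? ?]; nra.
Qed.

End harmonic_function.

(** * Hausdorff measure *)

Section metric_outer_measure.
Context {R : realType} {n : nat} (mu : {outer_measure set 'rV[R]_n -> \bar R}).
Hypothesis mu_metric : forall (A B : set 'rV[R]_n) (r : R), 0 < r ->
  (forall x y, A x -> B y -> r <= `|x - y|) ->
  (mu A + mu B <= mu (A `|` B))%E.

(** The set [A] minus the closed set [C] is the increasing union of the sets
[far m] of points at distance at least [1 / (m + 1)] from [C]. The layers
[far (m + 1) \ far m] of equal parity are at positive distances from one another,
so that the sum of their measures is finite and the measure of [far m] tends to
that of [A \ C]. *)
Lemma closed_caratheodory (C : set 'rV[R]_n) : closed C ->
  mu.-caratheodory C.
Proof.
move=> cC; apply: le_caratheodory_measurable => A.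
have [->|muA] := eqVneq (mu A) +oo%E; first by rewrite leey.
have muAfin B : B `<=` A -> mu B \is a fin_num.
  move=> BA; rewrite ge0_fin_numE ?outer_measure_ge0//.
  by rewrite (le_lt_trans (le_outer_measure mu _ _ BA))// ltey.
pose far m := A `&` [set x | forall y, C y -> m.+1%:R^-1 <= `|x - y|].
have far_nd l m : (l <= m)%N -> far l `<=` far m.
  move=> lm x [Ax xl]; split=> // y Cy; apply: le_trans (xl y Cy).
  by rewrite lef_pV2 ?posrE// ler_nat.
have farA m : far m `<=` A by move=> x [].
pose layer m := far m.+1 `\` far m.
have gap m B : B `<=` far m -> forall D, D `<=` A `\` far m.+1 ->
    (mu B + mu D <= mu (B `|` D))%E.
  move=> Bm D Dm; apply: (mu_metric (r := m.+1%:R^-1 - m.+2%:R^-1)).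
    by rewrite subr_gt0 ltf_pV2 ?posrE// ltr_nat.
  move=> x z /Bm[Ax xm] /Dm[Az /not_andP[//|]].
  move=> /existsNP[y] /not_implyP[Cy /negP]; rewrite -ltNge => zy.
  rewrite lerBlDr; apply: le_trans (xm y Cy) _.
  have := ler_normD (x - z) (z - y); rewrite addrA subrK => /le_trans; apply.
  by rewrite lerD2l ltW.
have parity j N : (\sum_(k < N.+1) mu (layer (k.*2 + j)%N) <= mu (far (N.*2 + j)%N.+1))%E.
  elim: N => [|N IH]; first by rewrite big_ord1 le_outer_measure// => x [].
  rewrite big_ord_recr/= (le_trans (leeD IH (lexx _)))//.
  have lay : layer (N.+1.*2 + j) `<=` A `\` far (N.*2 + j).+2.
    by move=> x [xf nx]; split; [exact: farA xf|rewrite doubleS in nx].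
  rewrite (le_trans (gap _ _ (@subset_refl _ _) _ lay))//.
  apply: le_outer_measure => x [|[]]; last by [].
  by apply: far_nd; rewrite doubleS !addSn; exact: leq_trans (leqnSn _) (leqnSn _).
have sum_layer : (\sum_(k <oo) mu (layer k) < +oo)%E.
  have A2 : (mu A + mu A < +oo)%E by rewrite lte_add_pinfty// ltey.
  apply: le_lt_trans A2; apply: lime_le.
    by apply: is_cvg_nneseries => k _ _; exact: outer_measure_ge0.
  apply: nearW => N.
  apply: (@le_trans _ _ (\sum_(0 <= k < N.+1.*2) mu (layer k))%E).
    rewrite [leRHS](@big_cat_nat _ _ _ N)//=; last first.
      by rewrite doubleS -addnn -addn2 -addnA leq_addr.
    by rewrite leeDl// sume_ge0// => k _; exact: outer_measure_ge0.
  have -> : (\sum_(0 <= k < N.+1.*2) mu (layer k) =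
      \sum_(k < N.+1) mu (layer (k.*2 + 0)%N) + \sum_(k < N.+1) mu (layer (k.*2 + 1)%N))%E.
    rewrite big_mkord; elim: N.+1 => [|M IH]; first by rewrite !big_ord0 adde0.
    rewrite doubleS !big_ord_recr/= IH addn0 addn1.
    by rewrite -!addeA; congr (_ + _)%E; rewrite addeCA.
  by rewrite leeD// (le_trans (parity _ _))// le_outer_measure.
have tail m : (mu (A `&` ~` C) <= mu (far m) + \sum_(m <= k <oo) mu (layer k))%E.
  have := outer_measure_sigma_subadditive_tail mu m layer.
  move=> /(leeD (lexx (mu (far m)))); apply: le_trans.
  apply: le_trans (outer_measureU2 _ _ _); apply: le_outer_measure => x [Ax nCx].
  have [l xl] : exists l, far l x.
    have : open (~` C) by exact: closed_openC.
    rewrite openE => /(_ x nCx)/nbhs_ballP[e /= e0 eC].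
    have [l _ lP] := near_infty_natSinv_lt (PosNum e0).
    exists l; split=> // y Cy; rewrite leNgt; apply/negP => xy.
    apply: (eC y) => //; rewrite -ball_normE/=.
    by apply: lt_trans xy _; exact: (lP l (leqnn l)).
  have [xm|nxm] := pselect (far m x); [by left|right].
  elim: l xl => [/(far_nd _ _ (leq0n m))//|l IH xl].
  have [/IH //|nxl] := pselect (far l x).
  by exists l => //= lm; apply: nxm; exact: far_nd xl.
have main m : (mu (A `&` C) + mu (A `&` ~` C) <=
    mu A + \sum_(m <= k <oo) mu (layer k))%E.
  rewrite (le_trans (leeD (lexx _) (tail m)))// addeA leeD2r//.
  rewrite addeC (le_trans (mu_metric (r := m.+1%:R^-1) _ _))//.
    by move=> x y [Ax xm] [Ay Cy]; exact: xm.
  by apply: le_outer_measure => x [[]|[]].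
have ft : (\sum_(m <= k <oo) mu (layer k))%E @[m --> \oo] --> 0%E.
  by apply: nneseries_tail_cvg => // k _; exact: outer_measure_ge0.
have fA : mu A \is a fin_num by exact: muAfin.
have h : (mu A + \sum_(m <= k <oo) mu (layer k))%E @[m --> \oo] --> (mu A + 0)%E.
  by apply: cvgeD; [rewrite fin_num_adde_defr|exact: cvg_cst|exact: ft].
rewrite adde0 in h; rewrite -(cvg_lim (@ereal_hausdorff R) h).
by apply: lime_ge; [apply/cvg_ex; eexists; exact: h|apply: nearW].
Qed.

End metric_outer_measure.

Section hausdorff.
Context {R : realType} (s : R).
Hypothesis s_gt0 : 0 < s.
Implicit Types (A B C : set 'rV[R]_2) (U : nat -> set 'rV[R]_2) (d : R).
Local Open Scope ereal_scope.

Lemma eucl_diam_ub A x y : A x -> A y -> (eucl_dist x y)%:E <= eucl_diam A.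
Proof. by move=> Ax Ay; apply: ereal_sup_ubound; exists x => //; exists y. Qed.

Lemma eucl_diam_le A (M : \bar R) :
  (forall x y, A x -> A y -> (eucl_dist x y)%:E <= M) -> eucl_diam A <= M.
Proof. by move=> AM; apply: ge_ereal_sup => _ [x Ax [y Ay <-]]; exact: AM. Qed.

Lemma eucl_diam_ge0 A : A !=set0 -> 0 <= eucl_diam A.
Proof. by move=> [x Ax]; have := eucl_diam_ub Ax Ax; rewrite eucl_distxx. Qed.

Lemma le_eucl_diam A B : A `<=` B -> eucl_diam A <= eucl_diam B.
Proof. by move=> AB; apply: eucl_diam_le => x y /AB Bx /AB; exact: eucl_diam_ub. Qed.

Lemma hausdorff_gauge_ge0 A : 0 <= hausdorff_gauge s A.
Proof. by rewrite /hausdorff_gauge; case: ifP => // _; exact: poweR_ge0. Qed.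

Lemma hausdorff_gauge0 : hausdorff_gauge s set0 = 0.
Proof. by rewrite /hausdorff_gauge eqxx. Qed.

Lemma hausdorff_pre_le d A : (0 < d)%R -> hausdorff_pre s d A <= hausdorff s A.
Proof. by move=> d0; apply: ereal_sup_ubound; exists d. Qed.

Lemma hausdorff_pre_cover d A U : hausdorff_cover d A U ->
  hausdorff_pre s d A <= \sum_(k <oo) hausdorff_gauge s (U k).
Proof. by move=> UA; apply: ereal_inf_lbound; exists U. Qed.

(** A set of diameter smaller than the gap between [A] and [B] meets only one of
them. *)
Lemma hausdorff_metric A B (r : R) : (0 < r)%R ->
  (forall x y, A x -> B y -> (r <= `|x - y|)%R) ->
  hausdorff s A + hausdorff s B <= hausdorff s (A `|` B).
Proof.
move=> r0 AB; set C := hausdorff s (A `|` B).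
have [->|Coo] := eqVneq C +oo; first by rewrite leey.
have fin D : D `<=` A `|` B -> hausdorff s D \is a fin_num.
  move=> DAB; rewrite ge0_fin_numE ?outer_measure_ge0//.
  by rewrite (le_lt_trans (le_outer_measure (hausdorff s) _ _ DAB))// ltey.
have key (d1 d2 : R) : (0 < d1)%R -> (0 < d2)%R ->
    hausdorff_pre s d1 A + hausdorff_pre s d2 B <= C.
  move=> d10 d20; pose d : R := Num.min (Num.min d1 d2) (r / 2)%R.
  have d0 : (0 < d)%R by rewrite !lt_min d10 d20 divr_gt0.
  apply: le_trans (hausdorff_pre_le (A `|` B) d0).
  apply: le_ereal_inf_tmp => _ [U [Ud UAB] <-].
  pose pick D k := if `[< U k `&` D !=set0 >] then U k else set0.
  have pickU D k : pick D k `<=` U k.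
    by rewrite /pick; case: asboolP => _; [exact: subset_refl|exact: sub0set].
  have cov D (e : R) : (d <= e)%R -> D `<=` A `|` B -> hausdorff_cover e D (pick D).
    move=> de DAB; split=> [k|x Dx].
      rewrite (le_trans (le_eucl_diam (pickU D k)))// (le_trans (Ud k))//.
    have [k _ Ux] := UAB x (DAB x Dx); exists k => //.
    by rewrite /pick; case: asboolP => // -[]; exists x.
  have dd1 : (d <= d1)%R by rewrite !ge_min lexx.
  have dd2 : (d <= d2)%R by rewrite !ge_min lexx orbT.
  have := leeD (hausdorff_pre_cover (cov A _ dd1 (@subsetUl _ _ _)))
               (hausdorff_pre_cover (cov B _ dd2 (@subsetUr _ _ _))).
  move=> /le_trans; apply; rewrite -nneseriesD; last 2 first.
    by move=> *; exact: hausdorff_gauge_ge0.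
    by move=> *; exact: hausdorff_gauge_ge0.
  apply: lee_nneseries => [k _ _|k _].
    by rewrite adde_ge0// hausdorff_gauge_ge0.
  rewrite /pick; case: asboolP => [[x [Ux Ax]]|_]; last first.
    by rewrite hausdorff_gauge0 add0e; case: asboolP => // _;
      rewrite ?hausdorff_gauge0 hausdorff_gauge_ge0.
  case: asboolP => [[y [Uy By]]|_]; last by rewrite hausdorff_gauge0 adde0.
  have := le_trans (eucl_diam_ub Ux Uy) (Ud k); rewrite lee_fin => xyd.
  have := AB x y Ax By; have := norm_le_eucl_dist x y.
  have : (d <= r / 2)%R by rewrite ge_min lexx orbT.
  by move=> *; exfalso; lra.
apply/lee_addgt0Pr => e e0.
have e2 : (0 < e / 2)%R by rewrite divr_gt0.
have fA := fin A (@subsetUl _ _ _); have fB := fin B (@subsetUr _ _ _).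
have [_ [d1 /= d10 <-] h1] := ub_ereal_sup_adherent e2 fA.
have [_ [d2 /= d20 <-] h2] := ub_ereal_sup_adherent e2 fB.
apply: le_trans (leeD (key d1 d2 d10 d20) (lexx e%:E)).
have {}h1 : hausdorff s A - (e / 2)%:E < hausdorff_pre s d1 A by [].
have {}h2 : hausdorff s B - (e / 2)%:E < hausdorff_pre s d2 B by [].
move: h1 h2; rewrite !lteBlDr// => h1 h2.
rewrite (le_trans (leeD (ltW h1) (ltW h2)))//.
by rewrite addeACA -EFinD -splitr.
Qed.

Lemma hausdorff_closed_measurable C : closed C ->
  (hausdorff s).-caratheodory C.
Proof. by apply: closed_caratheodory; exact: hausdorff_metric. Qed.

Lemma hausdorff_lipschitz (g : 'rV[R]_2 -> 'rV[R]_2) (L : R) A : (0 < L)%R ->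
  (forall x y, (eucl_dist (g x) (g y) <= L * eucl_dist x y)%R) ->
  hausdorff s (g @` A) <= (L `^ s)%:E * hausdorff s A.
Proof.
move=> L0 gL; apply: ge_ereal_sup => _ [d /= d0 <-].
have Ls : (0 < L `^ s)%R by exact: powR_gt0.
have dL : (0 < d / L)%R by rewrite divr_gt0.
apply: (@le_trans _ _ ((L `^ s)%:E * hausdorff_pre s (d / L) A)); last first.
  by rewrite lee_pmul2l ?fin_numE ?lte_fin// hausdorff_pre_le.
rewrite -lee_pdivrMl//; apply: le_ereal_inf_tmp => _ [U [Ud UA] <-].
rewrite lee_pdivrMl// -nneseriesZl; last by move=> *; exact: hausdorff_gauge_ge0.
have diam k : eucl_diam (g @` U k) <= L%:E * eucl_diam (U k).
  apply: eucl_diam_le => _ _ [x Ux <-] [y Uy <-].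
  apply: (@le_trans _ _ (L%:E * (eucl_dist x y)%:E)).
    by rewrite -EFinM lee_fin.
  by rewrite lee_pmul2l ?fin_numE ?lte_fin//; exact: eucl_diam_ub.
apply: (@le_trans _ _ (\sum_(k <oo) hausdorff_gauge s (g @` U k))).
  apply: hausdorff_pre_cover; split=> [k|_ [x Ax <-]].
    rewrite (le_trans (diam k))// (le_trans (lee_wpmul2l _ (Ud k)))//.
      by rewrite lee_fin ltW.
    by rewrite -EFinM mulrC divfK// lt0r_neq0.
  by have [k _ Ux] := UA x Ax; exists k => //; exists x.
apply: lee_nneseries => [k _ _|k _]; first exact: hausdorff_gauge_ge0.
rewrite /hausdorff_gauge; case: ifPn => [_|].
  by case: ifP => _; rewrite mule_ge0 ?lee_fin ?poweR_ge0// ltW.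
move=> gU; case: ifPn => [/eqP U0|U0].
  by move: gU; rewrite U0 image_set0 eqxx.
have D0 : 0 <= eucl_diam (U k) by apply: eucl_diam_ge0; exact/set0P.
have D0' : 0 <= eucl_diam (g @` U k) by apply: eucl_diam_ge0; exact/set0P.
have L0' : 0 <= L%:E by rewrite lee_fin ltW.
rewrite -poweR_EFin -poweRM//; apply: gt0_ler_poweR => //; first exact: ltW.
  by rewrite in_itv/= D0' leey.
by rewrite in_itv/= mule_ge0//= leey.
Qed.

End hausdorff.

(** * The Hausdorff measure of the gasket *)

Section word_avoidance.
Context {R : realType}.

Definition count_words d (P : pred (seq 'I_3)) : nat :=
  (\sum_(v : d.-tuple 'I_3) P v)%N.

Lemma count_words0 P : count_words 0 P = P [::] :> nat.
Proof.
rewrite /count_words (big_pred1 [tuple])//.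
by move=> w; apply/esym/eqP; exact: tuple0.
Qed.

Lemma count_wordsS d P :
  count_words d.+1 P = (\sum_i count_words d (fun v => P (i :: v)))%N.
Proof. by rewrite /count_words big_tuple_cons. Qed.

(** If the words of length [lev k] in [S k] have total mass less than 1 for the
uniform probability on the infinite words, some infinite word has no prefix in
them. The relative mass [mass w] of the forbidden words that extend [w] is the
mean of its values at the three extensions of [w] by a letter, and is at least 1
when [w] is forbidden: letters can be added one by one while the mass stays less
than 1. *)
Lemma avoid_words (lev : nat -> nat) (S : nat -> pred (seq 'I_3)) :
  (\sum_(k <oo) ((count_words (lev k) (S k))%:R / 3 ^+ lev k : R)%:E < 1)%E ->
  exists w : nat -> 'I_3, forall k, ~~ S k (mkseq w (lev k)).
Proof.
move=> mass_lt1.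
pose part k (w : seq 'I_3) : R := if (size w <= lev k)%N then
  (count_words (lev k - size w) (fun v => S k (w ++ v)))%:R *
    (3 ^+ size w / 3 ^+ lev k) else 0.
have part_ge0 k w : 0 <= part k w.
  by rewrite /part; case: ifP => // _; rewrite mulr_ge0// divr_ge0// exprn_ge0.
pose mass w := (\sum_(k <oo) (part k w)%:E)%E.
have part_mean k w : \sum_i part k (rcons w i) <= 3 * part k w.
  rewrite /part; under eq_bigr do rewrite size_rcons.
  have [lt_wk|ge_wk] := ltnP (size w) (lev k); last first.
    by rewrite big1// mulr_ge0//; exact: part_ge0.
  rewrite (ltnW lt_wk) -(subnSK lt_wk) count_wordsS natr_sum mulr_suml mulr_sumr.
  apply: ler_sum => i _; rewrite exprS.
  under [fun v : seq 'I_3 => S k (rcons w i ++ v)]eq_fun do rewrite cat_rcons.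
  by rewrite -!mulrA mulrCA.
have extend w : (mass w < 1)%E -> exists i, (mass (rcons w i) < 1)%E.
  move=> w1; apply: contrapT => /forallNP ge1.
  have {}ge1 i : (1 <= mass (rcons w i))%E by rewrite leNgt; exact/negP/ge1.
  have := leeD (leeD (ge1 0) (ge1 1)) (ge1 2); rewrite /mass.
  rewrite -!nneseriesD; do ?[by move=> *; rewrite ?adde_ge0 ?lee_fin].
  rewrite leNgt => /negP; apply.
  apply: (@le_lt_trans _ _ (3%:E * mass w)%E); last first.
    have : (3%:E * mass w < 3%:E * 1)%E by rewrite lte_pmul2l.
    by rewrite mule1 -!EFinD; congr (_ < _%:E)%E; ring.
  rewrite /mass -nneseriesZl; last by move=> *; rewrite lee_fin.
  apply: lee_nneseries => [k _ _|k _]; first by rewrite !adde_ge0 ?lee_fin.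
  by rewrite -!EFinD -EFinM lee_fin; have := part_mean k w; rewrite sum_ord3.
have /choice[f fP] : forall w, exists i,
    (mass w < 1)%E -> (mass (rcons w i) < 1)%E.
  move=> w; have [/extend[i wi]|nw] := pselect (mass w < 1)%E.
    by exists i.
  by exists 0 => /nw.
pose W n := iter n (fun w => rcons w (f w)) [::].
have WE n : mkseq (fun k => f (W k)) n = W n.
  by elim: n => //= n IH; rewrite mkseqS IH.
have mW n : (mass (W n) < 1)%E.
  elim: n => [|n IH]; last exact: fP.
  apply: le_lt_trans mass_lt1; apply: lee_nneseries => [k _ _|k _].
    by rewrite lee_fin.
  by rewrite lee_fin /part/= subn0 expr0 mul1r.
exists (fun n => f (W n)) => k; rewrite WE; apply/negP => Sk.
have := mW (lev k); rewrite ltNge => /negP; apply.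
have sW : size (W (lev k)) = lev k by rewrite -WE size_mkseq.
apply: (@le_trans _ _ (part k (W (lev k)))%:E).
  rewrite /part sW leqnn subnn count_words0 cats0 Sk mul1r.
  by rewrite divff// expf_neq0.
rewrite /mass (nneseriesD1 (n := k))//; last by move=> *; rewrite lee_fin.
by rewrite leeDl// nneseries_ge0// => *; rewrite lee_fin.
Qed.

End word_avoidance.

Section gasket_hausdorff.
Context {R : realType} {p : 'I_3 -> 'rV[R]_2} {V : set 'rV[R]_2}.
Hypothesis p_equilateral : equilateral p.
Hypothesis gasketV : is_gasket p V.
Local Notation dim := (@gasket_dim R).
Local Notation H := (hausdorff dim).

Lemma gasket_dim_gt0 : 0 < dim.
Proof. by apply: divr_gt0; apply: ln_gt0; rewrite ltr1n. Qed.

Lemma powR2_gasket_dim : 2 `^ dim = 3.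
Proof.
rewrite /powR ifF; last by apply/negbTE; rewrite pnatr_eq0.
rewrite /gasket_dim divfK; first by rewrite lnK// posrE.
by apply/lt0r_neq0/ln_gt0; rewrite ltr1n.
Qed.

Lemma powR_gasket_dim n : (2^-1 ^+ n) `^ dim = 3 ^- n.
Proof.
have h : 2^-1 `^ dim = 3^-1 :> R.
  apply: (mulfI (x := 3)); first by rewrite pnatr_eq0.
  by rewrite -{1}powR2_gasket_dim -powRM// !mulfV ?pnatr_eq0// powR1.
elim: n => [|n IH]; first by rewrite !expr0 powR1 invr1.
by rewrite exprS powRM ?exprn_ge0// IH h -invfM -exprS.
Qed.

Lemma le_gauge (A B : \bar R) : (0 <= A)%E -> (A <= B)%E -> (A `^ dim <= B `^ dim)%E.
Proof.
move=> A0 AB; apply: gt0_ler_poweR => //.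
- exact: ltW gasket_dim_gt0.
- by rewrite in_itv/= A0 leey.
- by rewrite in_itv/= (le_trans A0)// leey.
Qed.

(** The [3 ^ n] cells of level [n] have diameter at most [2 ^- n * D], hence total gauge
at most [3 ^ n * (2 ^- n * D) `^ dim = D `^ dim]. *)
Lemma hausdorff_gasket_lty : (H V < +oo)%E.
Proof.
have [D D0 VD] := gasket_bounded gasketV.
apply: (@le_lt_trans _ _ (D `^ dim)%:E); last by rewrite ltry.
apply: ge_ereal_sup => _ [d /= d0 <-].
have [n nd] : exists n, 2^-1 ^+ n * D <= d.
  have : 2^-1 ^+ n * D @[n --> \oo] --> 0 * D.
    by apply: cvgMl; apply: cvg_expr; rewrite ger0_norm// invf_lt1// ltr1n.
  rewrite mul0r => /cvgrPdist_lt/(_ d d0)[n _ /(_ n (leqnn n))].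
  rewrite sub0r normrN => nd; exists n.
  exact: le_trans (ler_norm _) (ltW nd).
pose ws := [seq val w | w <- enum {: n.-tuple 'I_3}].
have sws : size ws = (3 ^ n)%N by rewrite size_map -cardE card_tuple card_ord.
pose U k := if (k < size ws)%N then Fword p (nth [::] ws k) @` V else set0.
have sizew k : (k < size ws)%N -> size (nth [::] ws k) = n.
  by move=> /(mem_nth [::])/mapP[w _ ->]; exact: size_tuple.
have diamU k : (eucl_diam (U k) <= (2^-1 ^+ n * D)%:E)%E.
  apply: eucl_diam_le => x y; rewrite /U; case: ifPn => // /sizew kn.
  move=> [x' Vx <-] [y' Vy <-]; rewrite lee_fin eucl_dist_Fword kn.
  by rewrite ler_wpM2l ?exprn_ge0// VD.
have gaugeU k : (hausdorff_gauge dim (U k) <= ((3 ^- n) * D `^ dim)%:E)%E.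
  rewrite /hausdorff_gauge; case: ifPn => [_|/set0P U0].
    by rewrite lee_fin mulr_ge0 ?powR_ge0// invr_ge0 exprn_ge0.
  rewrite -powR_gasket_dim -powRM ?exprn_ge0//; last exact: ltW.
  by rewrite -poweR_EFin le_gauge// eucl_diam_ge0.
have cov : hausdorff_cover d V U.
  split=> [k|x Vx]; first by rewrite (le_trans (diamU k)).
  have [w wn [y Vy xE]] := gasket_Fword gasketV n Vx.
  have ww : w \in ws.
    by apply/mapP; exists (Tuple (introT eqP wn)); rewrite // mem_enum.
  exists (index w ws) => //; rewrite /U index_mem ww nth_index//.
  by exists y.
apply: (le_trans (hausdorff_pre_cover dim cov)).
rewrite (nneseries_split _ (3 ^ n)); last by move=> *; exact: hausdorff_gauge_ge0.
rewrite [X in (_ + X)%E]eseries0 ?adde0; last first.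
  by move=> k nk _; rewrite /U sws ltnNge nk hausdorff_gauge0.
apply: (@le_trans _ _ (\sum_(0 <= k < 0 + 3 ^ n) ((3 ^- n) * D `^ dim)%:E)%E).
  by apply: lee_sum => k _.
rewrite sumEFin lee_fin add0n sumr_const_nat subn0 -[X in X <= _]mulr_natl natrX mulrA.
by rewrite divff ?mul1r// expf_neq0.
Qed.

Section bary.
Context {b : 'I_3 -> 'rV[R]_2 -> R}.
Hypothesis b_affine :
  forall i x y, b i (2^-1 *: (x + y)) = 2^-1 * (b i x + b i y).
Hypothesis b_vertex : forall i j, b i (p j) = (i == j)%:R.
Hypothesis b_sum : forall x, \sum_i b i x = 1.
Hypothesis b_lip : exists2 C : R, 0 < C &
  forall i x y, `|b i x - b i y| <= C * eucl_dist x y.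

(** Integer coordinates, in units of the mesh of level [size w], of the corner
of the cell of [w] at which [b i] is smallest. *)
Fixpoint word_coord (i : 'I_3) (w : seq 'I_3) : nat :=
  if w is j :: w' then (word_coord i w' + (i == j) * 2 ^ size w')%N else 0%N.

Lemma bary_Fword i w x :
  b i (Fword p w x) = 2^-1 ^+ size w * ((word_coord i w)%:R + b i x).
Proof.
elim: w => [|j w IH] /=; first by rewrite expr0 mul1r add0r.
rewrite (bary_Fmap b_affine b_vertex) IH natrD natrM natrX.
have := @exprVn R 2 (size w); have : 2 ^+ size w != 0 :> R by rewrite expf_neq0.
rewrite exprS; set q := 2 ^+ size w => q0 ->.
by field.
Qed.

Lemma word_coord_lt i w : (word_coord i w < 2 ^ size w)%N.
Proof.
elim: w => //= j w IH; rewrite expnS mul2n -addnn.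
by case: eqP => _; rewrite ?mul1n ?mul0n ?addn0 ?ltn_add2r// ltn_addr.
Qed.

Lemma word_coord_inj w w' : size w = size w' ->
  (forall i, word_coord i w = word_coord i w') -> w = w'.
Proof.
elim: w w' => [|j w IH] [|j' w'] //= [ww'] e.
have jj' : j = j'.
  apply/eqP; apply/negPn/negP => jj'.
  have := e j; rewrite eqxx mul1n (negbTE jj') mul0n addn0 => e'.
  have := word_coord_lt j w'; rewrite -e' -ww' ltnNge.
  by rewrite leq_addl.
rewrite jj' in e *; congr cons; apply: IH => // i.
by have := e i; rewrite ww' => /addIn.
Qed.

(** A set whose diameter is at most the mesh of level [n] meets a bounded number of
cells of that level, as their integer coordinates lie in a cube of bounded size. *)
Lemma count_cells : exists K : nat, forall n (B : set 'rV[R]_2),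
  (eucl_diam B <= (2^-1 ^+ n)%:E)%E ->
  (count_words n (fun w => `[< (Fword p w @` V `&` B) !=set0 >]) <= K)%N.
Proof.
have [C C0 bC] := b_lip.
pose M := Num.bound (C + 1).
have CM : C + 1 < M%:R.
  by have := archi_boundP (x := C + 1); apply; rewrite addr_ge0// ltW.
exists (((2 * M).+1) ^ 3)%N => n B Bn; rewrite /count_words.
pose A := [pred w : n.-tuple 'I_3 | `[< (Fword p w @` V `&` B) !=set0 >]].
have -> : (\sum_(v : n.-tuple 'I_3) `[< (Fword p v @` V `&` B) !=set0 >])%N = #|A|.
  by rewrite -sum1_card [RHS]big_mkcond; apply: eq_bigr => w _; rewrite inE;
    case: `[< _ >].
have [w0 /asboolP[_ [[y Vy <-] By]]|A0] := pickP A; last by rewrite eq_card0.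
pose phi (w : n.-tuple 'I_3) : {ffun 'I_3 -> 'I_(2 * M).+1} :=
  [ffun i => inord (word_coord i w + M - word_coord i w0)].
have b01 i x : V x -> 0 <= b i x <= 1.
  move=> Vx; have b0 j := bary_ge0 gasketV b_affine b_vertex b_lip j Vx.
  rewrite b0 -(b_sum x) (bigD1 i)//= lerDl sumr_ge0//.
have close (w : n.-tuple 'I_3) i : A w ->
    (word_coord i w <= word_coord i w0 + M)%N /\
    (word_coord i w0 <= word_coord i w + M)%N.
  move=> /asboolP[_ [[x Vx <-] Bx]].
  have := bC i (Fword p w x) (Fword p w0 y); rewrite !bary_Fword !size_tuple.
  have : eucl_dist (Fword p w x) (Fword p w0 y) <= 2^-1 ^+ n.
    by rewrite -lee_fin (le_trans (eucl_diam_ub Bx By)).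
  set q := 2^-1 ^+ n; have q0 : 0 < q by rewrite exprn_gt0.
  rewrite -mulrBr normrM (gtr0_norm q0) => dq h.
  have {}h : `|(word_coord i w)%:R + b i x - ((word_coord i w0)%:R + b i y)| <= C.
    rewrite -(ler_pM2l q0) (le_trans h)// mulrC ler_wpM2r//; exact: ltW.
  have /andP[x0 x1] := b01 i x Vx; have /andP[y0 y1] := b01 i y Vy.
  by move: h; rewrite ler_norml -!(ler_nat R) !natrD; lra.
have phi_inj : {in A &, injective phi}.
  move=> w w' wA w'A ww'; suff : tval w = tval w' by move/val_inj.
  apply: word_coord_inj; rewrite ?size_tuple// => i.
  have := congr1 (fun g : {ffun 'I_3 -> 'I_(2 * M).+1} => nat_of_ord (g i)) ww'.
  have [h1 h2] := close w i wA; have [h3 h4] := close w' i w'A.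
  by rewrite /phi !ffunE !inordK; lia.
rewrite -(card_in_imset phi_inj) (leq_trans (max_card _))//.
by rewrite card_ffun !card_ord.
Qed.

(** The level at which the cells are about as large as a set of Hausdorff gauge at
most [t]. *)
Lemma gauge_level (B : set 'rV[R]_2) (t : R) : 0 < t -> (eucl_diam B <= 1)%E ->
  (hausdorff_gauge dim B <= t%:E)%E ->
  exists n, (eucl_diam B <= (2^-1 ^+ n)%:E)%E /\ 3 ^- n <= 3 * t.
Proof.
move=> t0 B1 Bt; have ex : exists n, 3 ^- n <= 3 * t.
  have : 3^-1 ^+ n @[n --> \oo] --> (0 : R).
    by apply: cvg_expr; rewrite ger0_norm// invf_lt1// ltr1n.
  move=> /cvgrPdist_lt/(_ (3 * t)); rewrite mulr_gt0// => /(_ isT)[n _ nP].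
  exists n; have := nP n (leqnn n); rewrite sub0r normrN exprVn => h.
  exact: le_trans (ler_norm _) (ltW h).
case: (ex_minnP ex) => n nt nmin; exists n; split=> //.
case: n nt nmin => [|n] nt nmin; first by rewrite expr0.
have tn : t < 3 ^- n.+1.
  have : ~~ (3 ^- n <= 3 * t) by apply/negP => /nmin; rewrite ltnn.
  by rewrite -ltNge exprS invfM; lra.
rewrite leNgt; apply/negP => nB.
have B0 : B !=set0.
  apply/set0P/eqP => B0; move: nB; rewrite B0 /eucl_diam.
  rewrite (_ : [set _ | _ in _ & _ in _] = set0); first by rewrite ereal_sup0.
  by apply/seteqP; split=> // _ [x []].
have : (((2^-1 ^+ n.+1) `^ dim)%:E <= t%:E)%E.
  apply: le_trans Bt; rewrite /hausdorff_gauge ifF; last first.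
    by apply/negbTE; exact/set0P.
  by rewrite -poweR_EFin le_gauge ?lee_fin ?exprn_ge0// ltW.
by rewrite powR_gasket_dim lee_fin leNgt tn.
Qed.

(** A cover of small total gauge would, by [count_cells], produce a set of cells of
small total mass for the uniform probability on words; the point coded by an
infinite word that avoids these cells would not be covered. *)
Lemma hausdorff_gasket_gt0 : (0 < H V)%E.
Proof.
have [K0 K0P] := count_cells; pose K := K0.+1.
have KP n (B : set 'rV[R]_2) : (eucl_diam B <= (2^-1 ^+ n)%:E)%E ->
    (count_words n (fun w => `[< (Fword p w @` V `&` B) !=set0 >]) <= K)%N.
  by move=> /K0P/leq_trans; apply.
(* A cover of total gauge less than [k0] gives cells of total mass at most
   [3 * K * (2 * k0) = 1 / 2]. *)
pose k0 : R := (12 * K%:R)^-1.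
have k00 : 0 < k0 by rewrite invr_gt0 mulr_gt0// ltr0n.
apply: (@lt_le_trans _ _ k0%:E); first by rewrite lte_fin.
apply: le_trans (hausdorff_pre_le dim V (@ltr01 R)).
apply: le_ereal_inf_tmp => _ [U [U1 UV] <-].
rewrite leNgt; apply/negP => Uk0.
pose g k := hausdorff_gauge dim (U k).
have g0 k : (0 <= g k)%E by exact: hausdorff_gauge_ge0.
have gfin k : g k \is a fin_num.
  rewrite ge0_fin_numE//; apply: le_lt_trans (lt_trans Uk0 (ltry _)).
  rewrite [leRHS](nneseriesD1 (n := k))//; last by move=> *; exact: g0.
  by rewrite leeDl// nneseries_ge0// => *; exact: g0.
pose t k : R := fine (g k) + k0 / 2 ^+ k.+1.
have t0 k : 0 < t k by rewrite ltr_wpDl ?fine_ge0// divr_gt0// exprn_gt0.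
have lev_ex k : exists n, (eucl_diam (U k) <= (2^-1 ^+ n)%:E)%E /\ 3 ^- n <= 3 * t k.
  apply: gauge_level => //; rewrite -/(g k) -(fineK (gfin k)) lee_fin lerDl.
  by rewrite divr_ge0// ?exprn_ge0// ltW.
have [lev levP] := choice lev_ex.
pose S k (w : seq 'I_3) := `[< (Fword p w @` V `&` U k) !=set0 >].
have sum_t : (\sum_(k <oo) (t k)%:E <= (2 * k0)%:E)%E.
  rewrite /t; under eq_eseriesr do rewrite EFinD fineK//.
  rewrite nneseriesD; last 2 first.
  - by move=> *; exact: g0.
  - by move=> *; rewrite lee_fin divr_ge0 ?exprn_ge0// ltW.
  rewrite (_ : 2 * k0 = k0 + k0); last by ring.
  rewrite EFinD; apply: leeD; first exact: ltW.
  have := @epsilon_trick0 R k0 xpredT (ltW k00).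
  by under eq_eseriesr do rewrite natrX.
have [w wP] : exists w : nat -> 'I_3, forall k, ~~ S k (mkseq w (lev k)).
  apply: avoid_words.
  apply: (@le_lt_trans _ _ (\sum_(k <oo) ((3 * K%:R)%:E * (t k)%:E))%E).
    apply: lee_nneseries => [k _ _|k _].
      by rewrite lee_fin divr_ge0// exprn_ge0.
    rewrite -EFinM lee_fin; have [d1 d2] := levP k.
    have : ((count_words (lev k) (S k))%:R : R) <= K%:R by rewrite ler_nat KP.
    have : 0 <= 3 ^- lev k :> R by rewrite invr_ge0 exprn_ge0.
    have := ler0n R (count_words (lev k) (S k)); have := ltW (t0 k).
    move: d2; set c := _%:R; set q := 3 ^- _; set kk := K%:R => *; nra.
  rewrite nneseriesZl; last by move=> k _; rewrite lee_fin ltW.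
  apply: (@le_lt_trans _ _ ((3 * K%:R)%:E * (2 * k0)%:E)%E).
    by rewrite lee_wpmul2l// lee_fin mulr_ge0.
  rewrite -EFinM lte_fin /k0; set kk := K%:R.
  have kk0 : kk != 0 :> R by rewrite pnatr_eq0.
  have -> : 3 * kk * (2 / (12 * kk)) = 1 / 2 by field.
  lra.
pose cell n := Fword p (mkseq w n) @` V.
have cell_nd m n : (m <= n)%N -> cell n `<=` cell m.
  move=> mn _ [y Vy <-]; rewrite -(subnK mn).
  have -> : mkseq w (n - m + m) = mkseq w m ++ [seq w i | i <- iota m (n - m)].
    by rewrite /mkseq addnC iotaD map_cat add0n.
  have FwordD (v v' : seq 'I_3) x : Fword p (v ++ v') x = Fword p v (Fword p v' x).
    by rewrite /Fword foldr_cat.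
  rewrite FwordD; set v := [seq w i | i <- _]; exists (Fword p v y) => //.
  exact: Fword_gasket.
case: (gasketV) => /= cV _ _.
pose xs n := Fword p (mkseq w n) (p 0).
have xsV n : cell n (xs n) by exists (p 0) => //; exact: (gasket_vertex gasketV 0).
have [] := cV (xs @ \oo).
  by exists 0%N => // n _; exact: (Fword_gasket gasketV _ (gasket_vertex gasketV 0)).
move=> x [Vx clx].
have cellx n : cell n x.
  apply: (cell_closed gasketV) => B Bx.
  by apply: clx => //; exists n => // m /= nm; exact: cell_nd nm _ (xsV m).
have [k _ Ux] := UV x Vx.
by have /asboolP[] := wP k; exists x; split=> //; exact: cellx.
Qed.

End bary.
End gasket_hausdorff.

(** * Integrals depending on a parameter *)

Section almost_everywhere.
Context {d : measure_display} {T : measurableType d} {R : realType}.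
Context {mu : {measure set T -> \bar R}}.

Lemma ae_imply (P Q : T -> Prop) : {ae mu, forall x, P x} ->
  (forall x, P x -> Q x) -> {ae mu, forall x, Q x}.
Proof. by move=> + PQ; apply: filterS => x; exact: PQ. Qed.

Lemma ae_imply2 (P Q S : T -> Prop) :
  {ae mu, forall x, P x} -> {ae mu, forall x, Q x} ->
  (forall x, P x -> Q x -> S x) -> {ae mu, forall x, S x}.
Proof. by move=> + + PQS; apply: filterS2 => x; exact: PQS. Qed.

End almost_everywhere.

Section complete_measure.
Context {d : measure_display} {T : measurableType d} {R : realType}.
Context {mu : {measure set T -> \bar R}} {D : set T}.
Hypothesis mD : measurable D.
Hypothesis mu_complete : measure_is_complete mu.

(** Completeness of the measure disposes of the null set where there is no
convergence. *)
Lemma measurable_fun_ae_cvg (h : nat -> T -> R) (g : T -> R) :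
  (forall n, measurable_fun D (h n)) ->
  {ae mu, forall x, D x -> h n x @[n --> \oo] --> g x} ->
  measurable_fun D g.
Proof.
move=> mh [N [mN N0 hN]].
have -> : D = (D `\` N) `|` (D `&` N) by rewrite setUC setUIDK.
apply/measurable_funU; [exact: measurableD|exact: measurableI|split].
- apply: (@measurable_fun_cvg _ _ _ _ h) => [n|x [Dx Nx]].
    by apply: measurable_funS (mh n) => //; exact: subDsetl.
  by apply: contrapT => hx; apply: Nx; apply: hN => /= /(_ Dx).
- move=> _ B mB; apply: mu_complete; exists N; split=> //.
  by move=> x [[]].
Qed.

(** When [u] is replaced by its rounding to a multiple of [1 / (k + 1)], the composite is
measurable because it is so on each of countably many level sets. *)
Lemma measurable_caratheodory (f : T -> R -> R) (u : T -> R) (M : R) :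
  (forall t, measurable_fun D (f ^~ t)) ->
  {ae mu, forall x, D x -> continuous (f x)} ->
  measurable_fun D u -> (forall x, D x -> `|u x| <= M) ->
  measurable_fun D (fun x => f x (u x)).
Proof.
move=> mf cf mu_ uM.
pose z k x := Num.truncn ((u x + M) * k.+1%:R).
pose c k m : R := m%:R / k.+1%:R - M.
have uM0 x k : D x -> 0 <= (u x + M) * k.+1%:R.
  by move=> /uM; rewrite ler_norml => /andP[? _]; rewrite mulr_ge0//; lra.
apply: (@measurable_fun_ae_cvg (fun k x => f x (c k (z k x)))) => [k _ B mB|].
- have -> : D `&` (fun x => f x (c k (z k x))) @^-1` B =
      \bigcup_m ((D `&` (fun x => (u x + M) * k.+1%:R) @^-1` `[m%:R, m.+1%:R[) `&`
        (D `&` (f ^~ (c k m)) @^-1` B)).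
    apply/seteqP; split=> [x [Dx Bx]|x [m _ [[Dx xm] [_ Bx]]]].
      exists (z k x) => //; split; split=> //.
      by rewrite /= in_itv/=; apply: truncn_itv; exact: uM0.
    split=> //=; suff -> : z k x = m by [].
    by apply/eqP; rewrite /z truncn_eq ?uM0//; move: xm; rewrite /= in_itv/=.
  apply: bigcup_measurable => m _; apply: measurableI; last exact: mf.
  suff : measurable_fun D (fun x => (u x + M) * k.+1%:R) by exact.
  by apply: measurable_funM => //; exact: measurable_funD.
- apply: filterS cf => x cfx Dx; apply: continuous_cvg; first exact: (cfx Dx (u x)).
  apply/cvgrPdist_lt => e e0.
  have [N _ NP] := near_infty_natSinv_lt (PosNum e0).
  exists N => // k Nk; have := NP k Nk => /= /(lt_trans _); apply.
  have k0 : (0 : R) < k.+1%:R by rewrite ltr0n.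
  have := truncn_itv (uM0 x k Dx); rewrite -/(z k x) => /andP[z1 z2].
  have -> : u x - c k (z k x) = ((u x + M) * k.+1%:R - (z k x)%:R) / k.+1%:R.
    by rewrite /c; field; rewrite nat1r lt0r_neq0.
  rewrite normrM (gtr0_norm (x := _^-1)) ?invr_gt0// ltr_pdivrMr// mulVf ?lt0r_neq0//.
  by rewrite ger0_norm ?subr_ge0// ltrBlDl natr1.
Qed.

Lemma dominated_Rintegral (h : nat -> T -> R) (g G : T -> R) :
  (forall n, measurable_fun D (h n)) ->
  {ae mu, forall x, D x -> h n x @[n --> \oo] --> g x} ->
  mu.-integrable D (EFin \o G) ->
  {ae mu, forall x, D x -> forall n, `|h n x| <= G x} ->
  mu.-integrable D (EFin \o g) /\
  \int[mu]_(x in D) h n x @[n --> \oo] --> \int[mu]_(x in D) g x.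
Proof.
move=> mh hg iG hG; have mg := measurable_fun_ae_cvg mh hg.
have [] := @dominated_convergence _ _ _ mu D mD (fun n => EFin \o h n)
  (EFin \o g) (EFin \o G).
- by move=> n; exact/measurable_EFinP.
- exact/measurable_EFinP.
- by apply: filterS hg => x hx Dx; apply: cvg_EFin; [exact: nearW|exact: hx].
- by [].
- by apply: filterS hG => x hx n Dx /=; rewrite lee_fin; exact: hx.
move=> ig _ hcvg; split=> //; apply: fine_cvg.
by rewrite fineK//; exact: integrable_fin_num.
Qed.

Lemma ae_integrable_le (g G : T -> R) : measurable_fun D g ->
  mu.-integrable D (EFin \o G) -> {ae mu, forall x, D x -> `|g x| <= G x} ->
  mu.-integrable D (EFin \o g).
Proof.
move=> mg iG gG; have [] := @dominated_Rintegral (fun=> g) g G => //.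
- by apply: nearW => x _; exact: cvg_cst.
- by apply: filterS gG => x gx Dx _; exact: gx.
Qed.

Lemma ae_le_Rintegral (g G : T -> R) : mu.-integrable D (EFin \o g) ->
  mu.-integrable D (EFin \o G) -> {ae mu, forall x, D x -> g x <= G x} ->
  \int[mu]_(x in D) g x <= \int[mu]_(x in D) G x.
Proof.
move=> ig iG gG.
have mg := measurable_int mu ig; have mG := measurable_int mu iG.
have -> : \int[mu]_(x in D) G x = \int[mu]_(x in D) Num.max (g x) (G x).
  rewrite /Rintegral; congr fine; apply: ae_eq_integral => //.
    by apply/measurable_EFinP; apply: measurable_maxr; exact/measurable_EFinP.
  by apply: filterS gG => x gx Dx; rewrite max_r// gx.
apply: le_Rintegral => //.
  apply: (@ae_integrable_le _ (fun x => `|g x| + `|G x|)).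
  - by apply: measurable_maxr; exact/measurable_EFinP.
  - rewrite (_ : EFin \o _ = (EFin \o (Num.Def.normr \o g)) \+ (EFin \o (Num.Def.normr \o G)))%E//.
    by apply: integrableD => //; exact: integrable_norm.
  - apply: nearW => x _; case: (leP (g x) (G x)) => _;
      by rewrite ?lerDl ?lerDr.
by move=> x _; rewrite le_max lexx.
Qed.

End complete_measure.

Section primitive.
Context {R : realType} (f : 'rV[R]_2 -> R -> R) (x : 'rV[R]_2).
Hypothesis cf : continuous (f x).
Local Notation mu := (@lebesgue_measure R).

Let int_f (a b : R) : mu.-integrable `[a, b] (EFin \o f x).
Proof.
apply: continuous_compact_integrable; first exact: segment_compact.
exact: continuous_subspaceT.
Qed.

(* Integrating from a base point [c < 0] turns both cases of the definition into one
   formula. *)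
Let primitive_shift (c t : R) : c < 0 -> c < t ->
  primitive f x t = \int[mu]_(s in `[c, t]) f x s - \int[mu]_(s in `[c, 0]) f x s.
Proof.
move=> c0 ct; rewrite /primitive; case: ifPn => [t0|].
  rewrite Rintegral_itvB ?bnd_simp//; last exact: ltW.
  rewrite Rintegral_itv_obnd_cbnd//.
  by apply: integrableS (int_f 0 t) => //; exact: subset_itv_oc_cc.
rewrite -ltNge => t0; rewrite -[RHS]opprB; congr (- _).
rewrite Rintegral_itvB ?bnd_simp; [|exact: int_f|exact: ltW|exact: ltW].
rewrite Rintegral_itv_obnd_cbnd//.
by apply: integrableS (int_f t 0) => //; exact: subset_itv_oc_cc.
Qed.

Lemma primitive0 : primitive f x 0 = 0.
Proof. by rewrite /primitive lexx set_itv1 Rintegral_set1. Qed.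

Lemma primitive_MVT a b : a <= b -> exists2 c, c \in `[a, b] &
  primitive f x b - primitive f x a = f x c * (b - a).
Proof.
move=> ab; pose c := Num.min a 0 - 1.
have ca : c < a by rewrite /c ltrBlDr (le_lt_trans (y := a)) ?ge_min ?lexx// ltrDl.
have c0 : c < 0.
  by rewrite /c ltrBlDr add0r (le_lt_trans (y := 0)) ?ge_min ?lexx ?orbT// ltr01.
rewrite (primitive_shift c0 (lt_le_trans ca ab)) (primitive_shift c0 ca).
rewrite opprB addrA subrK; pose J t := \int[mu]_(s in `[c, t]) f x s.
have dJ t : c < t -> is_derive t 1 J (f x t).
  move=> ct; have [] := @continuous_FTC1_closed R (f x) c t (t + 1) _ (int_f _ _) ct (@cf t).
    by rewrite ltrDl.
  by move=> dJ <-; rewrite derive1E; exact: derivableP.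
apply: (MVT_segment ab (f := J)) => [t|].
  by rewrite in_itv/= => /andP[at_ _]; apply: dJ; exact: lt_trans at_.
apply: derivable_within_continuous => t; rewrite in_itv/= => /andP[at_ _].
by have [] := dJ t (lt_le_trans ca at_).
Qed.

Lemma primitive_bound (M K t : R) : (forall s, `|s| <= M -> `|f x s| <= K) ->
  `|t| <= M -> `|primitive f x t| <= M * K.
Proof.
move=> fK tM; have K0 : 0 <= K.
  by apply: le_trans (normr_ge0 _) (fK 0 _); rewrite normr0 (le_trans _ tM).
have key (c h : R) : `|c| <= M -> `|h| <= M -> `|f x c * h| <= M * K.
  by move=> cM hM; rewrite normrM mulrC ler_pM// fK.
move: tM; rewrite ler_norml => /andP[t1 t2].
have [t0|/ltW t0] := leP 0 t.
  have [c] := primitive_MVT t0; rewrite in_itv/= primitive0 !subr0 => /andP[c1 c2] ->.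
  by apply: key; rewrite ler_norml; lra.
have [c] := primitive_MVT t0; rewrite in_itv/= primitive0 !sub0r => /andP[c1 c2].
move=> /(congr1 (fun y => `|y|)); rewrite normrN => ->.
by apply: key; rewrite ler_norml; lra.
Qed.

Lemma primitive_lipschitz (M K s t : R) : (forall r, `|r| <= M -> `|f x r| <= K) ->
  `|s| <= M -> `|t| <= M -> `|primitive f x t - primitive f x s| <= K * `|t - s|.
Proof.
move=> fK; wlog st : s t / s <= t.
  move=> h sM tM; have [st|/ltW ts] := leP s t; first exact: (h _ _ st sM tM).
  by rewrite distrC (distrC t); exact: (h _ _ ts tM sM).
rewrite !ler_norml => /andP[s1 s2] /andP[t1 t2].
have [c] := primitive_MVT st; rewrite in_itv/= => /andP[c1 c2] ->.
rewrite -ler_norml normrM ler_wpM2r// fK// ler_norml; lra.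
Qed.

Lemma primitive_increment a h : exists c, `|c - a| <= `|h| /\
  primitive f x (a + h) - primitive f x a = f x c * h.
Proof.
have [h0|/ltW h0] := leP 0 h.
  have le : a <= a + h by rewrite lerDl.
  have [c] := primitive_MVT le; rewrite in_itv/= => /andP[c1 c2] ->; exists c.
  rewrite !ger0_norm ?subr_ge0//; split; first lra.
  by rewrite addrC addKr.
have le : a + h <= a by rewrite gerDl.
have [c] := primitive_MVT le; rewrite in_itv/= => /andP[c1 c2] cE; exists c.
rewrite !ler0_norm ?subr_le0//; split; first lra.
by rewrite -opprB cE; ring.
Qed.

Lemma primitive_continuous : continuous (primitive f x).
Proof.
move=> t; apply/cvgrPdist_lt => e e0.
have /cvgrPdist_lt/(_ 1 ltr01)/nbhs_ballP[d /= d0 dP] := @cf t.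
pose K := `|f x t| + 1; have K0 : 0 < K by rewrite ltr_wpDl.
apply/nbhs_ballP; exists (Num.min d (e / K)).
  by rewrite /= lt_min d0 divr_gt0.
move=> s /=; rewrite lt_min => /andP[sd se].
have [c [ct cE]] := primitive_increment t (s - t).
rewrite distrC; have -> : s = t + (s - t) by rewrite addrC subrK.
rewrite cE normrM distrC.
have fK : `|f x c| <= K.
  have : `|f x t - f x c| < 1.
    apply: dP; rewrite -ball_normE/= distrC (le_lt_trans ct)// distrC.
    exact: sd.
  rewrite distrC => h; have := ler_normD (f x c - f x t) (f x t).
  by rewrite subrK /K; lra.
rewrite (le_lt_trans (ler_wpM2r _ fK))// mulrC -ltr_pdivlMr//.
Qed.

(** The difference quotients of the primitive converge to [f] also when the base
point and the direction vary, since the mean value points converge. *)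
Lemma primitive_quotient (t h s : nat -> R) (t0 h0 : R) :
  t n @[n --> \oo] --> t0 -> h n @[n --> \oo] --> h0 -> s n @[n --> \oo] --> 0 ->
  (forall n, 0 < s n) ->
  (primitive f x (t n + s n * h n) - primitive f x (t n)) / s n @[n --> \oo]
    --> f x t0 * h0.
Proof.
move=> tt hh ss s0.
have [c cP] := choice (fun n => primitive_increment (t n) (s n * h n)).
have -> : (fun n => (primitive f x (t n + s n * h n) - primitive f x (t n)) / s n) =
    (fun n => f x (c n) * h n).
  apply/funext => n; have [_ ->] := cP n; have := s0 n.
  by move: (s n) => r r0; field; exact: lt0r_neq0.
apply: cvgM => //; apply: continuous_cvg; first exact: (@cf t0).
have sh : `|s n * h n| @[n --> \oo] --> 0.
  rewrite -(normr0 R) -(mul0r h0); apply: cvg_norm; exact: cvgM.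
have ct : c n - t n @[n --> \oo] --> 0.
  apply: norm_cvg0; apply: (@squeeze_cvgr _ _ _ _ (fun=> 0) (fun n => `|s n * h n|)) => //.
    by apply: nearW => n; rewrite normr_ge0/=; case: (cP n).
  exact: cvg_cst.
have : (c n - t n) + t n @[n --> \oo] --> 0 + t0 by exact: cvgD.
by under eq_fun do rewrite subrK; rewrite add0r.
Qed.

Lemma uniformly_continuous_segment (a b e : R) : 0 < e -> exists2 d, 0 < d &
  forall s t, s \in `[a, b] -> `|s - t| < d -> `|f x s - f x t| < e.
Proof.
move=> e0; have loc (s : R) : exists2 d, 0 < d &
    forall s' t, `|s - s'| < d -> `|s' - t| < d -> `|f x s' - f x t| < e.
  have e2 : 0 < e / 2 by rewrite divr_gt0.
  have /cvgrPdist_lt/(_ _ e2)/nbhs_ballP[d /= d0 dP] := @cf s.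
  exists (d / 2) => [|s' t ss' s't]; first by rewrite divr_gt0.
  have h1 : `|f x s - f x s'| < e / 2.
    by apply: dP; rewrite -ball_normE/=; lra.
  have h2 : `|f x s - f x t| < e / 2.
    apply: dP; rewrite -ball_normE/=.
    by have := ler_normD (s - s') (s' - t); rewrite addrA subrK; lra.
  have := ler_normD (f x s' - f x s) (f x s - f x t).
  rewrite addrA subrK => /le_lt_trans; apply.
  by rewrite [ltRHS]splitr ltrD// distrC.
have /compact_near_coveringP/(_ _ (0 : R)^'+
    (fun d s => forall t, `|s - t| < d -> `|f x s - f x t| < e)) :=
  @segment_compact R a b.
move=> /(_ _)[] => [s _|].
  have [d d0 dP] := loc s.
  exists (ball s d, [set r | r < d]).
    split=> /=; first exact: nbhsx_ballx.
    by near=> r; near: r; exact: nbhs_right_lt.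
  move=> [s' r]; rewrite -ball_normE/= => -[ss' rd] t s't.
  by apply: dP => //; exact: lt_trans rd.
move=> d /= d0 dP; exists (d / 2) => [|s t sab st]; first by rewrite divr_gt0.
apply: (dP (d / 2)) => //=; last by rewrite divr_gt0.
by rewrite sub0r normrN ger0_norm ?divr_ge0// ?ltW//; lra.
Unshelve. all: by end_near. Qed.

(** Riemann sums exhibit the primitive as a limit of functions that are measurable in
[x]. *)
Lemma primitive_riemann (t : R) :
  t / n.+1%:R * \sum_(k < n.+1) f x (t / n.+1%:R * k%:R) @[n --> \oo]
    --> primitive f x t.
Proof.
apply/cvgrPdist_le => e e0.
have t1 : 0 < `|t| + 1 by rewrite ltr_wpDl.
have [d d0 dP] := @uniformly_continuous_segment (- `|t|) `|t| (e / (`|t| + 1))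
  (divr_gt0 e0 t1).
have [N _ NP] := near_infty_natSinv_lt (PosNum (divr_gt0 d0 t1)).
exists N => // n Nn; have {}NP := NP n Nn.
have n0 : (0 : R) < n.+1%:R by rewrite ltr0n.
pose h := t / n.+1%:R.
have hd : `|h| < d.
  rewrite /h normrM normfV (ger0_norm (ltW n0)).
  move: NP; rewrite /= ltr_pdivlMr//; apply: le_lt_trans.
  by rewrite mulrC ler_wpM2l ?invr_ge0 ?lerDl// ltW.
have step m : (m <= n.+1)%N ->
    `|primitive f x (h * m%:R) - h * \sum_(k < m) f x (h * k%:R)| <=
    m%:R * (`|h| * (e / (`|t| + 1))).
  elim: m => [|m IH] mn.
    by rewrite big_ord0 !mulr0 mul0r primitive0 subrr normr0.
  have [c [cm cE]] := primitive_increment (h * m%:R) h.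
  have hm : h * m.+1%:R = h * m%:R + h by rewrite -natr1 mulrDr mulr1.
  rewrite hm big_ord_recr/= mulrDr.
  rewrite (_ : _ - _ = (primitive f x (h * m%:R) - h * \sum_(k < m) f x (h * k%:R)) +
    h * (f x c - f x (h * m%:R))); last first.
    have -> : primitive f x (h * m%:R + h) = primitive f x (h * m%:R) + f x c * h.
      by rewrite -cE; ring.
    by ring.
  rewrite -natr1 mulrDl mul1r (le_trans (ler_normD _ _))//.
  rewrite lerD ?IH//; first exact: ltnW.
  rewrite normrM ler_wpM2l// distrC ltW//; apply: dP; last first.
    by rewrite distrC (le_lt_trans cm).
  rewrite in_itv/= -ler_norml /h normrM normrM normfV (ger0_norm (ltW n0)).
  rewrite normr_nat -mulrA ler_piMr// mulrC ler_pdivrMr// mul1r ler_nat.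
  exact: ltnW.
have := step n.+1 (leqnn _).
have -> : h * n.+1%:R = t by rewrite /h divfK// lt0r_neq0.
move=> /le_trans; apply.
rewrite /h normrM normfV (ger0_norm (ltW n0)).
rewrite (_ : _ * _ = `|t| * e / (`|t| + 1)).
  by rewrite ler_pdivrMr// mulrC ler_pM2l// lerDl.
by field; rewrite nat1r !lt0r_neq0.
Qed.

End primitive.

(** * Superposition operators on the gasket *)

Section gasket_measure_theory.
Context {R : realType} {p : 'I_3 -> 'rV[R]_2} {V : set 'rV[R]_2}.
Hypothesis p_equilateral : equilateral p.
Hypothesis gasketV : is_gasket p V.
Local Notation mu := (gasket_measure V).
Local Notation T := (@gasket_space R).
Local Notation H := (hausdorff (@gasket_dim R)).

Lemma gasket_measureE (A : set 'rV[R]_2) : mu A = ((fine (H V))^-1%:E * H A)%E.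
Proof. by []. Qed.

Lemma hausdorff_gasket : (0 < H V < +oo)%E.
Proof.
have [b [b1 b2 b3 b4 b5]] := barycentric_coordinates p_equilateral.
rewrite (hausdorff_gasket_gt0 gasketV b1 b2 b3 b5).
exact: hausdorff_gasket_lty gasketV.
Qed.

Lemma fine_hausdorff_gasket_gt0 : 0 < fine (H V).
Proof. by rewrite fine_gt0//; exact: hausdorff_gasket. Qed.

Lemma gasket_measure_gasket : mu V = 1%E.
Proof.
have /andP[h0 hoo] := hausdorff_gasket.
have hfin : H V \is a fin_num by rewrite ge0_fin_numE// ltW.
rewrite gasket_measureE -[X in (_ * X)%E](fineK hfin) -EFinM mulVf//.
exact/lt0r_neq0/fine_hausdorff_gasket_gt0.
Qed.

Lemma closed_gasket_measurable (C : set 'rV[R]_2) :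
  closed C -> measurable (C : set T).
Proof. exact: hausdorff_closed_measurable. Qed.

Lemma measurable_gasket : measurable (V : set T).
Proof.
apply: closed_gasket_measurable; case: gasketV => cV _ _.
by apply: compact_closed; first exact: norm_hausdorff.
Qed.

Lemma gasket_measure_complete : measure_is_complete mu.
Proof.
move=> B [A [mA muA BA]]; apply: measure_is_complete_caratheodory.
exists A; split => //; move: muA; rewrite gasket_measureE => /eqP.
rewrite mule_eq0 => /orP[|/eqP//].
by rewrite eqe invr_eq0 (gt_eqF fine_hausdorff_gasket_gt0).
Qed.

(** A cell has positive measure because the gasket is its image under an affine map
that doubles the distances [size w] times. *)
Lemma gasket_measure_cell (w : seq 'I_3) : (0 < mu (Fword p w @` V))%E.
Proof.
rewrite gasket_measureE mule_gt0//.
  by rewrite lte_fin invr_gt0 fine_hausdorff_gasket_gt0.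
elim: w => [|i w IH].
  have /andP[+ _] := hausdorff_gasket; congr (_ < H _)%E.
  by rewrite /= image_id.
have -> : Fword p (i :: w) @` V = Fmap p i @` (Fword p w @` V).
  by rewrite -image_comp.
move: (Fword p w @` V) IH => A A0.
pose g x : 'rV[R]_2 := 2 *: x - p i.
have gA : g @` (Fmap p i @` A) = A.
  apply/seteqP; split=> [_ [_ [x Ax <-] <-]|x Ax].
    by rewrite /g double_Fmap.
  by exists (Fmap p i x); [exists x|rewrite /g double_Fmap].
have g2 x y : eucl_dist (g x) (g y) <= 2 * eucl_dist x y.
  have -> : x = Fmap p i (g x) by apply: row2P; rewrite /Fmap /g !mxE; field.
  have -> : y = Fmap p i (g y) by apply: row2P; rewrite /Fmap /g !mxE; field.
  by rewrite eucl_dist_Fmap /g !double_Fmap mulrA divff ?mul1r ?pnatr_eq0.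
have := hausdorff_lipschitz (@gasket_dim_gt0 R) (Fmap p i @` A) (ltr0n R 2) g2.
by rewrite gA => /(lt_le_trans A0); rewrite pmule_rgt0// lte_fin powR_gt0.
Qed.

Lemma within_continuous_measurable (u : 'rV[R]_2 -> R) :
  {within V, continuous u} -> measurable_fun (V : set T) u.
Proof.
move=> cu mV; apply: (measurability _ (RGenCInfty.measurableE R)).
move=> _ [_ [a ->] <-].
have /continuous_closedP/(_ `[a, +oo[%classic) := cu.
move=> /(_ (@interval_closed _ (BLeft a) +oo%O erefl erefl)).
move=> /closed_subspaceP[C cC CV].
have -> : V `&` u @^-1` `[a, +oo[ = C `&` V.
  by rewrite CV setIC.
  by apply: measurableI => //; exact: closed_gasket_measurable.
exact: mV.
Qed.

Lemma within_continuous_bounded (u : 'rV[R]_2 -> R) :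
  {within V, continuous u} -> exists2 M, 0 < M & forall x, V x -> `|u x| <= M.
Proof.
move=> cu; case: (gasketV) => cV V0 _.
have [c /set_mem Vc cmax] := compact_EVT_max V0 cV cu.
have [c' /set_mem Vc' cmin] := compact_EVT_min V0 cV cu.
exists (`|u c| + `|u c'| + 1) => [|x Vx].
  by rewrite ltr_wpDl ?addr_ge0.
have := cmax x (mem_set Vx); have := cmin x (mem_set Vx).
have := ler_norm (u c); have := ler_norm (- u c'); rewrite normrN.
have := normr_ge0 (u c); have := normr_ge0 (u c').
by rewrite ler_norml; lra.
Qed.

Lemma integrable_cst (c : R) : mu.-integrable V (EFin \o (fun=> c)).
Proof.
apply/integrableP; split; first exact: measurable_cst.
rewrite (_ : (fun x => _) = cst `|c|%:E); last by apply/funext.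
rewrite integral_cst; last exact: measurable_gasket.
by rewrite gasket_measure_gasket mule1 ltry.
Qed.

Lemma within_continuous_integrable (u : 'rV[R]_2 -> R) :
  {within V, continuous u} -> mu.-integrable V (EFin \o u).
Proof.
move=> cu; have [M M0 uM] := within_continuous_bounded cu.
apply: (@ae_integrable_le _ T R mu V measurable_gasket gasket_measure_complete u (fun=> M)).
- exact: within_continuous_measurable.
- exact: integrable_cst.
- by apply: aeW.
Qed.

Section nemytskii.
Context {f : 'rV[R]_2 -> R -> R}.
Hypothesis f_caratheodory : L1_Caratheodory V f.
Implicit Types (u v h : 'rV[R]_2 -> R) (us hs : nat -> 'rV[R]_2 -> R).
Local Notation F := (primitive f).
Let mV := measurable_gasket.
Let muC := gasket_measure_complete.

Let mf t : measurable_fun (V : set T) (f ^~ t).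
Proof. by case: f_caratheodory. Qed.

Let cf : {ae mu, forall x, V x -> continuous (f x)}.
Proof. by case: f_caratheodory. Qed.

Let dom (M : R) : 0 < M -> exists fM : 'rV[R]_2 -> R,
  [/\ mu.-integrable V (EFin \o fM), forall x, V x -> 0 <= fM x
    & {ae mu, forall x, V x -> forall t, `|t| <= M -> `|f x t| <= fM x}].
Proof. by case: f_caratheodory => _ _; exact. Qed.

Lemma measurable_nemytskii u : {within V, continuous u} ->
  measurable_fun (V : set T) (fun x => f x (u x)).
Proof.
move=> cu; have [M _ uM] := within_continuous_bounded cu.
apply: (@measurable_caratheodory _ T R mu V mV muC f u M) => //.
exact: within_continuous_measurable.
Qed.

Lemma measurable_primitive t : measurable_fun (V : set T) (F ^~ t).
Proof.
apply: (@measurable_fun_ae_cvg _ T R mu V mV muC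
  (fun n x => t / n.+1%:R * \sum_(k < n.+1) f x (t / n.+1%:R * k%:R))).
  move=> n; apply: measurable_funM; first exact: measurable_cst.
  by apply: measurable_sum => k; exact: mf.
by apply: (ae_imply cf) => x cfx Vx; exact/primitive_riemann/cfx.
Qed.

Lemma measurable_primitive_nemytskii u : {within V, continuous u} ->
  measurable_fun (V : set T) (fun x => F x (u x)).
Proof.
move=> cu; have [M _ uM] := within_continuous_bounded cu.
apply: (@measurable_caratheodory _ T R mu V mV muC F u M).
- exact: measurable_primitive.
- by apply: (ae_imply cf) => x cfx Vx; exact/primitive_continuous/cfx.
- exact: within_continuous_measurable.
- exact: uM.
Qed.

Lemma integrable_nemytskii u h : {within V, continuous u} ->
  {within V, continuous h} -> mu.-integrable V (EFin \o (fun x => f x (u x) * h x)).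
Proof.
move=> cu ch; have [M M0 uM] := within_continuous_bounded cu.
have [K K0 hK] := within_continuous_bounded ch.
have [fM [ifM fM0 fP]] := dom M0.
apply: (@ae_integrable_le _ T R mu V mV muC _ (fun x => fM x * K)).
- apply: measurable_funM; first exact: (measurable_nemytskii cu).
  exact: within_continuous_measurable.
- have := @integrableZr _ T R mu V mV K _ ifM; congr integrable.
- apply: (ae_imply fP) => x fx Vx; rewrite normrM ler_pM//; last exact: hK.
  by apply: fx => //; exact: uM.
Qed.

Lemma integrable_primitive u : {within V, continuous u} ->
  mu.-integrable V (EFin \o (fun x => F x (u x))).
Proof.
move=> cu; have [M M0 uM] := within_continuous_bounded cu.
have [fM [ifM fM0 fP]] := dom M0.
apply: (@ae_integrable_le _ T R mu V mV muC _ (fun x => M * fM x)).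
- exact: (measurable_primitive_nemytskii cu).
- have := @integrableZl _ T R mu V mV M _ ifM; congr integrable.
- apply: (ae_imply2 cf fP) => x cfx fx Vx.
  by apply: (primitive_bound (cfx Vx)); [exact: fx|exact: uM].
Qed.

Lemma nemytskii_cvg us u (M : R) : (forall n, {within V, continuous (us n)}) ->
  uconv V us u -> (forall n x, V x -> `|us n x| <= M) ->
  \int[mu]_(x in V) `|f x (us n x) - f x (u x)| @[n --> \oo] --> 0.
Proof.
move=> cus uu usM; have cu := uconv_within_continuous cus uu.
have uM x : V x -> `|u x| <= M.
  move=> Vx; have h : `|us n x| @[n --> \oo] --> `|u x|.
    by apply: cvg_norm; exact: (uconv_cvg uu Vx).
  rewrite -(cvg_lim (@Rhausdorff R) h); apply: limr_le.
    by apply/cvg_ex; eexists; exact: h.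
  by apply: nearW => n; exact: usM.
have M0 : 0 < `|M| + 1 by rewrite ltr_wpDl.
have le (t : R) : `|t| <= M -> `|t| <= `|M| + 1.
  by move=> h; have := ler_norm M; lra.
have [fM [ifM fM0 fP]] := dom M0.
have [] := @dominated_Rintegral _ T R mu V mV muC
  (fun n x => `|f x (us n x) - f x (u x)|) (fun=> 0) (fun x => 2 * fM x).
- move=> n; apply: measurableT_comp; first exact: normr_measurable.
  apply: measurable_funB; first exact: (measurable_nemytskii (cus n)).
  exact: (measurable_nemytskii cu).
- apply: (ae_imply cf) => x cfx Vx.
  rewrite -(normr0 R) -(subrr (f x (u x))); apply: cvg_norm; apply: cvgB.
    by apply: continuous_cvg; [exact: (cfx Vx (u x))|exact: (uconv_cvg uu Vx)].
  exact: cvg_cst.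
- have := @integrableZl _ T R mu V mV 2 _ ifM; congr integrable.
- apply: (ae_imply fP) => x fx Vx n; rewrite normr_id (le_trans (ler_normB _ _))//.
  have := fx Vx _ (le _ (usM n x Vx)); have := fx Vx _ (le _ (uM x Vx)); lra.
by move=> _; rewrite (_ : \int[mu]_(x in V) 0 = 0)// Rintegral_cst// mul0r.
Qed.

Lemma primitive_cvg us u (M : R) : (forall n, {within V, continuous (us n)}) ->
  uconv V us u -> (forall n x, V x -> `|us n x| <= M) ->
  \int[mu]_(x in V) F x (us n x) @[n --> \oo] --> \int[mu]_(x in V) F x (u x).
Proof.
move=> cus uu usM; have cu := uconv_within_continuous cus uu.
have M0 : 0 < `|M| + 1 by rewrite ltr_wpDl.
have le (t : R) : `|t| <= M -> `|t| <= `|M| + 1.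
  by move=> h; have := ler_norm M; lra.
have [fM [ifM fM0 fP]] := dom M0.
have [] := @dominated_Rintegral _ T R mu V mV muC
  (fun n x => F x (us n x)) (fun x => F x (u x)) (fun x => (`|M| + 1) * fM x).
- by move=> n; exact: (measurable_primitive_nemytskii (cus n)).
- apply: (ae_imply cf) => x cfx Vx.
  apply: continuous_cvg; [exact: (primitive_continuous (cfx Vx))|exact: (uconv_cvg uu Vx)].
- have := @integrableZl _ T R mu V mV (`|M| + 1) _ ifM; congr integrable.
- apply: (ae_imply2 cf fP) => x cfx fx Vx n.
  by apply: (primitive_bound (cfx Vx)); [exact: fx|exact/le/usM].
by [].
Qed.

(** Differentiability of [u |-> \int F x (u x)] along varying base points and
directions: by compactness this is all the uniformity that the descent steps
below need. *)
Lemma primitive_quotient_cvg us u hs h (s : nat -> R) (M : R) :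
  (forall n, {within V, continuous (us n)}) -> uconv V us u ->
  (forall n, {within V, continuous (hs n)}) -> uconv V hs h ->
  (forall n x, V x -> `|us n x| <= M) -> (forall n x, V x -> `|hs n x| <= M) ->
  (forall n, 0 < s n <= 1) -> s n @[n --> \oo] --> 0 ->
  \int[mu]_(x in V) ((F x (us n x + s n * hs n x) - F x (us n x)) / s n -
    f x (us n x) * hs n x) @[n --> \oo] --> 0.
Proof.
move=> cus uu chs hh usM hsM s01 s0.
have M0 : 0 < `|M| + `|M| + 1 by rewrite ltr_wpDl ?addr_ge0.
have [fM [ifM fM0 fP]] := dom M0.
have ush n : {within V, continuous (fun x => us n x + s n * hs n x)}.
  rewrite (_ : (fun x => _) = (fun x => 1 * us n x + s n * hs n x)).
    by apply: within_continuous_comb; [exact: cus|exact: chs].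
  by apply/funext => x; rewrite mul1r.
have [] := @dominated_Rintegral _ T R mu V mV muC
  (fun n x => (F x (us n x + s n * hs n x) - F x (us n x)) / s n -
    f x (us n x) * hs n x) (fun=> 0) (fun x => 2 * `|M| * fM x).
- move=> n; apply: measurable_funB.
    apply: measurable_funM; last exact: measurable_cst.
    apply: measurable_funB; first exact: (measurable_primitive_nemytskii (ush n)).
    exact: (measurable_primitive_nemytskii (cus n)).
  apply: measurable_funM; first exact: (measurable_nemytskii (cus n)).
  exact: within_continuous_measurable.
- apply: (ae_imply cf) => x cfx Vx.
  rewrite -(subrr (f x (u x) * h x)); apply: cvgB.
    apply: (primitive_quotient (cfx Vx)).
    - exact: (uconv_cvg uu Vx).
    - exact: (uconv_cvg hh Vx).
    - exact: s0.
    - by move=> n; case/andP: (s01 n).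
  apply: cvgM; last exact: (uconv_cvg hh Vx).
  by apply: continuous_cvg; [exact: (cfx Vx (u x))|exact: (uconv_cvg uu Vx)].
- have := @integrableZl _ T R mu V mV (2 * `|M|) _ ifM; congr integrable.
- apply: (ae_imply2 cf fP) => x cfx fx Vx n.
  have /andP[sn0 sn1] := s01 n.
  have hM : `|hs n x| <= `|M| by rewrite (le_trans (hsM n x Vx))// ler_norm.
  have uM : `|us n x| <= `|M| + `|M| + 1.
    by have := usM n x Vx; have := ler_norm M; have := normr_ge0 M; lra.
  have uM' : `|us n x + s n * hs n x| <= `|M| + `|M| + 1.
    rewrite (le_trans (ler_normD _ _))// normrM (ger0_norm (ltW sn0)).
    have : s n * `|hs n x| <= `|hs n x| by rewrite ler_piMl.
    by have := usM n x Vx; have := ler_norm M; lra.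
  have fM0' := fM0 x Vx.
  have h1 := primitive_lipschitz (cfx Vx) (fx Vx) uM uM'.
  rewrite (_ : us n x + s n * hs n x - us n x = s n * hs n x) in h1; last by ring.
  have h2 : `|(F x (us n x + s n * hs n x) - F x (us n x)) / s n| <= fM x * `|M|.
    rewrite normrM normfV (ger0_norm (ltW sn0)) ler_pdivrMr//.
    apply: (le_trans h1).
    rewrite normrM (ger0_norm (ltW sn0)) mulrCA [leRHS]mulrC.
    by apply: ler_wpM2l; [exact: ltW|exact: ler_wpM2l].
  have h3 : `|f x (us n x) * hs n x| <= fM x * `|M|.
    by rewrite normrM ler_pM//; exact: fx.
  by rewrite (le_trans (ler_normB _ _))//; lra.
by move=> _; rewrite (_ : \int[mu]_(x in V) 0 = 0)// Rintegral_cst// mul0r.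
Qed.

End nemytskii.
End gasket_measure_theory.

(** * The variational problem *)

(** A nonnegative function of integral zero vanishes almost everywhere, but cells are not
negligible. *)
Lemma Rintegral_cell_gt0 {R : realType} {p : 'I_3 -> 'rV[R]_2} {V : set 'rV[R]_2}
    (w : seq 'I_3) (g : 'rV[R]_2 -> R) : equilateral p -> is_gasket p V ->
  (gasket_measure V).-integrable V (EFin \o g) ->
  {ae gasket_measure V, forall x, V x -> 0 <= g x} ->
  {ae gasket_measure V, forall x, (Fword p w @` V) x -> 0 < g x} ->
  0 < \int[gasket_measure V]_(x in V) g x.
Proof.
move=> pE gV ig g0 gB; have mV := measurable_gasket gV.
have muC := gasket_measure_complete pE gV.
have VB x : (Fword p w @` V) x -> V x by move=> [y Vy <-]; exact: Fword_gasket.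
have ge0 : 0 <= \int[gasket_measure V]_(x in V) g x.
  have <- : \int[gasket_measure V]_(x in V) (fun=> 0 : R) x = 0.
    by rewrite Rintegral_cst// mul0r.
  by apply: (ae_le_Rintegral mV muC) => //; exact: (integrable_cst pE gV).
rewrite lt_neqAle ge0 andbT; apply/eqP => I0.
have ing := integrable_norm ig.
have : \int[gasket_measure V]_(x in V) `|g x| <= 0.
  rewrite I0; apply: (ae_le_Rintegral mV muC) => //.
  by apply: (ae_imply g0) => x gx Vx; rewrite ger0_norm// gx.
have : 0 <= \int[gasket_measure V]_(x in V) `|g x| by apply: Rintegral_ge0.
move=> n0 n1; have I1 : \int[gasket_measure V]_(x in V) `|g x| = 0.
  by apply/eqP; rewrite eq_le n1 n0.
have /ae_eq_integral_abs : (\int[gasket_measure V]_(x in V) `|(EFin \o g) x| = 0)%E.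
  rewrite -[LHS]fineK; first by congr (_%:E).
  exact: (integral_fune_fin_num mV ing).
move=> /(_ mV (measurable_int _ ig)) gz.
have := gasket_measure_cell pE gV w; rewrite (@measure_negligible _ _ _ (gasket_measure V)) ?ltxx//.
  by apply: closed_gasket_measurable; exact: cell_closed.
suff : {ae gasket_measure V, forall x, ~ (Fword p w @` V) x}.
  by move=> [N [mN N0 BN]]; exists N; split => // x Bx; apply: BN => /=; apply.
apply: (ae_imply2 gz gB) => x gx0 gBx Bx.
have := gBx Bx; have := gx0 (VB x Bx); rewrite /= => -[->].
by rewrite ltxx.
Qed.

Lemma quadratic_bound {R : realFieldType} (k A B y : R) : 0 < k -> 0 <= A -> 0 <= B ->
  k * y ^+ 2 <= A * y + B -> y <= 1 + (A + B) / k.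
Proof.
move=> k0 A0 B0 h; have [y1|y1] := leP y 1.
  by rewrite (le_trans y1)// lerDl divr_ge0 ?addr_ge0// ltW.
have y0 : 0 < y by lra.
suff : y <= (A + B) / k by lra.
rewrite ler_pdivlMr// -(ler_pM2l y0).
have : B <= B * y by rewrite ler_peMr// ltW.
by move: h; rewrite expr2; lra.
Qed.

(** When the argument is multiplied by [r], the energy grows by the factor on the left and
[primitive f x], by [primitive_ratio] below, at least by the factor on the right. For
[r = 1 + e] these are [1 + 2 e] and [1 + theta e] to first order in [e]. *)
Lemma superquadratic_ratio {R : realFieldType} (theta : R) : 2 < theta ->
  exists r, 1 < r /\ r ^+ 2 < 1 + theta * (1 - r^-1).
Proof.
move=> th2; pose e := Num.min 1 ((theta - 2) / 5).
have e0 : 0 < e by rewrite lt_min ltr01 divr_gt0// subr_gt0.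
have e1 : e <= 1 by rewrite /e ge_min lexx.
have e2 : 5 * e <= theta - 2 by rewrite mulrC -ler_pdivlMr// /e ge_min lexx orbT.
exists (1 + e); split; first by rewrite ltrDl.
have r0 : 0 < 1 + e by rewrite addr_gt0.
have -> : 1 + theta * (1 - (1 + e)^-1) = 1 + theta * (e / (1 + e)).
  by field; rewrite lt0r_neq0.
rewrite -ltrBlDl mulrA ltr_pdivlMr//.
have -> : ((1 + e) ^+ 2 - 1) * (1 + e) = (2 + 3 * e + e * e) * e by ring.
rewrite ltr_pM2r//; have : e * e <= e by rewrite ler_piMl// ltW.
lra.
Qed.

Section variational.
Context {R : realType} {p : 'I_3 -> 'rV[R]_2} {V : set 'rV[R]_2}.
Context {a : 'rV[R]_2 -> R} {am ap : R}.
Hypothesis p_equilateral : equilateral p.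
Hypothesis gasketV : is_gasket p V.
Hypothesis am_gt0 : 0 < am.
Hypothesis am_le : forall x, Vinfty p x -> am <= a x.
Hypothesis le_ap : forall x, Vinfty p x -> a x <= ap.
Local Notation fct := ('rV[R]_2 -> R).
Local Notation mu := (gasket_measure V).
Local Notation T := (@gasket_space R).
Local Notation En := (Energy p).
Local Notation W := (WEnergy p a).
Implicit Types (u v h : 'rV[R]_2 -> R) (us hs : nat -> 'rV[R]_2 -> R).

Let mV := measurable_gasket gasketV.
Let muC := gasket_measure_complete p_equilateral gasketV.

Let ap_ge0 : 0 <= ap.
Proof.
have Vp : Vinfty p (p 0) by exists [::], 0.
exact: le_trans (ltW am_gt0) (le_trans (am_le Vp) (le_ap Vp)).
Qed.

Lemma H01_continuous u : H01 p V u -> {within V, continuous u}.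
Proof. by case. Qed.

Lemma H01D u v : H01 p V u -> H01 p V v -> H01 p V (fun x => u x + v x).
Proof.
move=> Hu Hv; have := H01_comb 1 1 Hu Hv.
by under eq_fun do rewrite !mul1r.
Qed.

Lemma H01_0 : H01 p V (fun=> 0).
Proof.
apply/H01P; split=> //; first by move=> x; exact: cst_continuous.
exists 0 => n; rewrite graph_energyE (_ : (fun _ _ => _) = fun _ _ => 0).
  by rewrite edge_sum0.
by apply/funext => x; apply/funext => y; rewrite subrr expr0n mulr0.
Qed.

Lemma Energy0 : En (fun=> 0) = 0.
Proof.
have := EnergyZ 0 (H01_finite H01_0); by rewrite expr0n/= !mul0r.
Qed.

Lemma WEnergy0 : W (fun=> 0) = 0.
Proof.
have := WEnergyZ am_gt0 am_le le_ap 0 (H01_finite H01_0); by rewrite expr0n/= !mul0r.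
Qed.

(** Minimization of [W / 2 - Q] for a coercive [Q] that is continuous for uniform
convergence on energy balls. A minimizing sequence converges uniformly along a
subsequence, and then also in energy: by strong convexity a large
[En (us n - us m)] would make the value at [(us n + us m) / 2] smaller than the
infimum. Hence no semicontinuity of [W] is needed. *)
Lemma minimizer_exists (Q : fct -> R) (c0 C : R) : 0 < c0 ->
  (forall u, H01 p V u -> forall M e, 0 < e -> exists2 d, 0 < d &
     forall v, H01 p V v -> En v <= M -> (forall x, V x -> `|v x - u x| < d) ->
       `|Q v - Q u| < e) ->
  (forall u, H01 p V u -> c0 * En u - C <= W u / 2 - Q u) ->
  exists2 u, H01 p V u & forall v, H01 p V v -> W u / 2 - Q u <= W v / 2 - Q v.
Proof.
move=> c00 cQ coerQ; pose J u := W u / 2 - Q u; pose S := [set J u | u in H01 p V].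
have J_ge u : H01 p V u -> - C <= J u.
  move=> Hu; apply: le_trans (coerQ u Hu).
  have : 0 <= c0 * En u by rewrite mulr_ge0 ?Energy_ge0// ltW.
  lra.
have infS : has_inf S.
  split; first by exists (J (fun=> 0)), (fun=> 0) => //; exact: H01_0.
  by exists (- C) => _ [u Hu <-]; exact: J_ge.
pose m := inf S.
have m_le u : H01 p V u -> m <= J u.
  by move=> Hu; apply: ge_inf; [case: infS|exists u].
have ex n : exists u, H01 p V u /\ J u < m + n.+1%:R^-1.
  have n0 : 0 < n.+1%:R^-1 :> R by rewrite invr_gt0.
  have [_ [u Hu <-] Ju] := inf_adherent n0 infS.
  by exists u.
have [us usP] := choice ex.
pose M := (m + 1 + C) / c0.
have EM n : En (us n) <= M.
  have [Hu Ju] := usP n; rewrite /M ler_pdivlMr// mulrC.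
  have := coerQ _ Hu; have : n.+1%:R^-1 <= 1 :> R by rewrite invf_le1 ?ler1n ?ltr0n.
  by move: Ju; rewrite /J; move: (n.+1%:R^-1) => r; lra.
have [k [u [kn Hu uu]]] := H01_compact gasketV (fun n => (usP n).1) EM.
pose vs := us \o k.
have Hvs n : H01 p V (vs n) by case: (usP (k n)).
have EvM n : En (vs n) <= M by exact: EM.
have Jvs n : J (vs n) < m + n.+1%:R^-1.
  have [_ /lt_le_trans] := usP (k n); apply; rewrite lerD2l lef_pV2 ?posrE ?ltr0n//.
  by rewrite ler_nat ltnS.
have evs : econv p vs u.
  apply: (econv_cauchy gasketV uu) => [n|e e0]; first exact: H01_finite.
  have e8 : 0 < am * e / 32 by rewrite divr_gt0// mulr_gt0.
  have [d d0 dP] := cQ u Hu M (am * e / 32) e8.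
  have [N1 _ N1P] := uu d d0.
  have [N2 _ N2P] := near_infty_natSinv_lt (PosNum e8).
  exists (maxn N1 N2) => i j; rewrite !geq_max => /andP[i1 i2] /andP[j1 j2].
  (* The midpoint [w] of [vs i] and [vs j] competes with both of them. *)
  have Hij := H01_comb 2^-1 2^-1 (Hvs j) (Hvs i).
  have half : 2^-1 + 2^-1 = 1 :> R by field.
  have h2 : 0 <= 2^-1 :> R by rewrite invr_ge0.
  have fv n := H01_finite (Hvs n).
  have := WEnergy_comb am_gt0 am_le le_ap h2 h2 half (fv j) (fv i).
  have := m_le _ Hij; rewrite {1}/J.
  set w := (fun x => _) in Hij *.
  have Ew : En w <= M.
    have := Energy_comb h2 h2 half (fv j) (fv i); rewrite -/w.
    have := EvM i; have := EvM j; lra.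
  have close n x : (N1 <= n)%N -> V x -> `|vs n x - u x| < d by move=> /N1P; apply.
  have wd x : V x -> `|w x - u x| < d.
    move=> Vx; have := close j x j1 Vx; have := close i x i1 Vx.
    by rewrite /w !ltr_norml => *; lra.
  have := dP w Hij Ew wd; have := dP _ (Hvs i) (EvM i) (fun x => close i x i1).
  have := dP _ (Hvs j) (EvM j) (fun x => close j x j1).
  have := lt_trans (Jvs i) (_ : _ < m + am * e / 32); rewrite ltrD2l => /(_ (N2P i i2)).
  have := lt_trans (Jvs j) (_ : _ < m + am * e / 32); rewrite ltrD2l => /(_ (N2P j j2)).
  rewrite /J !ltr_norml; set Eij := En _; set Wi := W (vs i); set Wj := W (vs j).
  move=> J1 J2 /andP[q1 q2] /andP[q3 q4] /andP[q5 q6] mw ww.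
  rewrite -(ler_pM2l am_gt0); lra.
exists u => // v Hv; suff -> : W u / 2 - Q u = m by exact: m_le.
apply/eqP; rewrite eq_le m_le// andbT.
suff h (e : R) : 0 < e -> W u / 2 - Q u <= m + e by apply/ler_addgt0Pr => e; exact: h.
move=> e0.
have cW := WEnergy_cvg am_gt0 am_le le_ap (fun n => H01_finite (Hvs n)) (H01_finite Hu) evs.
have e3 : 0 < e / 3 by rewrite divr_gt0.
have [d d0 dP] := cQ u Hu M (e / 3) e3.
have [n [[h1 h2] h3]] : exists n, (`|W u - W (vs n)| < e / 3 /\
    (forall x, V x -> `|vs n x - u x| < d)) /\ n.+1%:R^-1 < e / 3.
  apply: (@filter_ex _ \oo); apply: filterI; first apply: filterI.
  - by move/cvgrPdist_lt: cW; apply.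
  - exact: uu.
  - exact: near_infty_natSinv_lt (PosNum e3).
have := dP _ (Hvs n) (EvM n) h2; have := Jvs n; move: h1; rewrite /J !ltr_norml.
move: (W u) (W (vs n)) (Q u) (Q (vs n)) (n.+1%:R^-1) h3 (m) => w1 w2 q1 q2 r h3 l.
by move=> /andP[? ?] ? /andP[? ?]; lra.
Qed.

Section nonlinearity.
Context {f : 'rV[R]_2 -> R -> R}.
Hypothesis f_caratheodory : L1_Caratheodory V f.
Local Notation F := (primitive f).

(** The derivative of [potential] at [u] in the direction [v]. *)
Definition dpotential u v : R := \int[mu]_(x in V) (f x (u x) * v x).
Definition potential u : R := \int[mu]_(x in V) F x (u x).
Definition action u : R := W u / 2 - potential u.

Let int_f u v : H01 p V u -> H01 p V v ->
  mu.-integrable V (EFin \o (fun x => f x (u x) * v x)).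
Proof.
by move=> [cu _ _] [cv _ _]; exact: (integrable_nemytskii p_equilateral gasketV).
Qed.

Lemma dpotentialB u v w : H01 p V u -> H01 p V v -> H01 p V w ->
  dpotential u (fun x => v x - w x) = dpotential u v - dpotential u w.
Proof.
move=> Hu Hv Hw; rewrite /dpotential -RintegralB; last 3 first.
- exact: mV.
- exact: int_f.
- exact: int_f.
by apply: eq_Rintegral => x _; rewrite mulrBr.
Qed.

Lemma dpotentialZ u v (t : R) : H01 p V u -> H01 p V v ->
  dpotential u (fun x => t * v x) = t * dpotential u v.
Proof.
move=> Hu Hv; rewrite /dpotential -RintegralZl; last 2 first.
- exact: mV.
- exact: int_f.
by apply: eq_Rintegral => x _; rewrite mulrCA.
Qed.

Lemma dpotentialD u v w : H01 p V u -> H01 p V v -> H01 p V w ->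
  dpotential u (fun x => v x + w x) = dpotential u v + dpotential u w.
Proof.
move=> Hu Hv Hw; rewrite /dpotential -RintegralD; last 3 first.
- exact: mV.
- exact: int_f.
- exact: int_f.
by apply: eq_Rintegral => x _; rewrite mulrDr.
Qed.

Lemma integrable_normf u : H01 p V u ->
  mu.-integrable V (EFin \o (fun x => `|f x (u x)|)).
Proof.
move=> [cu _ _]; have c1 : {within V, continuous (fun=> 1 : R)}.
  by move=> x; exact: cst_continuous.
have := integrable_nemytskii p_equilateral gasketV f_caratheodory cu c1.
move=> /integrable_norm; congr integrable; apply/funext => x /=.
by rewrite mulr1.
Qed.

Lemma dpotential_bound u u' v (S : R) : H01 p V u -> H01 p V u' -> H01 p V v ->
  (forall x, V x -> `|v x| <= S) ->
  `|dpotential u v - dpotential u' v| <=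
  S * \int[mu]_(x in V) `|f x (u x) - f x (u' x)|.
Proof.
move=> Hu Hu' Hv vS.
have iff : mu.-integrable V (EFin \o (fun x => f x (u x) * v x - f x (u' x) * v x)).
  by have := integrableB mV (int_f Hu Hv) (int_f Hu' Hv); congr integrable.
have idf : mu.-integrable V (EFin \o (fun x => `|f x (u x) - f x (u' x)|)).
  have c1 : {within V, continuous (fun=> 1 : R)} by move=> x; exact: cst_continuous.
  have i1 := integrable_nemytskii p_equilateral gasketV f_caratheodory
    (H01_continuous Hu) c1.
  have i2 := integrable_nemytskii p_equilateral gasketV f_caratheodory
    (H01_continuous Hu') c1.
  have := integrable_norm (integrableB mV i1 i2); congr integrable.
  by apply/funext => x /=; rewrite !mulr1.
rewrite /dpotential -RintegralB; [|exact: mV|exact: int_f|exact: int_f].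
rewrite (le_trans (le_normr_Rintegral mV iff))// -RintegralZl//.
apply: le_Rintegral; first exact: mV.
- by have := integrable_norm iff; congr integrable.
- by have := integrableZl mV S idf; congr integrable.
- move=> x Vx; rewrite -mulrBl normrM mulrC ler_wpM2r//.
  exact: vS.
Qed.

Lemma dpotential_le u v (S : R) : H01 p V u -> H01 p V v ->
  (forall x, V x -> `|v x| <= S) ->
  `|dpotential u v| <= S * \int[mu]_(x in V) `|f x (u x)|.
Proof.
move=> Hu Hv vS; rewrite (le_trans (le_normr_Rintegral mV (int_f Hu Hv)))//.
rewrite -RintegralZl; [|exact: mV|exact: integrable_normf].
apply: le_Rintegral; first exact: mV.
- by have := integrable_norm (int_f Hu Hv); congr integrable.
- by have := integrableZl mV S (integrable_normf Hu); congr integrable.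
- move=> x Vx; rewrite normrM mulrC ler_wpM2r//.
  exact: vS.
Qed.

Lemma normf_bound (M : R) : exists2 K : R, 0 <= K &
  forall u, H01 p V u -> En u <= M -> \int[mu]_(x in V) `|f x (u x)| <= K.
Proof.
pose S := 5 * Num.sqrt `|M| + 1.
have S0 : 0 < S by rewrite ltr_wpDl// mulr_ge0// sqrtr_ge0.
have [_ _ /(_ S S0)[fM [ifM fM0 fP]]] := f_caratheodory.
exists (\int[mu]_(x in V) fM x) => [|u Hu uM].
  by apply: Rintegral_ge0.
apply: (ae_le_Rintegral mV muC) => //; first exact: integrable_normf.
apply: (ae_imply fP) => x fx Vx; apply: fx => //.
have : `|u x| <= 5 * Num.sqrt `|M|.
  apply: (H01_sup_le gasketV _ Hu) => //.
  by rewrite sqr_sqrtr// (le_trans uM)// ler_norm.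
by move=> h; rewrite /S (le_trans h)// lerDl.
Qed.

(** The map [resolvent u] is the solution operator of the equation with right-hand side
[f x (u x)]; the last term expresses the strong convexity of its variational
problem. Its fixed points are the solutions of the nonlinear equation. *)
Definition is_resolvent u w : Prop := H01 p V w /\ forall v, H01 p V v ->
  W w / 2 - dpotential u w + am / 4 * En (fun x => v x - w x) <=
  W v / 2 - dpotential u v.

Definition resolvent u : fct := xget u (is_resolvent u).

Lemma resolventP u : H01 p V u -> is_resolvent u (resolvent u).
Proof.
move=> Hu; suff : exists w, is_resolvent u w by exact: xgetPex.
pose K := \int[mu]_(x in V) `|f x (u x)|.
have K0 : 0 <= K by apply: Rintegral_ge0.
have c0 : 0 < am / 4 by rewrite divr_gt0.
have [|v Hv|w Hw wmin] := @minimizer_exists (dpotential u) (am / 4) (25 * K ^+ 2 / am) c0.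
- move=> v Hv M e e0; exists (e / (K + 1)) => [|v' Hv' _ vv'].
    by rewrite divr_gt0// ltr_wpDl.
  have vv x : V x -> `|v' x - v x| <= e / (K + 1) by move=> /vv'/ltW.
  rewrite -dpotentialB// (le_lt_trans (dpotential_le Hu (H01B Hv' Hv) vv))//.
  rewrite -/K mulrAC ltr_pdivrMr ?ltr_wpDl//.
  by rewrite ltr_pM2l// ltrDl.
- have := dpotential_le Hu Hv (H01_sup gasketV Hv).
  have := WEnergy_ge am_gt0 am_le le_ap (H01_finite Hv); rewrite -/K.
  have {1 3}-> : En v = Num.sqrt (En v) ^+ 2 by rewrite sqr_sqrtr// Energy_ge0.
  move: (Num.sqrt (En v)) (sqrtr_ge0 (En v)) => y y0 Wy /ler_normlW Dv.
  have : 0 <= (am * y / 2 - 5 * K) ^+ 2 / am.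
    by rewrite divr_ge0 ?sqr_ge0// ltW.
  have -> : (am * y / 2 - 5 * K) ^+ 2 / am =
      am / 4 * y ^+ 2 - 5 * y * K + 25 * K ^+ 2 / am.
    by field; exact: lt0r_neq0.
  lra.
exists w; split=> // v Hv.
have half : 2^-1 + 2^-1 = 1 :> R by field.
have h2 : 0 <= 2^-1 :> R by rewrite invr_ge0.
have Hz := H01_comb 2^-1 2^-1 Hv Hw.
have := wmin _ Hz.
have := WEnergy_comb am_gt0 am_le le_ap h2 h2 half (H01_finite Hv) (H01_finite Hw).
have -> : dpotential u (fun x => 2^-1 * v x + 2^-1 * w x) =
    2^-1 * dpotential u v + 2^-1 * dpotential u w.
  rewrite -!dpotentialZ// -dpotentialD//; exact: H01Z.
lra.
Qed.

Lemma resolvent_H01 u : H01 p V u -> H01 p V (resolvent u).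
Proof. by case/resolventP. Qed.

Lemma resolvent_ineq u v : H01 p V u -> H01 p V v ->
  W (resolvent u) / 2 - dpotential u (resolvent u) +
    am / 4 * En (fun x => v x - resolvent u x) <= W v / 2 - dpotential u v.
Proof. by move=> /resolventP[_]; exact. Qed.

Let self_bound (E B : R) : 0 <= E -> 0 <= B -> am / 2 * E <= 5 * Num.sqrt E * B ->
  E <= (10 / am * B) ^+ 2.
Proof.
move=> E0 B0; have {1 3}-> : E = Num.sqrt E ^+ 2 by rewrite sqr_sqrtr.
move: (Num.sqrt E) (sqrtr_ge0 E) => y y0 h.
have [->|yn0] := eqVneq y 0; first by rewrite expr0n/= sqr_ge0.
have yp : 0 < y by rewrite lt_neqAle eq_sym yn0.
have am0 := ltW am_gt0; rewrite lerXn2r ?nnegrE ?mulr_ge0 ?invr_ge0//.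
rewrite mulrAC ler_pdivlMr//.
have : y * (am * y) <= y * (10 * B) by move: h; rewrite expr2; lra.
by rewrite ler_pM2l// mulrC.
Qed.

Lemma resolvent_bound (M : R) : exists M' : R,
  forall u, H01 p V u -> En u <= M -> En (resolvent u) <= M'.
Proof.
have [K K0 KP] := normf_bound M; exists ((10 / am * K) ^+ 2) => u Hu uM.
have HT := resolvent_H01 Hu; apply: self_bound => //; first exact: Energy_ge0.
have := resolvent_ineq Hu H01_0; rewrite WEnergy0 EnergyC.
have -> : (fun x => resolvent u x - 0) = resolvent u by apply/funext => x; rewrite subr0.
have -> : dpotential u (fun=> 0) = 0.
  have := dpotentialZ 0 Hu H01_0; by rewrite !mul0r.
have := WEnergy_ge am_gt0 am_le le_ap (H01_finite HT).
have := dpotential_le Hu HT (H01_sup gasketV HT) => /ler_normlW.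
have := KP u Hu uM; have : 0 <= 5 * Num.sqrt (En (resolvent u)).
  by rewrite mulr_ge0// sqrtr_ge0.
have := mulr_ge0 (ltW am_gt0) (Energy_ge0 (p := p) (resolvent u)).
move=> h y0 /(ler_wpM2l y0); lra.
Qed.

Lemma resolvent_lipschitz u u' : H01 p V u -> H01 p V u' ->
  En (fun x => resolvent u x - resolvent u' x) <=
  (10 / am * \int[mu]_(x in V) `|f x (u x) - f x (u' x)|) ^+ 2.
Proof.
move=> Hu Hu'; have HT := resolvent_H01 Hu; have HT' := resolvent_H01 Hu'.
have HB := H01B HT HT'.
apply: self_bound; [exact: Energy_ge0|exact: Rintegral_ge0|].
have := resolvent_ineq Hu HT'; rewrite EnergyC; have := resolvent_ineq Hu' HT.
have := dpotential_bound Hu Hu' HB (H01_sup gasketV HB) => /ler_normlW.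
rewrite (dpotentialB Hu HT HT') (dpotentialB Hu' HT HT').
move: (En _) (W _) (W _) (Num.sqrt _) (Rintegral _ _ _) => E W1 W2 y I.
move: (dpotential _ _) (dpotential _ _) (dpotential _ _) (dpotential _ _) => a1 a2 a3 a4.
lra.
Qed.

Lemma resolvent_cvg us u (M : R) : (forall n, H01 p V (us n)) -> H01 p V u ->
  (forall n, En (us n) <= M) -> uconv V us u ->
  econv p (fun n => resolvent (us n)) (resolvent u).
Proof.
move=> Hus Hu uM uu e e0.
have usM n x : V x -> `|us n x| <= 5 * Num.sqrt `|M|.
  apply: (H01_sup_le gasketV _ (Hus n)); [exact: sqrtr_ge0|].
  by rewrite sqr_sqrtr// (le_trans (uM n))// ler_norm.
have := nemytskii_cvg p_equilateral gasketV f_caratheodory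
  (fun n => H01_continuous (Hus n)) uu usM.
have d0 : 0 < Num.sqrt e * am / 10 by rewrite divr_gt0// mulr_gt0// sqrtr_gt0.
move=> /cvgrPdist_lt/(_ _ d0); apply: filterS => n.
rewrite sub0r normrN => /ltW h.
rewrite (le_trans (resolvent_lipschitz (Hus n) Hu))//.
rewrite -[leRHS]sqr_sqrtr ?(ltW e0)//.
rewrite lerXn2r ?nnegrE ?sqrtr_ge0//.
  apply: mulr_ge0; last exact: Rintegral_ge0.
  by rewrite divr_ge0// ltW.
rewrite mulrAC ler_pdivrMr// mulrC -ler_pdivlMr// (le_trans (ler_norm _))//.
Qed.

Lemma resolvent_fixed_solution u : H01 p V u ->
  En (fun x => resolvent u x - u x) = 0 -> solution p V a f u.
Proof.
move=> Hu E0; have HT := resolvent_H01 Hu.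
have Tu x : V x -> resolvent u x = u x.
  move=> Vx; have := H01_sup gasketV (H01B HT Hu) Vx.
  rewrite E0 sqrtr0 mulr0 normr_le0 subr_eq0 => /eqP //.
split=> // v Hv.
have := resolvent_ineq Hu Hv.
rewrite (eq_WEnergy gasketV am_gt0 am_le le_ap Tu).
have -> : dpotential u (resolvent u) = dpotential u u.
  by apply: eq_Rintegral => x /set_mem Vx; rewrite Tu.
have [-> _ _ _] := WEnergyP am_gt0 am_le le_ap (H01_finite Hv).
have [-> _ _ _] := WEnergyP am_gt0 am_le le_ap (H01_finite Hu).
rewrite -/(dpotential u (fun x => v x - u x)) dpotentialB//.
rewrite -!EFinM -!EFinB lee_fin.
have : 0 <= am / 4 * En (fun x => v x - resolvent u x).
  by rewrite mulr_ge0 ?divr_ge0 ?Energy_ge0// ltW.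
lra.
Qed.

Lemma potential_cvg us u (M : R) : (forall n, H01 p V (us n)) ->
  (forall n, En (us n) <= M) -> uconv V us u ->
  potential (us n) @[n --> \oo] --> potential u.
Proof.
move=> Hus uM uu.
apply: (primitive_cvg p_equilateral gasketV f_caratheodory (M := 5 * Num.sqrt `|M|)) => //.
- by move=> n; exact: H01_continuous.
- move=> n; apply: (H01_sup_le gasketV _ (Hus n)); [exact: sqrtr_ge0|].
  by rewrite sqr_sqrtr// (le_trans (uM n))// ler_norm.
Qed.

Lemma action_cvg us u (M : R) : (forall n, H01 p V (us n)) -> H01 p V u ->
  (forall n, En (us n) <= M) -> econv p us u ->
  action (us n) @[n --> \oo] --> action u.
Proof.
move=> Hus Hu uM uu; apply: cvgB.
  apply: cvgMl; apply: (WEnergy_cvg am_gt0 am_le le_ap _ (H01_finite Hu) uu) => n.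
  exact: H01_finite.
exact: potential_cvg Hus uM (econv_uconv gasketV Hus Hu uu).
Qed.

Local Notation S := resolvent.

(** * Descent towards the resolvent *)

Let int_F u : H01 p V u -> mu.-integrable V (EFin \o (fun x => F x (u x))).
Proof. by case=> cu _ _; exact: (integrable_primitive p_equilateral gasketV). Qed.

Lemma potential0 : potential (fun=> 0) = 0.
Proof.
rewrite /potential; under eq_Rintegral do rewrite primitive0.
by rewrite Rintegral_cst// mul0r.
Qed.

Lemma action0 : action (fun=> 0) = 0.
Proof.
by rewrite /action potential0 WEnergy0 mul0r subr0.
Qed.

Lemma potential_bound (M : R) : exists K : R,
  forall u, H01 p V u -> En u <= M -> `|potential u| <= K.
Proof.
pose m := 5 * Num.sqrt `|M| + 1.
have m0 : 0 < m by rewrite ltr_wpDl// mulr_ge0// sqrtr_ge0.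
have [_ cf /(_ m m0)[fM [ifM fM0 fP]]] := f_caratheodory.
exists (\int[mu]_(x in V) (m * fM x)) => u Hu uM.
rewrite (le_trans (le_normr_Rintegral mV (int_F Hu)))//.
apply: (ae_le_Rintegral mV muC).
- by have := integrable_norm (int_F Hu); congr integrable.
- by have := integrableZl mV m ifM; congr integrable.
- apply: (ae_imply2 cf fP) => x cx fx Vx; apply: primitive_bound.
  + exact: cx.
  + by move=> s sm; exact: fx.
  + have : `|u x| <= 5 * Num.sqrt `|M|.
      apply: (H01_sup_le gasketV _ Hu) => //.
      by rewrite sqr_sqrtr// (le_trans uM)// ler_norm.
    by move=> h; rewrite /m (le_trans h)// lerDl.
Qed.

(** The defect in the first order expansion of [potential] at [u] in the direction
[S u - u], as a difference quotient. *)
Let defect u (s : R) : R := \int[mu]_(x in V)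
  ((F x (u x + s * (S u x - u x)) - F x (u x)) / s - f x (u x) * (S u x - u x)).

Let defectE u s : H01 p V u -> 0 < s -> s * defect u s =
  potential (fun x => u x + s * (S u x - u x)) - potential u -
  s * dpotential u (fun x => S u x - u x).
Proof.
move=> Hu s0; have Hh := H01B (resolvent_H01 Hu) Hu.
have Hs := H01D Hu (H01Z s Hh).
have i1 := int_F Hs; have i2 := int_F Hu.
have i3 : mu.-integrable V (EFin \o (fun x => f x (u x) * (S u x - u x))).
  exact: (integrable_nemytskii p_equilateral gasketV f_caratheodory
    (H01_continuous Hu) (H01_continuous Hh)).
have i12 : mu.-integrable V
    (EFin \o (fun x => F x (u x + s * (S u x - u x)) - F x (u x))).
  by have := integrableB mV i1 i2; congr integrable.
have i12s : mu.-integrable V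
    (EFin \o (fun x => (F x (u x + s * (S u x - u x)) - F x (u x)) / s)).
  by have := integrableZr mV s^-1 i12; congr integrable.
rewrite /defect RintegralB; [|exact: mV|exact: i12s|exact: i3].
rewrite RintegralZr; [|exact: mV|exact: i12].
rewrite RintegralB; [|exact: mV|exact: i1|exact: i2].
by rewrite -/(potential _) -/(potential _) mulrBr mulrC divfK// lt0r_neq0.
Qed.

Let action_step u s : H01 p V u -> 0 < s <= 1 ->
  action (fun x => u x + s * (S u x - u x)) <= action u -
  s * (am / 4 * En (fun x => S u x - u x) + defect u s).
Proof.
move=> Hu /andP[s0 s1]; have HS := resolvent_H01 Hu.
have := defectE Hu s0; have := resolvent_ineq Hu Hu; rewrite EnergyC.
rewrite (dpotentialB Hu HS Hu).
have s1' : 0 <= 1 - s by rewrite subr_ge0.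
have := WEnergy_comb am_gt0 am_le le_ap s1' (ltW s0) (subrK _ _)
  (H01_finite Hu) (H01_finite HS).
have -> : (fun x => (1 - s) * u x + s * S u x) = (fun x => u x + s * (S u x - u x)).
  by apply/funext => x; ring.
have : 0 <= (1 - s) * s * am * En (fun x => u x - S u x).
  by rewrite !mulr_ge0 ?Energy_ge0// ltW.
rewrite /action; move: (WEnergy _ _ _) (WEnergy _ _ _) (WEnergy _ _ _) => w1 w2 w3.
move: (En _) (En _) (dpotential _ _) (dpotential _ _) => e1 e2 d1 d2.
move: (potential _) (potential _) (defect _ _) => q1 q2 r h1 h2 h3 h4.
have := ler_wpM2l (ltW s0) h3; lra.
Qed.

(** Moving from [u] towards [S u] decreases the action at a rate proportional to
[En (S u - u)], with a step size that is uniform on energy balls: otherwise a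
compactness argument would contradict the convergence of difference quotients. *)
Lemma action_descent (M d : R) : 0 < d -> exists s0 : R, 0 < s0 <= 1 /\
  forall u, H01 p V u -> En u <= M -> d <= En (fun x => S u x - u x) ->
  forall s, 0 < s <= s0 -> action (fun x => u x + s * (S u x - u x)) <=
    action u - s * (am / 8 * En (fun x => S u x - u x)).
Proof.
move=> d0; apply: contrapT => no.
have ex n : exists us : fct * R, [/\ H01 p V us.1, En us.1 <= M,
    d <= En (fun x => S us.1 x - us.1 x), 0 < us.2 <= n.+1%:R^-1
  & defect us.1 us.2 <= - (am / 8 * d)].
  apply: contrapT => no'; apply: no; exists (n.+1%:R^-1); split.
    by rewrite invr_gt0 ltr0n/= invf_le1 ?ler1n ?ltr0n.
  move=> u Hu uM ud s sn; rewrite leNgt; apply/negP => bad; apply: no'.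
  exists (u, s); split => //=.
  have /andP[s0 s1] := sn.
  have s01 : 0 < s <= 1.
    by rewrite s0 (le_trans s1)// invf_le1 ?ler1n ?ltr0n.
  have := lt_le_trans bad (action_step Hu s01).
  rewrite ltrD2l ltrN2 ltr_pM2l// => h.
  have : am / 8 * d <= am / 8 * En (fun x => S u x - u x).
    by rewrite ler_wpM2l// divr_ge0// ltW.
  move=> h'; apply: ltW; apply: (lt_le_trans (y := - (am / 8 * En (fun x => S u x - u x)))).
    have e48 (y : R) : am / 4 * y = am / 8 * y + am / 8 * y by field.
    by move: h; rewrite e48 -addrA gtrDl -ltrBrDl sub0r.
  by rewrite lerN2.
have [us_ usP] := choice ex.
pose us n := (us_ n).1; pose s n := (us_ n).2.
have Hus n : H01 p V (us n) by have [] := usP n.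
have usM n : En (us n) <= M by have [] := usP n.
have [M' M'P] := resolvent_bound M.
pose hs n : fct := fun x => S (us n) x - us n x.
have Hhs n : H01 p V (hs n) by exact: H01B (resolvent_H01 (Hus n)) (Hus n).
have hsM n : En (hs n) <= 2 * M' + 2 * M.
  have := EnergyB_le (H01_finite (resolvent_H01 (Hus n))) (H01_finite (Hus n)).
  have := M'P _ (Hus n) (usM n); have := usM n; rewrite -/(hs n).
  move: (En _) (En _) (En _) => *; lra.
have [k1 [u [k1n Hu uu]]] := H01_compact gasketV Hus usM.
have [k2 [h [k2n Hh hh]]] :=
  H01_compact gasketV (fun n => Hhs (k1 n)) (fun n => hsM (k1 n)).
pose k n := k1 (k2 n).
have uu2 : uconv V (us \o k) u by exact: (uconv_sub k2n uu).
have kn n : (n <= k n)%N by rewrite (leq_trans (k2n n)).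
pose B := Num.max `|M| `|2 * M' + 2 * M|.
have sup v : H01 p V v -> En v <= B -> forall x, V x -> `|v x| <= 5 * Num.sqrt B.
  move=> Hv vB x Vx; apply: (H01_sup_le gasketV _ Hv) => //.
  by rewrite sqr_sqrtr// le_max normr_ge0.
have sk0 : s (k n) @[n --> \oo] --> 0.
  apply: (@squeeze_cvgr _ _ _ _ (fun=> 0) (fun n => n.+1%:R^-1)).
  - apply: nearW => n; have [_ _ _ /andP[s0 s1] _] := usP (k n).
    rewrite (ltW s0)/= (le_trans s1)// lef_pV2 ?posrE ?ltr0n//.
    by rewrite ler_nat ltnS.
  - exact: cvg_cst.
  - exact: cvg_harmonic.
have := primitive_quotient_cvg p_equilateral gasketV f_caratheodory
  (us := us \o k) (u := u) (hs := hs \o k) (h := h) (s := s \o k)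
  (M := 5 * Num.sqrt B).
have skn n : 0 < s (k n) <= 1.
  have [_ _ _ /andP[s0 s1] _] := usP (k n).
  by rewrite s0 (le_trans s1)// invf_le1 ?ler1n ?ltr0n.
move=> /(_ (fun n => H01_continuous (Hus (k n))) uu2).
move=> /(_ (fun n => H01_continuous (Hhs (k n))) hh).
move=> cvgd.
have {cvgd} : defect (us (k n)) (s (k n)) @[n --> \oo] --> 0.
  apply: cvgd.
  - move=> n; apply: sup; first exact: Hus.
    by rewrite le_max (le_trans (usM _))// ler_norm.
  - move=> n; apply: sup; first exact: Hhs.
    by rewrite le_max (le_trans (hsM _) (ler_norm _)) orbT.
  - exact: skn.
  - exact: sk0.
have e0 : 0 < am / 8 * d by rewrite mulr_gt0// divr_gt0.
move=> /cvgrPdist_lt/(_ _ e0)[N _ /(_ N (leqnn _))].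
rewrite /= sub0r normrN ltr_norml => /andP[+ _].
by have [_ _ _ _] := usP (k N); rewrite leNgt => /negP.
Qed.

Lemma econv_step us u hs h (c : nat -> R) (c0 : R) :
  (forall n, finite_energy p (us n)) -> finite_energy p u ->
  (forall n, finite_energy p (hs n)) -> finite_energy p h ->
  econv p us u -> econv p hs h -> (forall n, `|c n| <= 1) ->
  c n @[n --> \oo] --> c0 ->
  econv p (fun n x => us n x + c n * hs n x) (fun x => u x + c0 * h x).
Proof.
move=> fus fu fhs fh uu hh c1 cc e e0.
have : ((c n - c0) ^+ 2 * En h) @[n --> \oo] --> 0.
  rewrite -(mul0r (En h)); apply: cvgMl.
  rewrite (_ : (fun n => _) = (fun n => (c n - c0) * (c n - c0))).
    by rewrite -(mulr0 0); apply: cvgM; rewrite -(subrr c0); apply: cvgB => //; exact: cvg_cst.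
  by apply/funext => n; rewrite expr2.
have e12 : 0 < e / 12 by rewrite divr_gt0.
move=> /cvgrPdist_lt/(_ _ e12) cn; near=> n.
have f1 := finite_energyB (fus n) fu; have f2 := finite_energyB (fhs n) fh.
have -> : (fun x => us n x + c n * hs n x - (u x + c0 * h x)) = (fun x =>
    (us n x - u x) + (c n * (hs n x - h x) + (c n - c0) * h x)).
  by apply/funext => x; ring.
have f3 := finite_energyZ (c n) f2; have f4 := finite_energyZ (c n - c0) fh.
apply: le_trans (EnergyD_le f1 (finite_energyD f3 f4)) _.
have := EnergyD_le f3 f4; rewrite EnergyZ// (EnergyZ (c n - c0) fh).
have h1 : En (fun x => us n x - u x) <= e / 12 by near: n; exact: uu.
have h2 : En (fun x => hs n x - h x) <= e / 12 by near: n; exact: hh.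
have h3 : `|0 - (c n - c0) ^+ 2 * En h| < e / 12 by near: n.
have h4 : c n ^+ 2 * En (fun x => hs n x - h x) <= En (fun x => hs n x - h x).
  rewrite ler_piMl ?Energy_ge0// -real_normK ?num_real// expr_le1//.
move: h3; rewrite sub0r normrN => /ltW/ler_normlW h3.
move: (e : R) (En _) (En _) (En _) e0 h1 h2 h3 h4 => e' E1 E2 E3 *.
lra.
Unshelve. all: by end_near. Qed.

Lemma econvB us u hs h :
  (forall n, finite_energy p (us n)) -> finite_energy p u ->
  (forall n, finite_energy p (hs n)) -> finite_energy p h ->
  econv p us u -> econv p hs h ->
  econv p (fun n x => us n x - hs n x) (fun x => u x - h x).
Proof.
move=> fus fu fhs fh uu hh e e0; have e4 : 0 < e / 4 by rewrite divr_gt0.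
have := uu _ e4; have := hh _ e4; apply: filterS2 => n h1 h2.
have -> : (fun x => us n x - hs n x - (u x - h x)) =
    (fun x => (us n x - u x) - (hs n x - h x)) by apply/funext => x; ring.
apply: le_trans (EnergyB_le (finite_energyB (fus n) fu) (finite_energyB (fhs n) fh)) _.
move: (e : R) (En _) (En _) h1 h2 => e' E1 E2; lra.
Qed.

Lemma sqrt_Energy_cvg us u : (forall n, finite_energy p (us n)) -> finite_energy p u ->
  econv p us u -> Num.sqrt (En (us n)) @[n --> \oo] --> Num.sqrt (En u).
Proof.
move=> fus fu uu; apply/cvgrPdist_le => e e0.
have := uu _ (exprn_gt0 2 e0); apply: filterS => n h.
have h' : Num.sqrt (En (fun x => us n x - u x)) <= e.
  by rewrite (le_trans (ler_wsqrtr h))// sqrtr_sqr gtr0_norm.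
have := sqrt_Energy_triangle (finite_energyB (fus n) fu) fu.
have := sqrt_Energy_triangle (finite_energyB fu (fus n)) (fus n).
have -> : (fun x => u x - us n x + us n x) = u by apply/funext => x; rewrite subrK.
have -> : (fun x => us n x - u x + u x) = us n by apply/funext => x; rewrite subrK.
rewrite (EnergyC u).
rewrite ler_norml; move: (Num.sqrt _) (Num.sqrt _) (Num.sqrt _) h' => x y z *; lra.
Qed.

Lemma econv_cst u : econv p (fun=> u) u.
Proof.
move=> e e0; apply: nearW => _; under eq_fun do rewrite subrr.
by rewrite Energy0 ltW.
Qed.

(** * The mountain pass *)

Let clamp (x : R) := Num.max 0 (Num.min 1 x).

Let clamp_itv x : 0 <= clamp x <= 1.
Proof. by rewrite /clamp le_max lexx/= ge_max ler01 ge_min lexx. Qed.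

Let clamp_le0 x : x <= 0 -> clamp x = 0.
Proof. by move=> x0; apply/max_idPl; rewrite ge_min x0 orbT. Qed.

Let clamp_ge1 x : 1 <= x -> clamp x = 1.
Proof. by move=> x1; rewrite /clamp (min_idPl x1); apply/max_idPr. Qed.

Let clamp_gt0 x : 0 < x -> 0 < clamp x.
Proof. by move=> x0; rewrite lt_max lt_min ltr01 x0 orbT. Qed.

Let clamp_continuous : continuous clamp.
Proof.
apply: max_fun_continuous; first exact: cst_continuous.
by apply: min_fun_continuous; [exact: cst_continuous|move=> x; exact: cvg_id].
Qed.

Section deformation.
Variables (b s0 : R).
Hypotheses (b0 : 0 < b) (s00 : 0 < s0) (s01 : s0 <= 1).

(** A step towards [S u], damped so as to leave the functions of action at most
[b / 2] fixed. *)
Let step u : R := s0 * clamp (2 * action u / b - 1).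
Definition deform u : fct := fun x => u x + step u * (S u x - u x).

Let step_itv u : 0 <= step u <= s0.
Proof.
have /andP[c0 c1] := clamp_itv (2 * action u / b - 1).
by rewrite /step mulr_ge0 ?(ltW s00)//= ler_piMr// ltW.
Qed.

Let step_norm u : `|step u| <= 1.
Proof. by have /andP[c0 c1] := step_itv u; rewrite ger0_norm// (le_trans c1). Qed.

Let deform_H01 u : H01 p V u -> H01 p V (deform u).
Proof. by move=> Hu; apply/H01D/H01Z/H01B => //; exact: resolvent_H01. Qed.

Lemma deform_id u : action u <= b / 2 -> deform u = u.
Proof.
move=> ub; apply/funext => x; rewrite /deform /step clamp_le0 ?mulr0 ?mul0r ?addr0//.
by rewrite subr_le0 ler_pdivrMr// mul1r; lra.
Qed.

Let deform_bound (M : R) : exists M' : R,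
  forall u, H01 p V u -> En u <= M -> En (deform u) <= M'.
Proof.
have [M' M'P] := resolvent_bound M; exists (2 * M + 2 * (2 * M' + 2 * M)) => u Hu uM.
have fh := H01_finite (H01B (resolvent_H01 Hu) Hu).
apply: le_trans (EnergyD_le (H01_finite Hu) (finite_energyZ _ fh)) _.
rewrite EnergyZ//; have := EnergyB_le (H01_finite (resolvent_H01 Hu)) (H01_finite Hu).
have := M'P _ Hu uM; have : step u ^+ 2 <= 1.
  by rewrite -real_normK ?num_real// expr_le1.
have := Energy_ge0 (p := p) (fun x => S u x - u x); move: uM.
move: (En _) (En _) (En _) (step u ^+ 2) => E1 E2 E3 c h1 h2 h3 h4 h5.
have : c * E2 <= E2 by rewrite ler_piMl.
lra.
Qed.

Let deform_econv us u (M : R) : (forall n, H01 p V (us n)) -> H01 p V u ->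
  (forall n, En (us n) <= M) -> econv p us u ->
  econv p (fun n => deform (us n)) (deform u).
Proof.
move=> Hus Hu uM uu; apply: econv_step => //.
- by move=> n; exact: H01_finite (Hus n).
- exact: H01_finite Hu.
- by move=> n; exact: H01_finite (H01B (resolvent_H01 (Hus n)) (Hus n)).
- exact: H01_finite (H01B (resolvent_H01 Hu) Hu).
- have SS := resolvent_cvg Hus Hu uM (econv_uconv gasketV Hus Hu uu).
  apply: econvB SS uu.
  + by move=> n; exact: H01_finite (resolvent_H01 (Hus n)).
  + exact: H01_finite (resolvent_H01 Hu).
  + by move=> n; exact: H01_finite (Hus n).
  + exact: H01_finite Hu.
- apply: cvgMr; apply: continuous_cvg; first exact: clamp_continuous.
  apply: cvgB; last exact: cvg_cst.
  by apply: cvgMl; apply: cvgMr; exact: action_cvg Hus Hu uM uu.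
Qed.

Variable e0 : fct.
Hypothesis He0 : H01 p V e0.

Definition deform_path k (t : R) : fct := iter k deform (fun x => t * e0 x).

Lemma deform_path_H01 k t : H01 p V (deform_path k t).
Proof.
by elim: k => [|k IH]; [exact: H01Z|rewrite /deform_path iterS; exact: deform_H01].
Qed.

Let deform_path_bound k : exists M : R,
  forall t, 0 <= t <= 1 -> En (deform_path k t) <= M.
Proof.
elim: k => [|k [M MP]].
  exists (En e0) => t /andP[t0 t1]; rewrite /deform_path/= EnergyZ; last exact: H01_finite He0.
  by rewrite ler_piMl ?Energy_ge0// expr_le1.
have [M' M'P] := deform_bound M; exists M' => t t01.
by rewrite /deform_path iterS; apply: M'P; [exact: deform_path_H01|exact: MP].
Qed.

Let deform_path_econv k (ts : nat -> R) (t : R) : (forall n, 0 <= ts n <= 1) -> 0 <= t <= 1 ->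
  ts n @[n --> \oo] --> t ->
  econv p (fun n => deform_path k (ts n)) (deform_path k t).
Proof.
move=> ts01 t01 tst; elim: k => [|k IH].
  have fe := H01_finite He0; have f0 := H01_finite H01_0.
  have E0 s : (fun x => s * e0 x) = (fun x => 0 + s * e0 x).
    by apply/funext => x; rewrite add0r.
  rewrite /deform_path/= (_ : (fun n x => ts n * e0 x) = (fun n x => 0 + ts n * e0 x)).
    rewrite E0; apply: econv_step => //; [exact: econv_cst|exact: econv_cst|].
    by move=> n; have /andP[? ?] := ts01 n; rewrite ger0_norm.
  by apply/funext => n; exact: E0.
have [M MP] := deform_path_bound k.
rewrite /deform_path; under eq_fun do rewrite iterS; rewrite iterS.
by apply: (@deform_econv _ _ M) => // [n||n]; [exact: deform_path_H01|exact: deform_path_H01|exact: MP].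
Qed.

(** The deformed paths still join [0] to [e0], so they cross every sphere that
separates these points. *)
Lemma deform_path_crossing k (r : R) : action e0 <= 0 -> 0 < r -> r ^+ 2 < En e0 ->
  exists2 t, 0 <= t <= 1 & En (deform_path k t) = r ^+ 2.
Proof.
move=> ae0 r0 re0.
pose g (t : R) : R := Num.sqrt (En (deform_path k (clamp t))).
have cg : continuous g.
  move=> t; apply/(@cvg_nbhsP _ R^o) => ts tst; apply: sqrt_Energy_cvg.
  - by move=> n; exact: H01_finite (deform_path_H01 _ _).
  - exact: H01_finite (deform_path_H01 _ _).
  - apply: deform_path_econv => //; apply: continuous_cvg => //.
    exact: clamp_continuous.
have b2 : 0 <= b / 2 by rewrite divr_ge0// ltW.
have g0 : g 0 = 0.
  rewrite /g clamp_le0// /deform_path iter_fix; last first.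
    by apply: deform_id; under eq_fun do rewrite mul0r; rewrite action0.
  by under eq_fun do rewrite mul0r; rewrite Energy0 sqrtr0.
have g1 : r < g 1.
  rewrite /g clamp_ge1// /deform_path iter_fix; last first.
    by apply: deform_id; under eq_fun do rewrite mul1r; exact: le_trans ae0 b2.
  under eq_fun do rewrite mul1r.
  by rewrite -[r]gtr0_norm// -sqrtr_sqr ltr_sqrt// (le_lt_trans (sqr_ge0 r)).
have [t _ gt] : exists2 t, t \in `[0, 1]%R & g t = r.
  apply: IVT; [exact: ler01|exact: continuous_subspaceT|].
  by rewrite g0 ge_min (ltW r0)/= le_max (ltW g1) orbT.
exists (clamp t); first exact: clamp_itv.
by rewrite -gt sqr_sqrtr// Energy_ge0.
Qed.

End deformation.

(** If the gradient stayed away from zero on the functions of action between [b / 2] and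
[M1], then finitely many deformation steps would push the whole path from [0] to
[e0] below the level [b]; but the deformed path still crosses the sphere on which
the action is at least [b]. The combination [Num.sqrt (En u) + kappa * action u]
does not increase along the deformation, which keeps the relevant functions in one
energy ball and thus makes the step size uniform. *)
Lemma palais_smale_sequence (r b : R) e0 : 0 < r -> 0 < b -> H01 p V e0 ->
  action e0 <= 0 -> r ^+ 2 < En e0 ->
  (forall u, H01 p V u -> En u = r ^+ 2 -> b <= action u) ->
  exists M1 : R, forall d, 0 < d -> exists u,
    [/\ H01 p V u, b / 2 <= action u <= M1 & En (fun x => S u x - u x) <= d].
Proof.
move=> r0 b0 He0 ae0 re0 sphere.
have [K KP] := potential_bound (En e0).
pose M1 := ap * En e0 / 2 + K; exists M1 => d d0; apply: contrapT => no.
have big u : H01 p V u -> b / 2 <= action u -> action u <= M1 ->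
    d <= En (fun x => S u x - u x).
  move=> Hu bu uM; rewrite leNgt; apply/negP => ud; apply: no; exists u.
  by split; [exact: Hu|rewrite bu uM|exact: ltW].
pose sd := Num.sqrt d; have sd0 : 0 < sd by rewrite sqrtr_gt0.
(* A step of size [t] adds at most [t * y] to [Num.sqrt (En u)], where [y >= sd] is the
   norm of [S u - u], and takes at least [t * (am / 8) * y ^+ 2] from the action. *)
pose kappa := 8 / (am * sd); pose rho := Num.sqrt (En e0) + kappa * M1.
have le_or_gt (x y : R) : x <= y \/ y < x by case: leP; [left|right].
have kappa0 : 0 < kappa by rewrite divr_gt0// mulr_gt0.
have [s0 [/andP[s00 s01] s0P]] := action_descent (rho ^+ 2) d0.
pose c := s0 * (am / 8 * d).
have c0 : 0 < c by rewrite mulr_gt0// mulr_gt0// divr_gt0.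
pose D := deform b s0.
have stepP u : H01 p V u -> action u <= M1 ->
    Num.sqrt (En u) + kappa * action u <= rho ->
  [/\ action (D u) <= action u,
    Num.sqrt (En (D u)) + kappa * action (D u) <= rho
  & b <= action u -> action (D u) <= action u - c].
  move=> Hu uM urho; have [ub|ub] := le_or_gt (action u) (b / 2).
    rewrite /D (deform_id s0 b0 ub); split; [exact: lexx|exact: urho|move=> bu].
    by exfalso; move: (le_trans bu ub); rewrite leNgt ltr_pdivrMr// ltr_pMr// ltr1n.
  have Hh := H01B (resolvent_H01 Hu) Hu; have hd := big u Hu (ltW ub) uM.
  have au0 : 0 < action u by rewrite (lt_trans _ ub)// divr_gt0.
  have uE : En u <= rho ^+ 2.
    have ur : Num.sqrt (En u) <= rho.
      by rewrite (le_trans _ urho)// lerDl mulr_ge0// ltW.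
    rewrite -[leLHS]sqr_sqrtr ?Energy_ge0// lerXn2r ?nnegrE ?sqrtr_ge0//.
    exact: le_trans ur.
  pose t := s0 * clamp (2 * action u / b - 1).
  have cl0 : 0 < clamp (2 * action u / b - 1).
    by apply: clamp_gt0; rewrite subr_gt0 ltr_pdivlMr// mul1r mulrC -ltr_pdivrMr.
  have /andP[_ cl1] := clamp_itv (2 * action u / b - 1).
  have t0 : 0 < t by rewrite mulr_gt0.
  have ts0 : t <= s0 by rewrite ler_piMr// ltW.
  have := s0P u Hu uE hd t; rewrite t0 ts0 => /(_ isT).
  have DE : D u = (fun x => u x + t * (S u x - u x)) by [].
  rewrite -DE; pose y := Num.sqrt (En (fun x => S u x - u x)).
  have yE : En (fun x => S u x - u x) = y ^+ 2 by rewrite sqr_sqrtr ?Energy_ge0.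
  have y0 : 0 <= y by rewrite sqrtr_ge0.
  have sdy : sd <= y by rewrite ler_wsqrtr.
  have Dy : Num.sqrt (En (D u)) <= Num.sqrt (En u) + t * y.
    have fh := H01_finite Hh.
    have := sqrt_Energy_triangle (H01_finite Hu) (finite_energyZ t fh).
    by rewrite -DE EnergyZ// sqrtrM ?sqr_ge0// sqrtr_sqr gtr0_norm.
  rewrite yE => aD; split.
  - apply: (le_trans aD); rewrite gerBl mulr_ge0 ?(ltW t0)// mulr_ge0 ?sqr_ge0//.
    by rewrite divr_ge0// ltW.
  - apply: le_trans urho; have := ler_wpM2l (ltW kappa0) aD.
    have kE : kappa * (t * (am / 8 * y ^+ 2)) = t * y * (y / sd).
      by rewrite /kappa; field; rewrite !lt0r_neq0.
    rewrite (mulrBr kappa (action u)) kE => h.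
    apply: (le_trans (lerD Dy h)); rewrite addrACA gerDl subr_le0.
    apply: ler_peMr; last by rewrite ler_pdivlMr// mul1r.
    by apply: mulr_ge0 y0; exact: ltW.
  - move=> bu; have tE : t = s0.
      rewrite /t clamp_ge1 ?mulr1// lerBrDr ler_pdivlMr//.
      by have -> : 1 + 1 = 2 :> R by []; rewrite ler_pM2l.
    apply: (le_trans aD); rewrite lerD2l lerN2 tE /c ler_wpM2l ?(ltW s00)//.
    by rewrite ler_wpM2l ?divr_ge0 ?(ltW am_gt0)// -yE.
have pathP k t : 0 <= t <= 1 -> let u := deform_path b s0 e0 k t in
  [/\ H01 p V u, action u <= M1, Num.sqrt (En u) + kappa * action u <= rho
    & action u < b \/ action u <= M1 - k%:R * c].
  move=> /andP[t0 t1]; elim: k => [|k [Hu uM urho ub]] u; rewrite /u {u}.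
    have Ht := H01Z t He0.
    have Et : En (fun x => t * e0 x) <= En e0.
      rewrite EnergyZ; last exact: H01_finite He0.
      by rewrite ler_piMl ?Energy_ge0// expr_le1.
    have tM : action (fun x => t * e0 x) <= M1.
      have /ler_normlP[h _] := KP _ Ht Et; apply: lerD h.
      rewrite ler_pM2r ?invr_gt0//.
      apply: (le_trans (WEnergy_le am_gt0 am_le le_ap (H01_finite Ht))).
      by rewrite ler_wpM2l.
    rewrite /deform_path/= mul0r subr0; split=> //; last by right.
    by rewrite /rho lerD ?ler_wsqrtr// ler_wpM2l// ltW.
  have [aD rD bD] := stepP _ Hu uM urho.
  have HD : H01 p V (deform_path b s0 e0 k.+1 t) by exact: deform_path_H01.
  rewrite /deform_path iterS -/(deform_path b s0 e0 k t) -/D; split.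
  - exact: HD.
  - exact: le_trans aD uM.
  - exact: rD.
  - have [bu|bu] := le_or_gt b (action (deform_path b s0 e0 k t)).
      right; case: ub => [|ub]; first by rewrite ltNge bu.
      apply: (le_trans (bD bu)); rewrite -natr1 mulrDl mul1r opprD addrA lerD2r//.
    by left; exact: le_lt_trans aD bu.
pose k := Num.bound `|(M1 - b) / c|.
have kb : M1 - k%:R * c < b.
  rewrite ltrBlDr -ltrBlDl -ltr_pdivrMr//.
  exact: le_lt_trans (ler_norm _) (archi_boundP (normr_ge0 _)).
have [t t01 tr] := deform_path_crossing b0 s00 s01 He0 k ae0 r0 re0.
have [Hu _ _ ub] := pathP k t t01.
have := sphere _ Hu tr; case: ub => [|/le_lt_trans/(_ kb)]; rewrite ltNge => /negP //.
Qed.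

(** * Superquadratic growth *)

Let W_ge0 u : H01 p V u -> 0 <= W u.
Proof. by move=> Hu; exact: (WEnergy_ge0 am_gt0 am_le le_ap (H01_finite Hu)). Qed.

(** A Cauchy-Schwarz inequality: [S u] represents the linear form [dpotential u] with
respect to the energy. *)
Lemma dpotential_self_le u : H01 p V u ->
  dpotential u u <= Num.sqrt (W (S u)) * Num.sqrt (W u).
Proof.
move=> Hu; have HS := resolvent_H01 Hu; pose y := Num.sqrt (W u); pose z := Num.sqrt (W (S u)).
have yE : y ^+ 2 = W u by rewrite sqr_sqrtr// W_ge0.
have zE : z ^+ 2 = W (S u) by rewrite sqr_sqrtr// W_ge0.
have y0 : 0 <= y by rewrite sqrtr_ge0.
have z0 : 0 <= z by rewrite sqrtr_ge0.
have key (t : R) : 0 < t -> dpotential u u <= z * y + t * (y ^+ 2 / 2).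
  move=> t0; have Ht := H01Z t Hu; have Hv := H01D HS Ht.
  have := resolvent_ineq Hu Hv.
  rewrite (dpotentialD Hu HS Ht).
  rewrite (dpotentialZ t Hu Hu).
  have : 0 <= am / 4 * En (fun x => S u x + t * u x - S u x).
    by rewrite mulr_ge0 ?Energy_ge0// divr_ge0// ltW.
  have : W (fun x => S u x + t * u x) <= (z + t * y) ^+ 2.
    have := sqrt_WEnergy_triangle am_gt0 am_le le_ap (H01_finite HS)
      (finite_energyZ t (H01_finite Hu)).
    rewrite (WEnergyZ am_gt0 am_le le_ap t (H01_finite Hu)).
    rewrite sqrtrM ?sqr_ge0// sqrtr_sqr gtr0_norm// -/y -/z => h.
    rewrite -(sqr_sqrtr (W_ge0 Hv)) lerXn2r ?nnegrE ?sqrtr_ge0//.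
    by rewrite addr_ge0// mulr_ge0// ltW.
  rewrite -zE; move: (W _) (En _) (dpotential _ _) (dpotential _ _) => w e d1 d2 h1 h2 h3.
  rewrite -(ler_pM2l t0); move: h1 h2 h3; rewrite !expr2; lra.
apply/ler_addgt0Pr => e e0; have e1 : 0 < e / (y ^+ 2 / 2 + 1).
  by rewrite divr_gt0// ltr_wpDl// divr_ge0// sqr_ge0.
apply: (le_trans (key _ e1)); rewrite lerD2l mulrAC ler_pdivrMr.
  by rewrite ler_wpM2l ?(ltW e0)// lerDl.
by rewrite ltr_wpDl// divr_ge0// sqr_ge0.
Qed.

Section superquadratic.
Variables theta M0 : R.
Hypotheses (theta2 : 2 < theta) (M00 : 0 < M0).
Hypothesis superquadratic : {ae mu, forall x, V x -> forall t : R,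
  t <= - M0 \/ M0 <= t -> 0 < theta * F x t <= t * f x t}.

Let theta0 : 0 < theta. Proof. by rewrite (lt_trans _ theta2). Qed.

Lemma superquadratic_potential : exists2 C : R, 0 <= C &
  forall u, H01 p V u -> theta * potential u <= dpotential u u + C.
Proof.
have [_ cf /(_ M0 M00)[fM [ifM fM0 fP]]] := f_caratheodory.
pose c := (theta + 1) * M0.
have c0 : 0 <= c by rewrite mulr_ge0 ?addr_ge0// ltW.
exists (\int[mu]_(x in V) (c * fM x)) => [|u Hu].
  by apply: Rintegral_ge0 => x Vx; rewrite mulr_ge0// fM0.
have cu := H01_continuous Hu.
have i1 := integrable_nemytskii p_equilateral gasketV f_caratheodory cu cu.
have i2 : mu.-integrable V (EFin \o (fun x => c * fM x)).
  by have := integrableZl mV c ifM; congr integrable.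
rewrite /potential /dpotential -RintegralZl; [|exact: mV|exact: int_F].
rewrite -RintegralD; [|exact: mV|exact: i1|exact: i2].
apply: (ae_le_Rintegral mV muC).
- by have := integrableZl mV theta (int_F Hu); congr integrable.
- by have := integrableD mV i1 i2; congr integrable.
- apply: (ae_imply2 cf (ae_imply2 superquadratic fP (fun x => @conj _ _))).
  move=> x cfx [sx fx] Vx; move: (u x) => t; have fM0x := fM0 x Vx.
  have cM : 0 <= c * fM x by rewrite mulr_ge0.
  have le_or_gt (y z : R) : y <= z \/ z < y by case: leP; [left|right].
  have [tM|Mt] := le_or_gt `|t| M0.
    have FM := primitive_bound (cfx Vx) (fx Vx) tM.
    have fMt : `|f x t * t| <= M0 * fM x.
      by rewrite normrM mulrC ler_pM// fx.
    have : theta * F x t <= theta * (M0 * fM x).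
      by rewrite ler_wpM2l ?(ltW theta0)// (le_trans (ler_norm _)).
    move: fMt => /ler_normlP[fMt _] h; rewrite /c mulrDl mul1r mulrDl -mulrA.
    apply: (le_trans h); rewrite addrCA lerDl.
    by rewrite -(opprK (f x t * t)) addrC subr_ge0.
  have st : t <= - M0 \/ M0 <= t.
    have /orP[h|h] : (t < - M0) || (M0 < t) by rewrite -ltrNr orbC -lter_normr.
      by left; exact: ltW.
    by right; exact: ltW.
  have /andP[_ h] := sx Vx t st; rewrite mulrC.
  by rewrite (mulrC (f x t)) ler_wpDr// mulrC.
Qed.

(** The Ambrosetti-Rabinowitz condition bounds the energy of an approximate critical
point by its level. *)
Lemma palais_smale_bounded (M1 : R) : exists M : R, forall u, H01 p V u ->
  action u <= M1 -> En (fun x => S u x - u x) <= 1 -> En u <= M.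
Proof.
have [C C0 CP] := superquadratic_potential.
pose sa := Num.sqrt ap; have sa0 : 0 <= sa by rewrite sqrtr_ge0.
have k0 : 0 < theta / 2 - 1 by rewrite subr_gt0 ltr_pdivlMr// mul1r.
have B0 : 0 <= theta * `|M1| + C by rewrite addr_ge0// mulr_ge0// ltW.
pose Y := 1 + (sa + (theta * `|M1| + C)) / (theta / 2 - 1).
have Y0 : 0 <= Y.
  by apply: addr_ge0 => //; apply: divr_ge0; [exact: addr_ge0|exact: ltW].
exists (Y ^+ 2 / am) => u Hu uM uS; have HS := resolvent_H01 Hu; have Hh := H01B HS Hu.
rewrite ler_pdivlMr// mulrC (le_trans (WEnergy_ge am_gt0 am_le le_ap (H01_finite Hu)))//.
rewrite -(sqr_sqrtr (W_ge0 Hu)) lerXn2r ?nnegrE ?sqrtr_ge0//.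
have y0 := sqrtr_ge0 (W u).
apply: quadratic_bound => //.
have zy : Num.sqrt (W (S u)) <= sa + Num.sqrt (W u).
  have := sqrt_WEnergy_triangle am_gt0 am_le le_ap (H01_finite Hh) (H01_finite Hu).
  have -> : (fun x => S u x - u x + u x) = S u by apply/funext => x; rewrite subrK.
  move=> h; apply: (le_trans h); rewrite lerD2r ler_wsqrtr//.
  apply: (le_trans (WEnergy_le am_gt0 am_le le_ap (H01_finite Hh))).
  by rewrite ler_piMr.
have Du := le_trans (dpotential_self_le Hu) (ler_wpM2r y0 zy).
have tM : theta * (W u / 2 - potential u) <= theta * `|M1|.
  by rewrite ler_pM2l// (le_trans uM)// ler_norm.
have := CP u Hu; move: tM; rewrite -{1}(sqr_sqrtr (W_ge0 Hu)); move: Du.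
move: (Num.sqrt (W u)) (dpotential u u) (potential u) (theta * `|M1|) => y D q m.
rewrite !expr2; lra.
Qed.

Section growth.
Variable x : 'rV[R]_2.
Hypothesis cf : continuous (f x).
Hypothesis sx : forall t : R, M0 <= t -> 0 < theta * F x t <= t * f x t.

Lemma primitive_nondecreasing s t : M0 <= s -> s <= t -> F x s <= F x t.
Proof.
move=> Ms st; have [c /andP[]] := primitive_MVT (@cf) st.
rewrite !bnd_simp => sc ct E; rewrite -subr_ge0 E mulr_ge0 ?subr_ge0//.
have Mc := le_trans Ms sc; have c0 := lt_le_trans M00 Mc.
have /andP[h1 h2] := sx Mc; have := lt_le_trans h1 h2.
by rewrite pmulr_rgt0// => /ltW.
Qed.

(** The mean value of [f x] on [[t, r t]] is at least [theta * F x t / (r * t)], because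
[F x] increases there and [theta * F x c <= c * f x c]. *)
Lemma primitive_ratio (r t : R) : 1 < r -> M0 <= t ->
  (1 + theta * (1 - r^-1)) * F x t <= F x (r * t).
Proof.
move=> r1 Mt; have r0 : 0 < r by rewrite (lt_trans _ r1).
have t0 := lt_le_trans M00 Mt.
have trt : t <= r * t by rewrite ler_peMl// ltW.
have [c /andP[]] := primitive_MVT (@cf) trt; rewrite !bnd_simp => tc crt E.
have Mc := le_trans Mt tc; have c0 := lt_le_trans t0 tc.
have /andP[h1 h2] := sx Mc.
rewrite mulrDl mul1r -lerBrDl E.
have fc : theta * F x t / (r * t) <= f x c.
  rewrite ler_pdivrMr ?mulr_gt0//.
  have fc0 : 0 <= f x c by have := lt_le_trans h1 h2; rewrite pmulr_rgt0// => /ltW.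
  apply: (@le_trans _ _ (c * f x c)); last by rewrite mulrC ler_wpM2l.
  apply: le_trans h2; rewrite ler_wpM2l ?(ltW theta0)//.
  exact: primitive_nondecreasing.
have d0 : 0 <= r * t - t by rewrite subr_ge0.
apply: le_trans (ler_wpM2r d0 fc).
suff -> : theta * F x t / (r * t) * (r * t - t) = theta * (1 - r^-1) * F x t by [].
by field; rewrite !lt0r_neq0.
Qed.

Lemma primitive_geometric (r : R) n : 1 < r ->
  (1 + theta * (1 - r^-1)) ^+ n * F x M0 <= F x (r ^+ n * M0).
Proof.
move=> r1; have r0 : 0 < r by rewrite (lt_trans _ r1).
elim: n => [|n IH]; first by rewrite !expr0 !mul1r.
have q0 : 0 <= 1 + theta * (1 - r^-1).
  by rewrite addr_ge0// mulr_ge0 ?(ltW theta0)// subr_ge0 invf_le1// ltW.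
rewrite !exprS -!mulrA; apply: le_trans (primitive_ratio r1 _).
  exact: ler_wpM2l.
by rewrite ler_peMl ?(ltW M00)// exprn_ege1// ltW.
Qed.

End growth.

End superquadratic.

(** * Multiples of a bump function *)

Lemma eq_action u v : (forall x, V x -> u x = v x) -> action u = action v.
Proof.
move=> uv; have -> : action u = W u / 2 - potential u by [].
rewrite (eq_WEnergy gasketV am_gt0 am_le le_ap uv).
suff -> : potential u = potential v by [].
by apply: eq_Rintegral => x /set_mem Vx; rewrite uv.
Qed.

Lemma action_nonzero u : action u != 0 -> exists2 x, V x & u x != 0.
Proof.
move=> u0; apply: contrapT => no; move: u0; rewrite -action0 => /negP; apply.
apply/eqP/eq_action => x Vx; apply/eqP/negPn/negP => ux; apply: no.
by exists x.
Qed.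

(** If [S u] were different from a minimizer [u], a step towards [S u] would decrease the
action. *)
Lemma action_minimizer_solution u : H01 p V u ->
  (forall v, H01 p V v -> action u <= action v) -> solution p V a f u.
Proof.
move=> Hu umin.
apply: (resolvent_fixed_solution Hu).
have Hh := H01B (resolvent_H01 Hu) Hu.
apply/eqP; rewrite eq_le Energy_ge0 andbT leNgt; apply/negP => d0.
have [s [/andP[s0 s1] sP]] := action_descent (En u) d0.
have := sP u Hu (lexx _) (lexx _) s; rewrite s0 lexx => /(_ isT) h.
have := le_trans (umin _ (H01D Hu (H01Z s Hh))) h.
by rewrite lerDl oppr_ge0 leNgt !mulr_gt0// divr_gt0.
Qed.

Section bump.
Variables (w : seq 'I_3) (e : fct) (c : R).
Hypotheses (He : H01 p V e) (e_ge0 : forall x, V x -> 0 <= e x) (c0 : 0 < c).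
Hypothesis e_gec : forall x, (Fword p w @` V) x -> c <= e x.

Let cell_sub x : (Fword p w @` V) x -> V x.
Proof. by move=> [y Vy <-]; exact: Fword_gasket. Qed.

Let V_ex : exists x, (Fword p w @` V) x.
Proof.
have [_ [y Vy] _] := gasketV.
by exists (Fword p w y), y.
Qed.

Lemma bump_Energy_gt0 : 0 < En e.
Proof.
have [x wx] := V_ex; rewrite lt_neqAle Energy_ge0 andbT; apply/eqP => E0.
have := H01_sup gasketV He (cell_sub wx); rewrite -E0 sqrtr0 mulr0 normr_le0 => /eqP ex.
by have := e_gec wx; rewrite ex leNgt c0.
Qed.

Lemma integrable_sqr u : H01 p V u -> mu.-integrable V (EFin \o (fun x => `|u x| ^+ 2)).
Proof.
move=> Hu; have cu := H01_continuous Hu.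
apply: (within_continuous_integrable p_equilateral gasketV).
under eq_fun do rewrite real_normK ?num_real// expr2.
by move=> x; apply: cvgM; exact: cu.
Qed.

Lemma bump_sqr_gt0 : 0 < \int[mu]_(x in V) `|e x| ^+ 2.
Proof.
apply: (Rintegral_cell_gt0 (w := w) p_equilateral gasketV (integrable_sqr He)).
  by apply: aeW => x _; rewrite sqr_ge0.
apply: aeW => x wx; rewrite exprn_gt0// normr_gt0 lt0r_neq0//.
exact: lt_le_trans c0 (e_gec wx).
Qed.

(** Near zero a nonlinearity of subquadratic growth dominates the energy. *)
Lemma action_lt0_small :
  (forall K : R, exists2 delta : R, 0 < delta &
     {ae mu, forall x, V x -> forall t : R,
        0 < `|t| < delta -> K <= F x t / `|t| ^+ 2}) ->
  exists2 v, H01 p V v & action v < 0.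
Proof.
move=> sub; have I0 := bump_sqr_gt0; set I := Rintegral _ _ _ in I0.
pose K := (W e / 2 + 1) / I; have [d d0 dP] := sub K.
have [B B0 eB] := within_continuous_bounded gasketV (H01_continuous He).
pose t := d / (B + B).
have t0 : 0 < t by rewrite divr_gt0// addr_gt0.
have Ht := H01Z t He; exists (fun x => t * e x) => //.
have ie : mu.-integrable V (EFin \o (fun x => K * t ^+ 2 * `|e x| ^+ 2)).
  by have := integrableZl mV (K * t ^+ 2) (integrable_sqr He); congr integrable.
have : K * t ^+ 2 * I <= potential (fun x => t * e x).
  rewrite /I -RintegralZl; [|exact: mV|exact: integrable_sqr].
  apply: (ae_le_Rintegral mV muC ie (int_F Ht)).
  apply: (ae_imply dP) => x dx Vx.
  have [->|ex0] := eqVneq (e x) 0.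
    by rewrite normr0 expr0n mulr0 mulr0 primitive0.
  have te0 : 0 < `|t * e x| by rewrite normr_gt0 mulf_neq0// lt0r_neq0.
  have := dx Vx (t * e x); rewrite te0/= => h.
  have : `|t * e x| < d.
    rewrite normrM gtr0_norm// (le_lt_trans (ler_wpM2l (ltW t0) (eB x Vx)))//.
    by rewrite /t mulrAC ltr_pdivrMr ?addr_gt0// ltr_pM2l// ltrDl.
  move=> /h; rewrite ler_pdivlMr ?exprn_gt0//.
  by rewrite normrM exprMn (gtr0_norm t0) mulrA.
have -> : K * t ^+ 2 * I = t ^+ 2 * (W e / 2 + 1).
  by rewrite /K; field; rewrite lt0r_neq0.
rewrite /action (WEnergyZ am_gt0 am_le le_ap t (H01_finite He)).
have : 0 < t ^+ 2 by rewrite exprn_gt0.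
move: (t ^+ 2) (W e) (potential _) => t2 w' q h1 h2; lra.
Qed.

(** A superquadratic nonlinearity dominates the energy far out: along a geometric
sequence of multiples of [e] the potential grows with a larger ratio than the
energy. *)
Lemma action_le0_large (theta M0 r : R) : 2 < theta -> 0 < M0 ->
  {ae mu, forall x, V x -> forall t : R,
     t <= - M0 \/ M0 <= t -> 0 < theta * F x t <= t * f x t} ->
  exists v, [/\ H01 p V v, action v <= 0 & r < En v].
Proof.
move=> th2 M00 AR; have th0 : 0 < theta by rewrite (lt_trans _ th2).
have cvg_geometric0 (z k : R) : `|k| < 1 -> z * k ^+ n @[n --> \oo] --> 0.
  by move=> k1; rewrite -(mulr0 z); apply: cvgMr; exact: cvg_expr.
have [rr [rr1 rq]] := superquadratic_ratio th2.
have rr0 : 0 < rr by rewrite (lt_trans _ rr1).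
pose q := 1 + theta * (1 - rr^-1).
have q0 : 0 < q by apply: lt_trans rq; rewrite exprn_gt0.
have [mf cf /(_ M0 M00)[fM [ifM fM0 fP]]] := f_caratheodory.
pose B := Fword p w @` V.
have mB : measurable (B : set gasket_space) by apply: closed_gasket_measurable; exact: cell_closed.
pose g (x : 'rV[R]_2) := F x M0 * \1_B x.
have HM : mu.-integrable V (EFin \o (fun x => F x M0)).
  have cM : {within V, continuous (fun=> M0)} by move=> x; exact: cst_continuous.
  exact: (integrable_primitive p_equilateral gasketV f_caratheodory cM).
have ig : mu.-integrable V (EFin \o g).
  apply: (ae_integrable_le mV muC (G := fun x => `|F x M0|)).
  - apply: measurable_funM.
    + exact: (measurable_primitive p_equilateral gasketV f_caratheodory M0).
    + exact: measurable_indic.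
  - by have := integrable_norm HM; congr integrable.
  - apply: aeW => x _; rewrite normrM ler_piMr// indicE.
    by case: (_ \in _); rewrite ?normr1 ?normr0.
have arp x : V x -> (V x -> forall t : R, t <= - M0 \/ M0 <= t ->
    0 < theta * F x t <= t * f x t) -> forall t, M0 <= t -> 0 < theta * F x t <= t * f x t.
  by move=> Vx h t Mt; apply: h => //; right.
have Fp x : V x -> (V x -> forall t : R, t <= - M0 \/ M0 <= t ->
    0 < theta * F x t <= t * f x t) -> 0 < F x M0.
  by move=> Vx h; have /andP[] := arp x Vx h M0 (lexx _); rewrite pmulr_rgt0.
have gpos : 0 < \int[mu]_(x in V) g x.
  apply: (Rintegral_cell_gt0 (w := w) p_equilateral gasketV ig).
    by apply: (ae_imply AR) => x h Vx; rewrite mulr_ge0// ltW// Fp.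
  apply: (ae_imply AR) => x h Bx; rewrite /g indicE mem_set// mulr1.
  exact: (Fp x (cell_sub Bx) h).
set G := Rintegral _ _ _ in gpos.
pose K := \int[mu]_(x in V) (M0 * fM x).
pose t1 := M0 / c; have t10 : 0 < t1 by rewrite divr_gt0.
pose t n := t1 * rr ^+ n.
have t0 n : 0 < t n by rewrite mulr_gt0// exprn_gt0.
have pot n : q ^+ n * G - K <= potential (fun x => t n * e x).
  have Ht := H01Z (t n) He.
  have iqg : mu.-integrable V (EFin \o (fun x => q ^+ n * g x)).
    by have := integrableZl mV (q ^+ n) ig; congr integrable.
  have iM : mu.-integrable V (EFin \o (fun x => M0 * fM x)).
    by have := integrableZl mV M0 ifM; congr integrable.
  rewrite /G -RintegralZl; [|exact: mV|exact: ig].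
  rewrite /K -RintegralB; [|exact: mV|exact: iqg|exact: iM].
  apply: (ae_le_Rintegral mV muC _ (int_F Ht)).
    by have := integrableB mV iqg iM; congr integrable.
  apply: (ae_imply2 cf (ae_imply2 AR fP (fun x => @conj _ _))).
  move=> x cfx [sx fx] Vx; have sx' := arp x Vx sx; have cx := cfx Vx.
  have tex : 0 <= t n * e x by rewrite mulr_ge0 ?(ltW (t0 n))// e_ge0.
  have lowF (s : R) : 0 <= s -> - (M0 * fM x) <= F x s.
    move=> s0; have [sM|Ms] := leP s M0.
      have sM' : `|s| <= M0 by rewrite ger0_norm.
      by have /ler_normlP[] := primitive_bound cx (fx Vx) sM'; rewrite lerNl.
    have /andP[+ _] := sx' s (ltW Ms); rewrite pmulr_rgt0// => h.
    by rewrite (le_trans _ (ltW h))// oppr_le0 mulr_ge0 ?(ltW M00)// fM0.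
  rewrite /g indicE; case: (boolP (x \in B)) => [/set_mem Bx|_]; last first.
    by rewrite !mulr0 sub0r lowF.
  rewrite mulr1; apply: (@le_trans _ _ (q ^+ n * F x M0)).
    by rewrite gerBl mulr_ge0 ?(ltW M00)// fM0.
  apply: (le_trans (primitive_geometric th2 M00 cx sx' n rr1)).
  apply: (primitive_nondecreasing M00 cx sx').
    by rewrite ler_peMl ?(ltW M00)// exprn_ege1// ltW.
  rewrite /t mulrAC mulrC ler_pM2r ?exprn_gt0//.
  by rewrite /t1 mulrAC ler_pdivlMr// ler_pM2l// e_gec.
pose A := t1 ^+ 2 * (W e / 2).
have E0 := bump_Energy_gt0.
have lim1 : (A * (rr ^+ 2 / q) ^+ n + K * q^-1 ^+ n) @[n --> \oo] --> 0.
  rewrite -(addr0 0); apply: cvgD; apply: cvg_geometric0.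
    rewrite ger0_norm ?divr_ge0 ?sqr_ge0 ?(ltW q0)//.
    by rewrite ltr_pdivrMr// mul1r.
  rewrite ger0_norm ?invr_ge0 ?(ltW q0)// invf_lt1//.
  by apply: lt_trans rq; rewrite exprn_egt1.
have lim2 : (r * (rr ^- 2) ^+ n) @[n --> \oo] --> 0.
  apply: cvg_geometric0.
  by rewrite ger0_norm ?invr_ge0 ?sqr_ge0// invf_lt1 ?exprn_gt0// exprn_egt1.
have tE : 0 < t1 ^+ 2 * En e by rewrite mulr_gt0// exprn_gt0.
have [n [n1 n2]] : exists n, A * (rr ^+ 2 / q) ^+ n + K * q^-1 ^+ n < G /\
    r * (rr ^- 2) ^+ n < t1 ^+ 2 * En e.
  apply: (@filter_ex _ \oo); apply: filterI.
    move/(@cvgrPdist_lt _ R^o): lim1 => /(_ _ gpos); apply: filterS => n.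
    by rewrite sub0r normrN; apply: le_lt_trans; exact: ler_norm.
  move/(@cvgrPdist_lt _ R^o): lim2 => /(_ _ tE); apply: filterS => n.
  by rewrite sub0r normrN; apply: le_lt_trans; exact: ler_norm.
exists (fun x => t n * e x); split; first exact: H01Z.
  rewrite /action (WEnergyZ am_gt0 am_le le_ap (t n) (H01_finite He)).
  have qn0 : 0 < q ^+ n by rewrite exprn_gt0.
  rewrite subr_le0; apply: le_trans (pot n).
  rewrite lerBrDr -ler_pdivrMl//; apply: le_trans (ltW n1).
  have tn : t n ^+ 2 = t1 ^+ 2 * (rr ^+ 2) ^+ n by rewrite exprMn -!exprM mulnC.
  rewrite tn /A (expr_div_n _ _ n) exprVn.
  move: ((rr ^+ 2) ^+ n) (q ^+ n) (t1 ^+ 2) qn0 => x y z y0.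
  suff -> : y^-1 * (z * x * W e / 2 + K) = z * (W e / 2) * (x / y) + K / y by [].
  by field; rewrite lt0r_neq0.
rewrite EnergyZ; last exact: H01_finite He.
rewrite /t exprMn -mulrA mulrCA -ltr_pdivrMl ?exprn_gt0// mulrC.
by move: n2; rewrite exprVn -exprM mulnC exprM.
Qed.

End bump.

(** * The coercive case and the mountain pass case *)

Let e_ex : exists w e c, [/\ H01 p V e, forall x, V x -> 0 <= e x, 0 < c
  & forall x, (Fword p w @` V) x -> c <= e x].
Proof.
have [b [b1 b2 b3 b4 b5]] := barycentric_coordinates p_equilateral.
have [e [He e0 ec]] := positive_H01_function gasketV b1 b2 b3 b4 b5.
exists [:: 2; 1], e, (4 / 25); split=> //.
by move=> _ [y Vy <-]; exact: ec.
Qed.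

(** The infimum [poincare_constant] is itself an admissible constant. The function [e] of
positive energy bounds the admissible constants from below. *)
Lemma poincare_inequality : 0 <= poincare_constant p V /\
  forall u, H01 p V u -> \int[mu]_(x in V) `|u x| ^+ 2 <= poincare_constant p V * En u.
Proof.
have [w [e [c [He e0 c0 ec]]]] := e_ex.
rewrite /poincare_constant; set P := [set C : R | _].
have P25 : P 25.
  move=> u Hu; have i25 := integrable_cst p_equilateral gasketV (25 * En u).
  have : \int[mu]_(x in V) `|u x| ^+ 2 <= \int[mu]_(x in V) (fun=> 25 * En u) x.
    apply: (ae_le_Rintegral mV muC (integrable_sqr Hu) i25).
    apply: aeW => x Vx; have h := H01_sup gasketV Hu Vx.
    have : `|u x| ^+ 2 <= (5 * Num.sqrt (En u)) ^+ 2.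
      by rewrite lerXn2r ?nnegrE ?mulr_ge0 ?sqrtr_ge0.
    by rewrite exprMn sqr_sqrtr ?Energy_ge0// -natrX.
  rewrite Rintegral_cst; last exact: mV.
  by rewrite (gasket_measure_gasket p_equilateral gasketV) mulr1.
have P0 : lbound P 0.
  move=> C PC; have := PC e He.
  have := bump_sqr_gt0 He c0 ec.
  move=> h1 h2; have := le_trans (ltW h1) h2.
  by rewrite pmulr_lge0//; exact: (bump_Energy_gt0 He c0 ec).
have Pne : P !=set0 by exists 25.
split=> [|u Hu]; first exact: lb_le_inf.
apply/ler_addgt0Pr => d d0.
have E1 : 0 < En u + 1 by rewrite ltr_wpDl// Energy_ge0.
have d1 : 0 < d / (En u + 1) by rewrite divr_gt0.
have [C PC Cd] := inf_adherent d1 (conj Pne (ex_intro _ 0 P0)).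
apply: (le_trans (PC u Hu)).
apply: (le_trans (ler_wpM2r (Energy_ge0 (p := p) u) (ltW Cd))).
rewrite mulrDl lerD2l mulrAC ler_pdivrMr// ler_wpM2l ?(ltW d0)//.
by rewrite lerDl.
Qed.

Lemma potential_continuity u (M e : R) : H01 p V u -> 0 < e -> exists2 d : R, 0 < d &
  forall v, H01 p V v -> En v <= M -> (forall x, V x -> `|v x - u x| < d) ->
    `|potential v - potential u| < e.
Proof.
move=> Hu e0; apply: contrapT => no.
have ex n : exists v, [/\ H01 p V v, En v <= M,
    forall x, V x -> `|v x - u x| < n.+1%:R^-1 & e <= `|potential v - potential u|].
  apply: contrapT => no'; apply: no; exists (n.+1%:R^-1); first by rewrite invr_gt0.
  move=> v Hv vM vu; rewrite ltNge; apply/negP => ev; apply: no'.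
  by exists v.
have [vs vsP] := choice ex.
have vu : uconv V vs u.
  move=> d d0; apply: filterS (near_infty_natSinv_lt (PosNum d0)) => n nd x Vx.
  by have [_ _ h _] := vsP n; exact: lt_trans (h x Vx) nd.
have := potential_cvg (M := M) _ _ vu.
move=> /(_ (fun n => let: And4 h _ _ _ := vsP n in h)).
move=> /(_ (fun n => let: And4 _ h _ _ := vsP n in h)).
move=> /cvgrPdist_lt/(_ _ e0)[N _ /(_ N (leqnn _))].
by rewrite distrC ltNge; have [_ _ _ ->] := vsP N.
Qed.

(** Below the first eigenvalue the action is coercive, so it has a minimizer. *)
Lemma subquadratic_solution (alpha : R) (beta : 'rV[R]_2 -> R) :
  alpha < am * lambda1 p V -> mu.-integrable V (EFin \o beta) ->
  {ae mu, forall x, V x -> forall t : R, F x t <= alpha / 2 * `|t| ^+ 2 + beta x} ->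
  (forall K : R, exists2 delta : R, 0 < delta &
     {ae mu, forall x, V x -> forall t : R,
        0 < `|t| < delta -> K <= F x t / `|t| ^+ 2}) ->
  exists u, solution p V a f u /\ exists2 x, V x & u x != 0.
Proof.
move=> al ib Fb sub; have [P0 PP] := poincare_inequality.
set C := poincare_constant p V in P0 PP.
(* For negative [alpha] the quadratic term is bounded by zero instead. *)
pose al' := Num.max alpha 0; have al0 : 0 <= al' by rewrite le_max lexx orbT.
have alle : alpha <= al' by rewrite le_max lexx.
have alC : al' * C < am.
  have [C0|C0] := eqVneq C 0; first by rewrite C0 mulr0.
  have Cp : 0 < C by rewrite lt_neqAle eq_sym C0.
  rewrite /al' /Num.max; case: ifP => _; first by rewrite mul0r.
  by rewrite -ltr_pdivlMr.
pose c0 := (am - al' * C) / 2.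
have c00 : 0 < c0 by rewrite divr_gt0// subr_gt0.
have [||u Hu umin] := @minimizer_exists
  potential c0 (\int[mu]_(x in V) beta x) c00.
- by move=> u Hu M e e0; exact: potential_continuity.
- move=> u Hu; have i2 := integrable_sqr Hu.
  have i2a : mu.-integrable V (EFin \o (fun x => alpha / 2 * `|u x| ^+ 2)).
    by have := integrableZl mV (alpha / 2) i2; congr integrable.
  have : potential u <= alpha / 2 * (\int[mu]_(x in V) `|u x| ^+ 2) +
      \int[mu]_(x in V) beta x.
    rewrite -RintegralZl; [|exact: mV|exact: i2].
    rewrite -RintegralD; [|exact: mV|exact: i2a|exact: ib].
    apply: (ae_le_Rintegral mV muC (int_F Hu)).
      by have := integrableD mV i2a ib; congr integrable.
    by apply: (ae_imply Fb) => x Fx Vx; exact: Fx.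
  have I0 : 0 <= \int[mu]_(x in V) `|u x| ^+ 2 by apply: Rintegral_ge0 => x _; rewrite sqr_ge0.
  have := ler_wpM2r I0 alle; have := ler_wpM2l al0 (PP u Hu).
  have := WEnergy_ge am_gt0 am_le le_ap (H01_finite Hu).
  rewrite /c0 mulrA; move: (W u) (En u) (potential u) (Rintegral _ _ _) (Rintegral _ _ _).
  by move: (al' * C) => k w E q I J; lra.
have umin' v : H01 p V v -> action u <= action v by exact: umin.
exists u; split.
  exact: action_minimizer_solution.
have [w [e [c [He e0 cc0 ec]]]] := e_ex.
have [v Hv v0] := action_lt0_small He cc0 ec sub.
apply: action_nonzero.
by apply: ltr0_neq0; exact: le_lt_trans (umin' v Hv) v0.
Qed.

(** Zero is separated from a function of nonpositive action by a sphere on which the action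
is positive; the sequence of approximate critical points found in this situation is
bounded and converges in energy to a fixed point of [S]. *)
Lemma superquadratic_solution (rho alpha theta M0 : R) :
  0 < rho -> alpha < am * rho ^+ 2 / 162 ->
  {ae mu, forall x, V x -> forall t : R, - rho <= t <= rho -> F x t <= alpha} ->
  2 < theta -> 0 < M0 ->
  {ae mu, forall x, V x -> forall t : R,
     t <= - M0 \/ M0 <= t -> 0 < theta * F x t <= t * f x t} ->
  exists u, solution p V a f u /\ exists2 x, V x & u x != 0.
Proof.
move=> rho0 al Fal th2 M00 AR.
have [w [e [c [He e0 cc0 ec]]]] := e_ex.
(* On the ball of radius [r] functions are bounded by [5 * r <= rho], and half the
   weighted energy on the sphere is at least [am * r ^+ 2 / 2 = am * rho ^+ 2 / 162]. *)
pose r := rho / 9; have r0 : 0 < r by rewrite divr_gt0.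
have [v [Hv av rv]] := action_le0_large He e0 cc0 ec (r ^+ 2) th2 M00 AR.
pose b := am * rho ^+ 2 / 162 - alpha; have b0 : 0 < b by rewrite subr_gt0.
have sphere u : H01 p V u -> En u = r ^+ 2 -> b <= action u.
  move=> Hu ur; have Wu := WEnergy_ge am_gt0 am_le le_ap (H01_finite Hu).
  have qu : potential u <= alpha.
    have -> : alpha = \int[mu]_(x in V) (fun=> alpha) x.
      rewrite Rintegral_cst; last exact: mV.
      by rewrite (gasket_measure_gasket p_equilateral gasketV) mulr1.
    apply: (ae_le_Rintegral mV muC (int_F Hu)).
      exact: integrable_cst p_equilateral gasketV alpha.
    apply: (ae_imply Fal) => x Fx Vx; apply: (Fx Vx); rewrite -ler_norml.
    have := H01_sup gasketV Hu Vx; rewrite ur sqrtr_sqr (gtr0_norm r0) => h.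
    by apply: (le_trans h); rewrite /r; lra.
  have -> : action u = W u / 2 - potential u by [].
  move: Wu; rewrite ur /b /r; have -> : am * (rho / 9) ^+ 2 = am * rho ^+ 2 / 81 by field.
  by move: (am * rho ^+ 2) (W u) (potential u) qu => x y z; lra.
have [M1 PS] := palais_smale_sequence r0 b0 Hv av rv sphere.
have [M EM] := palais_smale_bounded th2 M00 AR M1.
have n0 n : 0 < n.+1%:R^-1 :> R by rewrite invr_gt0.
have [us usP] := choice (fun n => PS _ (n0 n)).
have Hus n : H01 p V (us n) by case: (usP n).
have uM n : En (us n) <= M.
  have [_ /andP[_ h] hS] := usP n; apply: (EM _ (Hus n) h).
  by apply: (le_trans hS); rewrite invf_le1 ?ler1n ?ltr0n.
have [k [u [kn Hu uu]]] := H01_compact gasketV Hus uM.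
have HS := resolvent_H01 Hu.
have Su := resolvent_cvg (fun n => Hus (k n)) Hu (fun n => uM (k n)) uu.
have SS : econv p (fun n x => S (us (k n)) x - us (k n) x) (fun=> 0).
  move=> d d0; apply: filterS (near_infty_natSinv_lt (PosNum d0)) => n nd.
  under eq_fun do rewrite subr0.
  have [_ _ h] := usP (k n); apply: (le_trans h); apply: le_trans (ltW nd).
  by rewrite lef_pV2 ?posrE ?ltr0n// ler_nat ltnS.
have uS : econv p (us \o k) (S u).
  have := econvB (fun n => H01_finite (resolvent_H01 (Hus (k n)))) (H01_finite HS)
    (fun n => H01_finite (H01B (resolvent_H01 (Hus (k n))) (Hus (k n))))
    (H01_finite H01_0) Su SS.
  under eq_fun do (under eq_fun do rewrite opprB addrC subrK).
  by under [X in econv _ _ X -> _]eq_fun do rewrite subr0.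
have uE x : V x -> S u x = u x.
  move=> Vx; have h1 := uconv_cvg uu Vx.
  have h2 := uconv_cvg (econv_uconv gasketV (fun n => Hus (k n)) HS uS) Vx.
  exact: (cvg_unique _ h2 h1).
exists u; split.
  apply: (resolvent_fixed_solution Hu).
  rewrite -Energy0; apply: (eq_Energy gasketV) => x Vx.
  by rewrite uE// subrr.
have ca := action_cvg (fun n => Hus (k n)) HS (fun n => uM (k n)) uS.
have : b / 2 <= action (S u).
  rewrite -(cvg_lim (@Rhausdorff R) ca); apply: limr_ge.
    by apply: cvgP; exact: ca.
  apply: nearW => n.
  by have [_ /andP[]] := usP (k n).
rewrite (eq_action uE) => bu.
apply: action_nonzero.
apply: lt0r_neq0; apply: lt_le_trans bu; exact: divr_gt0.
Qed.

End nonlinearity.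
End variational.

(** * Existence of a nonzero solution *)

Theorem theorem15 (R : realType) (p : 'I_3 -> 'rV[R]_2) (V : set 'rV[R]_2)
  (a : 'rV[R]_2 -> R) (f : 'rV[R]_2 -> R -> R)
  (p_equilateral : equilateral p)
  (V_gasket : is_gasket p V)
  (a_gt0 : forall x, Vinfty p x -> 0 < a x)
  (a_inf_gt0 : 0 < inf (a @` Vinfty p))
  (a_sup_lty : has_ubound (a @` Vinfty p))
  (f_caratheodory : L1_Caratheodory V f)
  (f_growth :
    ((exists (alpha : R) (beta : 'rV[R]_2 -> R),
        [/\ alpha < inf (a @` Vinfty p) * lambda1 p V,
            (gasket_measure V).-integrable V (EFin \o beta),
            forall x, V x -> 0 <= beta x
          & {ae gasket_measure V, forall x, V x -> forall t : R,
               primitive f x t <= alpha / 2 * `|t| ^+ 2 + beta x}])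
     /\ (forall K : R, exists2 delta : R, 0 < delta &
           {ae gasket_measure V, forall x, V x -> forall t : R,
              0 < `|t| < delta -> K <= primitive f x t / `|t| ^+ 2}))
    \/
    ((exists rho alpha : R,
        [/\ 0 < rho, alpha < inf (a @` Vinfty p) * rho ^+ 2 / 162
          & {ae gasket_measure V, forall x, V x -> forall t : R,
               - rho <= t <= rho -> primitive f x t <= alpha}])
     /\ (exists theta M0 : R,
        [/\ 2 < theta, 0 < M0
          & {ae gasket_measure V, forall x, V x -> forall t : R,
               t <= - M0 \/ M0 <= t ->
               0 < theta * primitive f x t <= t * f x t}]))) :
  exists u : 'rV[R]_2 -> R,
    solution p V a f u /\ (exists2 x, V x & u x != 0).
Proof.
have a_lb : has_lbound (a @` Vinfty p).
  by exists 0 => _ [x Vx <-]; exact: ltW (a_gt0 x Vx).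
have am_le x : Vinfty p x -> inf (a @` Vinfty p) <= a x.
  by move=> Vx; apply: ge_inf => //; exists x.
have le_ap x : Vinfty p x -> a x <= sup (a @` Vinfty p).
  by move=> Vx; apply: ub_le_sup => //; exists x.
case: f_growth => [[[alpha [beta [al ib _ Fb]]] sub]|].
  exact: (subquadratic_solution p_equilateral V_gasket a_inf_gt0 am_le le_ap
    f_caratheodory al ib Fb sub).
move=> [[rho [alpha [rho0 al Fal]]] [theta [M0 [th2 M00 AR]]]].
exact: (superquadratic_solution p_equilateral V_gasket a_inf_gt0 am_le le_ap
  f_caratheodory rho0 al Fal th2 M00 AR).
Qed.
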